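(* Let $\varphi:\mathcal{A}^{\mathbb{N}}\to\mathbb{R}$ be a (normalized) potential of summable variation with equilibrium state $\mu_\varphi$. The return-time $L^q$-spectrum $\mathcal{R}_\varphi$ coincides with the waiting-time $L^q$-spectrum $\mathcal{W}_\varphi$ (as functions on $\mathbb{R}$) if and only if $\varphi=u-u\circ\theta-\log|\mathcal{A}|$ for some continuous function $u:\mathcal{A}^{\mathbb{N}}\to\mathbb{R}$. In that case $$\mathcal{W}_\varphi(q)=\mathcal{R}_\varphi(q)=\begin{cases} q\log|\mathcal{A}| & \text{for } q\ge-1,\\ -\log|\mathcal{A}| & \text{for } q<-1.\end{cases}$$
   Context: $\mathcal{A}$ is a finite alphabet (with at least two elements), $\mathbb{N}=\{0,1,2,\dots\}$, $\mathcal{A}^{\mathbb{N}}$ carries the product topology and its Borel $\sigma$-algebra, and $\theta$ is the left shift, $(\theta x)_i=x_{i+1}$. $\mathscr{M}_\theta(\mathcal{A}^{\mathbb{N}})$ is the set of $\theta$-invariant Borel probability measures. For $x\in\mathcal{A}^{\mathbb{N}}$, $x_i^j=(x_i,\dots,x_j)$. A potential $\varphi:\mathcal{A}^{\mathbb{N}}\to\mathbb{R}$ is of summable variation if $\sum_n \mathrm{var}_n(\varphi)<\infty$, where $\mathrm{var}_n(\varphi)=\sup\{|\varphi(x)-\varphi(y)|: x_0^{n-1}=y_0^{n-1}\}$. For a continuous potential $\psi$, the topological pressure is $P(\psi)=\sup_{\eta\in\mathscr{M}_\theta(\mathcal{A}^{\mathbb{N}})}\{h(\eta)+\int\psi\,d\eta\}$,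 where $h(\eta)$ is the measure-theoretic entropy of $\theta$ (natural logarithm). A potential $\varphi$ of summable variation has a unique equilibrium state $\mu_\varphi$, i.e. a unique invariant measure attaining the supremum defining $P(\varphi)$. Standing assumption: $\varphi$ is normalized, i.e. $\sum_{a\in\mathcal{A}}e^{\varphi(ax)}=1$ for all $x\in\mathcal{A}^{\mathbb{N}}$; in particular $P(\varphi)=0$ and $\varphi<0$. The return time is $R_n(x)=\inf\{k\ge1: x_k^{k+n-1}=x_0^{n-1}\}$ and the waiting time is $W_n(x,y)=\inf\{k\ge1: y_k^{k+n-1}=x_0^{n-1}\}$. The spectra are, for $q\in\mathbb{R}$, $$\mathcal{R}_\varphi(q)=\lim_n\frac1n\log\int R_n(x)^q\,d\mu_\varphi(x),\qquad \mathcal{W}_\varphi(q)=\lim_n\frac1n\log\iint W_n(x,y)^q\,d\mu_\varphi(x)\,d\mu_\varphi(y);$$ for normalized potentials of summable variation both limits exist for all $q\in\mathbb{R}$. It is known (Chazottes–Ugalde, 2005) that $\mathcal{W}_\varphi(q)=P((1-q)\varphi)$ for $q\ge-1$ and $\mathcal{W}_\varphi(q)=P(2\varphi)$ for $q<-1$. *)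

(* Defs.v *)
From HB Require Import structures.
From mathcomp Require Import all_boot all_order all_algebra.
From mathcomp Require Import all_classical all_reals all_analysis.

Set Implicit Arguments.
Unset Strict Implicit.
Unset Printing Implicit Defensive.

Import Order.TTheory GRing.Theory Num.Theory.
Import numFieldNormedType.Exports.

Local Open Scope classical_set_scope.
Local Open Scope ring_scope.

(* Alphabets are non-empty finite types. The distinguished point is there only
   because [measurableType] inherits from [pointedType]; nothing below uses it. *)
#[short(type="alphabetType")]
HB.structure Definition Alphabet := {A of Finite A & Pointed A}.

(* A^nat with the product of the discrete topologies and the Borel
   sigma-algebra of that topology. *)
Definition shift_space (A : alphabetType) : Type :=
  prod_topology (fun _ : nat => discrete_topology A).

HB.instance Definition _ (A : alphabetType) := Pointed.on (shift_space A).
HB.instance Definition _ (A : alphabetType) := Nbhs.on (shift_space A).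
HB.instance Definition _ (A : alphabetType) := Topological.on (shift_space A).
HB.instance Definition _ (A : alphabetType) := Uniform.on (shift_space A).
HB.instance Definition _ (A : alphabetType) :=
  Measurable.copy (shift_space A)
    (g_sigma_algebraType (@open (shift_space A))).

Section entropy.
Context {d : measure_display} {X : measurableType d} {R : realType}.
Implicit Types (T : X -> X) (mu : probability X R).

Definition invariant_measure T mu : Prop :=
  forall B : set X, measurable B -> mu (T @^-1` B) = mu B.

Definition finite_measurable_partition (k : nat) (P : 'I_k -> set X) : Prop :=
  [/\ forall i, measurable (P i),
      trivIset [set: 'I_k] P
    & \bigcup_(i in [set: 'I_k]) P i = [set: X]].

(* The atoms of the join of P, T^{-1} P, ..., T^{-(n-1)} P are indexed by words
   w of length n; empty atoms are harmless since 0 * ln 0 = 0. *)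
Definition join_atom T (k : nat) (P : 'I_k -> set X) (n : nat)
    (w : {ffun 'I_n -> 'I_k}) : set X :=
  [set x | forall i : 'I_n, P (w i) (iter i T x)].

Definition join_entropy T mu (k : nat) (P : 'I_k -> set X) (n : nat) : R :=
  - \sum_(w : {ffun 'I_n -> 'I_k})
      fine (mu (join_atom T P w)) * ln (fine (mu (join_atom T P w))).

Definition partition_entropy T mu (k : nat) (P : 'I_k -> set X) : \bar R :=
  limn (fun n : nat => (n%:R^-1 * join_entropy T mu P n)%:E).

Definition measure_entropy T mu : \bar R :=
  ereal_sup [set h | exists (k : nat) (P : 'I_k -> set X),
    finite_measurable_partition P /\ h = partition_entropy T mu P].

End entropy.

(* t ^ q for t in [1, +oo]. Unlike [poweR], for which +oo `^ q = +oo as soon as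
   q <> 0, this gives (+oo) ^ q = 0 for q < 0. *)
Definition time_power {R : realType} (t : \bar R) (q : R) : \bar R :=
  expeR (q%:E * lne t)%E.

Section symbolic.
Context {R : realType} {A : alphabetType}.
Implicit Types (x y : shift_space A) (phi psi : shift_space A -> R).
Implicit Types (mu : probability (shift_space A) R).

Definition left_shift x : shift_space A := fun i : nat => x i.+1.

Definition prepend (a : A) x : shift_space A :=
  fun i : nat => if i is j.+1 then x j else a.

(* x_0^{n-1} = y_0^{n-1} *)
Definition agree (n : nat) x y : Prop := forall i : nat, (i < n)%N -> x i = y i.

Definition nth_variation phi (n : nat) : \bar R :=
  ereal_sup [set (`|phi p.1 - phi p.2|)%:E | p in
    [set p : shift_space A * shift_space A | agree n p.1 p.2]].

Definition summable_variation phi : Prop :=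
  (\sum_(0 <= n <oo) nth_variation phi n < +oo)%E.

Definition normalized phi : Prop :=
  forall x, \sum_(a : A) expR (phi (prepend a x)) = 1.

Definition free_energy psi mu : \bar R :=
  (measure_entropy left_shift mu + \int[mu]_x (psi x)%:E)%E.

Definition pressure psi : \bar R :=
  ereal_sup [set free_energy psi eta | eta in
    [set eta : probability (shift_space A) R |
      invariant_measure left_shift eta]].

Definition equilibrium_state phi mu : Prop :=
  invariant_measure left_shift mu /\ free_energy phi mu = pressure phi.

(* Both times are +oo when there is no occurrence. *)
Definition return_time (n : nat) x : \bar R :=
  ereal_inf [set k%:R%:E | k in
    [set k : nat | (1 <= k)%N /\ agree n (iter k left_shift x) x]].

Definition waiting_time (n : nat) x y : \bar R :=
  ereal_inf [set k%:R%:E | k in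
    [set k : nat | (1 <= k)%N /\ agree n (iter k left_shift y) x]].

Definition return_spectrum mu (q : R) : \bar R :=
  limn (fun n : nat =>
    (n%:R^-1)%:E * lne (\int[mu]_x time_power (return_time n x) q))%E.

Definition waiting_spectrum mu (q : R) : \bar R :=
  limn (fun n : nat =>
    (n%:R^-1)%:E *
      lne (\int[mu]_y \int[mu]_x time_power (waiting_time n x y) q))%E.

End symbolic.

(* Main.v *)
Require Import Defs.
From HB Require Import structures.
From mathcomp Require Import all_boot all_order all_algebra.
From mathcomp Require Import all_classical all_reals all_analysis.
From mathcomp Require Import measurable_realfun.
From mathcomp Require Import zify ring lra.

Set Implicit Arguments.
Unset Strict Implicit.
Unset Printing Implicit Defensive.

Import Order.TTheory GRing.Theory Num.Theory.
Import numFieldNormedType.Exports.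

Local Open Scope classical_set_scope.
Local Open Scope ring_scope.

(** Why the theorem holds.

    Write [S_n phi] for Birkhoff sums, [[w]] for the cylinder of a word [w], [P]
    for the pressure, and [gamma] for the supremum of the averages of [phi] along
    periodic orbits ([max_mean]). Summable variation gives bounded distortion:
    [S_n phi x] and [S_n phi y] differ by at most a constant [C] when [x] and
    [y] have the same first [n] letters.

    Equilibrium states are Gibbs measures. For every normalized potential [psi]
    of bounded distortion and every invariant [eta],
    [h(eta) <= - int psi d eta] ([measure_entropy_le]): by Gibbs' inequality,
    the entropy of the itineraries through any finite partition is at most the
    cost of coding them with the probability that [psi] puts on words, once the
    partition is approximated by cylinders. Conversely a measure built as a
    limit of averages of the iterates of the transfer operator has non-negative
    free energy, so [P(phi) >= 0] ([pressure_ge0]). Hence the equilibrium state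
    [mu] satisfies [h(mu) >= - int phi d mu]. The variational inequality for a
    tilt of [phi] in the direction of the indicator of a cylinder, normalized
    again, then forces [mu] to be fixed by the dual of the transfer operator on
    cylinders ([transfer_invariant]), whence
    [exp(S_n phi x - C) <= mu [x_0 ... x_(n-1)] <= exp(S_n phi x + C)]
    ([gibbs_bounds]). Everything else only uses this estimate and invariance.

    Equality of the spectra implies that [phi] is a coboundary plus a constant.
    It is enough to look at [q = -1]. If the return time of [x] is at most [k]
    then [x] starts by shadowing a [k]-periodic orbit during [n] steps; so
    [mu (R_n = k)] is at most of order [exp(n gamma)] whatever [k], and the
    return spectrum at [-1] is [gamma] ([return_spectrum_N1]). For the waiting
    time, [mu x mu (W_n = k)] is at most the mean measure
    [int mu [x_0 ... x_(n-1)] d mu] of a cylinder. If some periodic orbit has an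
    average smaller than [gamma], a long piece of it lowers the Birkhoff sum more
    than the rest of the orbit can recover, and the mixing of [mu] makes visits
    to this piece frequent; the mean measure is then exponentially smaller than
    [exp(n gamma)] ([cyl_measure_decay]) and the spectra differ at [-1]. So all
    periodic orbits have average [gamma], normalization gives
    [gamma = - ln #|A|] ([uniform_mean]), and a Livsic argument produces the
    transfer function ([livsic]).

    Conversely, if [phi = u - u o theta - ln #|A|], Birkhoff sums telescope along
    periodic orbits, and by bounded distortion every cylinder of length [n] has a
    measure of order [#|A| ^ - n]. For both [R_n] and [W_n], a given value then
    has probability at most of order [#|A| ^ - n], the value [1] has at least
    this order, and having no occurrence during [j] successive blocks of length
    [n] has probability at most [(1 - c #|A| ^ - n) ^ j]. These three facts
    determine the exponential rates of all the moments ([moment_rate]). *)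

(** * Sequences, words and cylinders *)

Section shift.
Context {A : alphabetType}.
Notation X := (shift_space A).
Implicit Types (x y z : X) (n m k : nat) (B : set X).

Lemma agree_sym n x y : agree n x y -> agree n y x.
Proof. by move=> h i /h. Qed.

Lemma agree_trans n x y z : agree n x y -> agree n y z -> agree n x z.
Proof. by move=> h1 h2 i ni; rewrite h1// h2. Qed.

Lemma agree_le m n x y : (m <= n)%N -> agree n x y -> agree m x y.
Proof. by move=> mn h i im; apply: h; exact: leq_trans mn. Qed.

Lemma iter_shiftE k x i : iter k left_shift x i = x (k + i)%N.
Proof.
elim: k x i => [//|k IH] x i; rewrite iterS /left_shift IH.
by rewrite addnS addSn.
Qed.

Lemma agree_shift k n x y :
  agree (k + n) x y -> agree n (iter k left_shift x) (iter k left_shift y).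
Proof. by move=> h i ni; rewrite !iter_shiftE h// ltn_add2l. Qed.

Lemma agree_add k n x y : agree k x y ->
  agree n (iter k left_shift x) (iter k left_shift y) -> agree (k + n) x y.
Proof.
move=> h1 h2 i; case: (ltnP i k) => [ik _|ki ikn]; first exact: h1.
by have := h2 (i - k)%N; rewrite !iter_shiftE subnKC//; apply; lia.
Qed.

Lemma agree_prepend a n x y :
  agree n x y -> agree n.+1 (prepend a x) (prepend a y).
Proof. by move=> h [//|i] ni; exact: h. Qed.

Lemma left_shift_prepend a x : left_shift (prepend a x) = x.
Proof. by []. Qed.

Lemma prepend_left_shift x : prepend (x 0%N) (left_shift x) = x.
Proof. by apply/funext => -[|i]. Qed.

(** The word [x_0 ... x_(n-1)], as an element of a finite type. *)
Definition initial n x : n.-tuple A := [tuple x i | i < n].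

Lemma initialP n x y : initial n x = initial n y <-> agree n x y.
Proof.
split=> [h i ni|h].
  have := congr1 (fun t => tnth t (Ordinal ni)) h.
  by rewrite !tnth_mktuple.
by apply: eq_from_tnth => i; rewrite !tnth_mktuple; apply: h.
Qed.

Lemma nth_initial n x i : (i < n)%N -> nth point (initial n x) i = x i.
Proof. by move=> ni; rewrite -(tnth_nth point _ (Ordinal ni)) tnth_mktuple. Qed.

(** The sequence that reads the word [w], then [x]. *)
Definition concat (w : seq A) x : X := foldr prepend x w.

Lemma concat_nth w x i :
  concat w x i = if (i < size w)%N then nth point w i else x (i - size w)%N.
Proof.
by elim: w i => [|a w IH] [|i] /=.
Qed.

Lemma concat_agree w x y : agree (size w) (concat w x) (concat w y).
Proof. by move=> i h; rewrite !concat_nth h. Qed.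

Lemma initial_concat n (w : n.-tuple A) x : initial n (concat w x) = w.
Proof.
apply: eq_from_tnth => i; rewrite tnth_mktuple concat_nth size_tuple ltn_ord.
by rewrite (tnth_nth point).
Qed.

Lemma iter_shift_concat w x : iter (size w) left_shift (concat w x) = x.
Proof. by elim: w => //= a w IH; rewrite -iterS iterSr left_shift_prepend. Qed.

Lemma iter_shift_concat_tuple n (w : n.-tuple A) x :
  iter n left_shift (concat w x) = x.
Proof. by have := iter_shift_concat w x; rewrite size_tuple. Qed.

Lemma concat_initial_agree n x y : agree n x (concat (initial n x) y).
Proof. by apply/initialP; rewrite initial_concat. Qed.

Lemma concat_initial_shift n x :
  concat (initial n x) (iter n left_shift x) = x.
Proof.
apply/funext => i; rewrite concat_nth size_tuple.
case: ltnP => h; last by rewrite iter_shiftE subnKC.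
by rewrite -(tnth_nth point _ (Ordinal h)) tnth_mktuple.
Qed.

(** The periodic sequence [w w w ...]; for a non-empty [w] the default value
    [point] is never read. *)
Definition repeat_word (w : seq A) : X := fun i => nth point w (i %% size w).

Lemma repeat_word_shift w : iter (size w) left_shift (repeat_word w) = repeat_word w.
Proof. by apply/funext => i; rewrite iter_shiftE /repeat_word modnDl. Qed.

Lemma repeat_word_agree n x : agree n x (repeat_word (initial n x)).
Proof.
move=> i ni; rewrite /repeat_word size_tuple modn_small//.
by rewrite -(tnth_nth point _ (Ordinal ni)) tnth_mktuple.
Qed.

(** A sequence whose word of length [n] occurs again at time [k] agrees up to
    [n + k] with a [k]-periodic one. *)
Lemma agree_repeat_word n k x : (0 < k)%N -> agree n (iter k left_shift x) x ->
  agree (n + k) x (repeat_word (initial k x)).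
Proof.
move=> k0 h i; elim/ltn_ind: i => i IH ink.
case: (ltnP i k) => [ik|ki]; first exact: repeat_word_agree.
have := h (i - k)%N; rewrite iter_shiftE subnKC// => -> //; last by lia.
rewrite IH; [|lia..].
rewrite /repeat_word size_tuple; congr nth.
by rewrite -[in RHS](subnK ki) modnDr.
Qed.

(** ** Finite-dimensional sets and functions *)

(** [B] only depends on the first [n] letters. *)
Definition fdim n B := forall x y, agree n x y -> B x -> B y.

(** [f] only depends on the first [n] letters. *)
Definition fdim_fun {V : Type} n (f : X -> V) :=
  forall x y, agree n x y -> f x = f y.

Lemma fdim_le m n B : (m <= n)%N -> fdim m B -> fdim n B.
Proof. by move=> mn h x y xy; apply: h; exact: agree_le xy. Qed.

Lemma fdimI n B1 B2 : fdim n B1 -> fdim n B2 -> fdim n (B1 `&` B2).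
Proof. by move=> h1 h2 x y xy [/h1 b1 /h2 b2]; split; [exact: b1|exact: b2]. Qed.

Lemma fdimU n B1 B2 : fdim n B1 -> fdim n B2 -> fdim n (B1 `|` B2).
Proof.
by move=> h1 h2 x y xy [/h1 b1|/h2 b2]; [left; exact: b1|right; exact: b2].
Qed.

Lemma fdimC n B : fdim n B -> fdim n (~` B).
Proof. by move=> h x y xy nb b; apply: nb; exact: h (agree_sym xy) b. Qed.

Lemma fdim_mem n B x y : fdim n B -> agree n x y -> (x \in B) = (y \in B).
Proof.
move=> nB xy; apply/idP/idP; rewrite !inE; apply: nB => //; exact: agree_sym.
Qed.

Lemma fdim_agree n x : fdim n [set y | agree n x y].
Proof. by move=> y z yz /= xy; exact: agree_trans xy yz. Qed.

Lemma fdim_return n k : fdim (k + n) [set x | agree n (iter k left_shift x) x].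
Proof.
move=> x y xy h i ni; rewrite iter_shiftE -!xy; [|lia..].
by rewrite -iter_shiftE h.
Qed.

(** Cylinders form a basis of the product topology. *)
Lemma nbhs_agreeP x B : nbhs x B <-> exists n, forall y, agree n x y -> B y.
Proof.
split=> [|[n nB]].
  pose F : set_system X := [set C | exists n, forall y, agree n x y -> C y].
  have FF : Filter F.
    split.
    - by exists 0%N.
    - move=> P Q [n Pn] [m Qm]; exists (maxn n m) => y xy; split.
        by apply: Pn; apply: agree_le xy; exact: leq_maxl.
      by apply: Qm; apply: agree_le xy; exact: leq_maxr.
    - by move=> P Q PQ [n Pn]; exists n => y /Pn /PQ.
  have : F --> x.
    apply/cvg_sup => i; apply/cvg_image => //=.
      apply/seteqP; split; first by [].
      by move=> b Tb; exists (fun _ : nat => b).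
    move=> C /nbhs_singleton Cx.
    exists [set f | C (f i)].
      by exists i.+1 => y /(_ i (ltnSn i)) /= <-.
    apply/seteqP; split; first by move=> _ [y Cy <-].
    by move=> b Cb; exists (fun _ : nat => b).
  by apply.
apply: (@filterS _ _ _ [set y | agree n x y]) => //.
elim: n {nB} => [|n IH]; first exact: filterS filterT.
have nx : nbhs x [set y : X | y n = x n].
  apply: open_nbhs_nbhs; split => //.
  have /continuousP : continuous (fun y : X => (y n : discrete_topology A)).
    exact: (@proj_continuous _ (fun _ : nat => discrete_topology A) n).
  by move=> /(_ [set x n]); apply; exact: discrete_open.
apply: filterS2 IH nx => y xy /= yn i; rewrite ltnS leq_eqVlt => /orP[/eqP ->//|].
exact: xy.
Qed.

Lemma fdim_open n B : fdim n B -> open B.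
Proof.
move=> nB; rewrite openE => x Bx; apply/nbhs_agreeP.
by exists n => y xy; exact: nB Bx.
Qed.

Lemma fdim_measurable n B : fdim n B -> measurable B.
Proof. by move=> /fdim_open; exact: sub_sigma_algebra. Qed.

Lemma open_measurable_shift B : open B -> measurable B.
Proof. exact: sub_sigma_algebra. Qed.

(** Every open set is the increasing union of its finite-dimensional cores. *)
Lemma open_bigcup_fdim B : open B ->
  B = \bigcup_n [set x | forall y, agree n x y -> B y].
Proof.
rewrite openE => oB; rewrite eqEsubset; split => [x /oB|x [n _ /=]]; last exact.
by move=> /nbhs_agreeP[n nB]; exists n.
Qed.

Lemma fdim_core n B : fdim n [set x | forall y, agree n x y -> B y].
Proof. by move=> x y xy /= h z yz; apply: h; exact: agree_trans xy yz. Qed.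

(** Finite-dimensional sets generate the Borel sigma-algebra. *)
Lemma measurable_fdimE :
  (measurable : set (set X)) = <<s [set B | exists n, fdim n B] >>.
Proof.
rewrite eqEsubset; split.
  apply: smallest_sub; first exact: smallest_sigma_algebra.
  move=> B oB; rewrite (open_bigcup_fdim oB).
  apply: sigma_algebra_bigcup => n; apply: sub_sigma_algebra.
  by exists n; exact: fdim_core.
apply: smallest_sub; first exact: sigma_algebra_measurable.
by move=> B [n /fdim_measurable].
Qed.

Lemma setI_closed_fdim : setI_closed [set B | exists n, fdim n B].
Proof.
move=> B1 B2 [n h1] [m h2]; exists (maxn n m); apply: fdimI.
  by apply: fdim_le h1; exact: leq_maxl.
by apply: fdim_le h2; exact: leq_maxr.
Qed.

Lemma measurable_fun_left_shift : measurable_fun [set: X] (@left_shift A).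
Proof.
apply: (measurability [set B | exists n, fdim n B]).
  exact: measurable_fdimE.
move=> _ [B [n nB] <-]; apply: (@fdim_measurable n.+1); rewrite setTI.
by move=> x y xy /=; apply: nB; exact: (@agree_shift 1).
Qed.

Lemma measurable_fun_iter_shift k :
  measurable_fun [set: X] (iter k (@left_shift A)).
Proof.
elim: k => [|k IH]; first exact: measurable_id.
exact: (measurableT_comp measurable_fun_left_shift IH).
Qed.

End shift.

(** * Real-valued probabilities and integrals of bounded functions *)

Section real_probability.
Context {d : measure_display} {T : measurableType d} {R : realType}.
Variable P : probability T R.
Implicit Types (B : set T) (f g : T -> R).

(** The probability of [B] as a real number. *)
Definition pr B : R := fine (P B).

Lemma prE B : measurable B -> P B = (pr B)%:E.
Proof. by move=> mB; rewrite /pr fineK// fin_num_measure. Qed.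

Lemma pr_ge0 B : 0 <= pr B. Proof. exact: fine_ge0. Qed.

Lemma pr_le B1 B2 : measurable B1 -> measurable B2 -> B1 `<=` B2 ->
  pr B1 <= pr B2.
Proof.
by move=> m1 m2 s; rewrite -lee_fin -!prE//; apply: le_measure => //; rewrite inE.
Qed.

Lemma pr_setT : pr setT = 1. Proof. by rewrite /pr probability_setT. Qed.

Lemma pr_le1 B : measurable B -> pr B <= 1.
Proof. by move=> mB; rewrite -pr_setT; exact: pr_le. Qed.

Lemma pr_set0 : pr set0 = 0. Proof. by rewrite /pr measure0. Qed.

Lemma prU B1 B2 : measurable B1 -> measurable B2 -> B1 `&` B2 = set0 ->
  pr (B1 `|` B2) = pr B1 + pr B2.
Proof.
move=> m1 m2 h; apply: EFin_inj; rewrite EFinD -!prE//; last exact: measurableU.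
exact: measureU.
Qed.

Lemma prU_le B1 B2 : measurable B1 -> measurable B2 ->
  pr (B1 `|` B2) <= pr B1 + pr B2.
Proof.
move=> m1 m2; rewrite -lee_fin EFinD -!prE//; last exact: measurableU.
exact: measureU2.
Qed.

Lemma prC B : measurable B -> pr (~` B) = 1 - pr B.
Proof.
move=> mB; apply/eqP; rewrite eq_sym subr_eq eq_sym addrC; apply/eqP.
rewrite -prU//; [|exact: measurableC|exact: setICr].
by rewrite setUCr pr_setT.
Qed.

Lemma pr_bigcup_le (I : finType) (F : I -> set T) :
  (forall i, measurable (F i)) -> pr (\bigcup_i F i) <= \sum_i pr (F i).
Proof.
move=> mF; suff H (s : seq I) : pr (\bigcup_(i in [set` s]) F i) <= \sum_(i <- s) pr (F i).
  have -> : \bigcup_i F i = \bigcup_(i in [set` index_enum I]) F i.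
    by apply: eq_bigcupl; split => i // _ /=; rewrite mem_index_enum.
  exact: H.
rewrite bigcup_seq; elim: s => [|a s IH]; first by rewrite !big_nil pr_set0.
rewrite !big_cons; apply: le_trans (lerD (lexx _) IH); apply: prU_le => //.
exact: bigsetU_measurable.
Qed.

(** Bounded measurable functions: the class on which all real integrals are
    taken. *)
Definition bmeas f := measurable_fun setT f /\ exists M, forall x, `|f x| <= M.

Lemma bmeas_integrable f : bmeas f -> P.-integrable setT (EFin \o f).
Proof.
move=> [mf [M fM]]; apply: measurable_bounded_integrable => //.
  by rewrite -ge0_fin_numE// fin_num_measure.
by exists M; split; [exact: num_real|move=> r Mr x _; exact: le_trans (fM x) (ltW Mr)].
Qed.

Lemma bmeas_cst c : bmeas (cst c).
Proof. by split; [exact: measurable_cst|exists `|c|]. Qed.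

Lemma bmeasD f g : bmeas f -> bmeas g -> bmeas (fun x => f x + g x).
Proof.
move=> [mf [M fM]] [mg [N gN]]; split; first exact: measurable_funD.
by exists (M + N) => x; rewrite (le_trans (ler_normD _ _))// lerD.
Qed.

Lemma bmeasM f g : bmeas f -> bmeas g -> bmeas (fun x => f x * g x).
Proof.
move=> [mf [M fM]] [mg [N gN]]; split; first exact: measurable_funM.
by exists (M * N) => x; rewrite normrM ler_pM.
Qed.

Lemma bmeasZ c f : bmeas f -> bmeas (fun x => c * f x).
Proof. exact: bmeasM (bmeas_cst c). Qed.

Lemma bmeas_sum I (s : seq I) (F : I -> T -> R) : (forall i, bmeas (F i)) ->
  bmeas (fun x => \sum_(i <- s) F i x).
Proof.
move=> h; elim: s => [|a s IH].
  by under eq_fun do rewrite big_nil; exact: bmeas_cst.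
by under eq_fun do rewrite big_cons; exact: bmeasD.
Qed.

Lemma bmeas_indic B : measurable B -> bmeas (\1_B : T -> R).
Proof.
move=> mB; split; first exact: measurable_indic.
by exists 1 => x; rewrite indicE ger0_norm ?ler0n//; case: (_ \in _).
Qed.

Lemma Rint_ge0 f : (forall x, 0 <= f x) -> 0 <= \int[P]_x f x.
Proof. by move=> f0; apply: Rintegral_ge0. Qed.

Lemma Rint_le f g : bmeas f -> bmeas g -> (forall x, f x <= g x) ->
  \int[P]_x f x <= \int[P]_x g x.
Proof. by move=> bf bg fg; apply: le_Rintegral => //; exact: bmeas_integrable. Qed.

Lemma RintD f g : bmeas f -> bmeas g ->
  \int[P]_x (f x + g x) = \int[P]_x f x + \int[P]_x g x.
Proof. by move=> bf bg; apply: RintegralD => //; exact: bmeas_integrable. Qed.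

Lemma RintZ c f : bmeas f -> \int[P]_x (c * f x) = c * \int[P]_x f x.
Proof. by move=> bf; apply: RintegralZl => //; exact: bmeas_integrable. Qed.

Lemma Rint_sum I (s : seq I) (F : I -> T -> R) : (forall i, bmeas (F i)) ->
  \int[P]_x (\sum_(i <- s) F i x) = \sum_(i <- s) \int[P]_x F i x.
Proof.
move=> h; elim: s => [|a s IH].
  under eq_Rintegral do rewrite big_nil.
  by rewrite big_nil Rintegral_cst// mul0r.
under eq_Rintegral do rewrite big_cons.
by rewrite big_cons RintD ?IH//; exact: bmeas_sum.
Qed.

Lemma Rint_cst c : \int[P]_x c = c.
Proof. by rewrite Rintegral_cst// [fine _]pr_setT mulr1. Qed.

Lemma Rint_indic B : measurable B -> \int[P]_x \1_B x = pr B.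
Proof.
move=> mB; rewrite /Rintegral /pr; congr fine.
by rewrite integral_indic// setIT.
Qed.

Lemma EFin_Rint f : bmeas f -> (\int[P]_x (f x)%:E)%E = (\int[P]_x f x)%:E.
Proof.
by move=> /bmeas_integrable h; rewrite /Rintegral fineK// integrable_fin_num.
Qed.

(** ** Random variables with finitely many values *)
Section finite_valued.
Variables (I : finType) (xi : T -> I).
Hypothesis mxi : forall i, measurable (xi @^-1` [set i]).

Let finE (F : I -> R) x :
  F (xi x) = \sum_i F i * (\1_(xi @^-1` [set i]) x).
Proof.
rewrite (bigD1 (xi x))//= indicE mem_set// mulr1 big1 ?addr0// => i xii.
by rewrite indicE memNset ?mulr0//= => /esym/eqP; rewrite (negbTE xii).
Qed.

Lemma bmeas_finite (F : I -> R) : bmeas (fun x => F (xi x)).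
Proof.
under eq_fun do rewrite finE.
by apply: bmeas_sum => i; apply: bmeasZ; exact: bmeas_indic.
Qed.

Lemma Rint_finite (F : I -> R) :
  \int[P]_x F (xi x) = \sum_i F i * pr (xi @^-1` [set i]).
Proof.
under eq_Rintegral do rewrite finE.
rewrite Rint_sum; last by move=> i; apply: bmeasZ; exact: bmeas_indic.
apply: eq_bigr => i _; rewrite RintZ; last exact: bmeas_indic.
by rewrite Rint_indic.
Qed.

Lemma pr_finite_sum : \sum_i pr (xi @^-1` [set i]) = 1.
Proof.
have := Rint_finite (cst 1); rewrite /= Rint_cst => ->.
by apply: eq_bigr => i _; rewrite mul1r.
Qed.

End finite_valued.

Lemma Rint_preserving (th : T -> T) f : measurable_fun setT th ->
  invariant_measure th P -> bmeas f -> \int[P]_x f (th x) = \int[P]_x f x.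
Proof.
move=> mth inv bf; rewrite /Rintegral; congr fine.
have -> : (\int[P]_x (f x)%:E = \int[pushforward P th]_x (f x)%:E)%E.
  by apply: eq_measure_integral => B mB _; rewrite /= /pushforward inv.
rewrite (integral_pushforward mth)//.
- by apply/measurable_EFinP; case: bf.
- rewrite preimage_setT; apply: (bmeas_integrable (f := f \o th)); split.
    by apply: measurableT_comp => //; case: bf.
  by case: bf => _ [M fM]; exists M => x; exact: fM.
Qed.

End real_probability.
Arguments bmeas {d T R} f.
#[global] Hint Resolve pr_ge0 : core.

(** * Approximation by finitely many coordinates *)

Section approximation.
Context {R : realType} {A : alphabetType}.
Notation X := (shift_space A).
Variable mu : probability X R.
Implicit Types (B E : set X).

Let sdiff B E := (B `\` E) `|` (E `\` B).

(** [B] is arbitrarily close in measure to finite-dimensional sets. *)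
Let approx B := measurable B /\ forall eps : R, 0 < eps ->
  exists n E, fdim n E /\ pr mu (sdiff B E) < eps.

Let measurable_sdiff B E : measurable B -> measurable E -> measurable (sdiff B E).
Proof. by move=> mB mE; apply: measurableU; apply: measurableD. Qed.

Let sdiff_trans B E F : sdiff B F `<=` sdiff B E `|` sdiff E F.
Proof.
move=> x; rewrite /sdiff /=.
by case: (pselect (E x)); tauto.
Qed.

Let approxU B1 B2 : approx B1 -> approx B2 -> approx (B1 `|` B2).
Proof.
move=> [m1 a1] [m2 a2]; split; first exact: measurableU.
move=> e e0; have e20 : 0 < e / 2 by rewrite divr_gt0.
have [n [E [nE hE]]] := a1 _ e20; have [m [F [mF hF]]] := a2 _ e20.
exists (maxn n m), (E `|` F); split.
  by apply: fdimU; [apply: fdim_le nE; exact: leq_maxl|apply: fdim_le mF; exact: leq_maxr].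
have mE := fdim_measurable nE; have mF' := fdim_measurable mF.
rewrite (splitr e); apply: le_lt_trans (ltrD hE hF).
apply: le_trans (prU_le _ _ _); [|exact: measurable_sdiff..].
apply: pr_le; [|apply: measurableU; exact: measurable_sdiff|].
  by apply: measurable_sdiff; exact: measurableU.
by move=> x; rewrite /sdiff /=; tauto.
Qed.

Let approx0 : approx set0.
Proof.
split=> // e e0; exists 0%N, set0; split => //.
by rewrite /sdiff !setD0 setU0 pr_set0.
Qed.

Let approx_nondecreasing (F : nat -> set X) : (forall n, approx (F n)) ->
  nondecreasing_seq F -> approx (\bigcup_n F n).
Proof.
move=> aF ndF.
have mF n : measurable (F n) by case: (aF n).
have mU : measurable (\bigcup_n F n) by exact: bigcupT_measurable.
split=> // e e0; have e20 : 0 < e / 2 by rewrite divr_gt0.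
have : mu (F n) @[n --> \oo] --> mu (\bigcup_n F n).
  exact: nondecreasing_cvg_mu.
rewrite prE// => /fine_cvgP[_ /cvgrPdist_lt/(_ _ e20)[N _ /(_ N (leqnn N))]].
rewrite -/(pr mu (F N)) => hN.
have [n [E [nE hE]]] := (aF N).2 _ e20.
exists n, E; split => //; have mE := fdim_measurable nE.
apply: (@le_lt_trans _ _ (pr mu (sdiff (\bigcup_n F n) (F N)) + pr mu (sdiff (F N) E))).
  apply: le_trans (prU_le _ _ _); [|exact: measurable_sdiff..].
  by apply: pr_le; [exact: measurable_sdiff|apply: measurableU; exact: measurable_sdiff|exact: sdiff_trans].
rewrite (splitr e); apply: ltrD => //; apply: le_lt_trans hN.
apply: le_trans (ler_norm _).
have -> : sdiff (\bigcup_n F n) (F N) = \bigcup_n F n `\` F N.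
  rewrite /sdiff [X in _ `|` X](_ : _ = set0) ?setU0//.
  by apply/seteqP; split => // x [FN]; apply; exists N.
have FNU : F N `<=` \bigcup_n F n by exact: bigcup_sup.
rewrite lerBrDr -prU//; [|exact: measurableD|].
  by rewrite setUC setDUK.
by rewrite setDE -setIA setICl setI0.
Qed.

(** Finite-dimensional sets are dense among Borel sets. *)
Lemma fdim_dense B (eps : R) : measurable B -> 0 < eps ->
  exists n E, fdim n E /\ pr mu ((B `\` E) `|` (E `\` B)) < eps.
Proof.
suff : measurable `<=` approx by move=> /(_ B) h /h [_]; apply.
rewrite measurable_fdimE; apply: smallest_sub; last first.
  move=> E [n nE]; split; first exact: fdim_measurable nE.
  by move=> e e0; exists n, E; split => //; rewrite /sdiff !setDv setU0 pr_set0.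
split; first exact: approx0.
- move=> E [mE aE]; rewrite setTD; split; first exact: measurableC.
  move=> e /aE[n [F [nF hF]]]; exists n, (~` F); split; first exact: fdimC.
  suff -> : sdiff (~` E) (~` F) = sdiff E F by [].
  by rewrite /sdiff !setDE !setCK setUC; congr (_ `|` _); rewrite setIC.
- move=> F aF.
  have -> : \bigcup_n F n = \bigcup_n (\big[setU/set0]_(i < n.+1) F i).
    by rewrite bigcup_bigsetU_bigcup.
  apply: approx_nondecreasing.
    move=> n; elim: n.+1 => [|k IH]; first by rewrite big_ord0; exact: approx0.
    by rewrite big_ord_recr; apply: approxU.
  by move=> n m nm; apply/subsetPset/subset_bigsetU; rewrite ltnS.
Qed.

End approximation.

Section uniformly_continuous.
Context {R : realType} {A : alphabetType}.
Notation X := (shift_space A).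
Implicit Types f : X -> R.

(** Uniform continuity, read on the coordinates. *)
Definition ucont f := forall eps : R, 0 < eps ->
  exists n, forall x y, agree n x y -> `|f x - f y| <= eps.

Lemma ucont_continuous f : ucont f -> continuous f.
Proof.
move=> uf x B /nbhs_ballP[e /= e0 eB].
have e20 : 0 < e / 2 by rewrite divr_gt0.
have [n h] := uf _ e20; apply/nbhs_agreeP; exists n => y xy.
by apply: eB; rewrite /ball /=; apply: le_lt_trans (h _ _ xy) _; lra.
Qed.

Lemma fdim_bounded n f : fdim_fun n f -> exists M, forall x, `|f x| <= M.
Proof.
move=> nf; exists (\sum_(w : n.-tuple A) `|f (concat w point)|) => x.
rewrite (nf _ _ (@concat_initial_agree A n x point)).
by rewrite (bigD1 (initial n x))//= lerDl sumr_ge0.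
Qed.

Lemma measurable_initial n (w : n.-tuple A) : measurable (@initial A n @^-1` [set w]).
Proof.
apply: (@fdim_measurable _ n) => x y /initialP xy /= <-.
by rewrite -xy.
Qed.

Lemma fdim_bmeas n f : fdim_fun n f -> bmeas f.
Proof.
move=> nf; have -> : f = (fun w : n.-tuple A => f (concat w point)) \o initial n.
  by apply/funext => x /=; exact: nf (@concat_initial_agree A n x point).
exact: bmeas_finite (@measurable_initial n) _.
Qed.

(** Boundedness: up to [1], such a function takes finitely many values. *)
Lemma ucont_bmeas f : ucont f -> bmeas f.
Proof.
move=> uf; split.
  apply: (measurability _ (RGenOpens.measurableE R)) => _ [_ [a [b ->] <-]].
  rewrite setTI; apply: open_measurable_shift.
  have /continuousP := ucont_continuous uf; apply.
  exact: interval_open.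
have [n h] := uf 1 ltr01.
have [M hM] := @fdim_bounded n (fun x => f (concat (initial n x) point))
  (fun x y xy => congr1 (fun w : n.-tuple A => f (concat w point)) ((initialP n x y).2 xy)).
exists (1 + M) => x.
rewrite -[f x](subrK (f (concat (initial n x) point))).
by rewrite (le_trans (ler_normD _ _))// lerD//; exact/h/concat_initial_agree.
Qed.

Lemma ucont_prepend a f : ucont f -> ucont (fun x => f (prepend a x)).
Proof.
move=> uf e /uf[n h]; exists n => x y xy; apply: h.
by apply: (@agree_le _ _ n.+1) => //; exact: agree_prepend.
Qed.

Lemma Rint_fdim (mu : probability X R) n (f : X -> R) (y : X) : fdim_fun n f ->
  \int[mu]_x f x = \sum_(w : n.-tuple A)
     f (concat w y) * pr mu (@initial A n @^-1` [set w]).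
Proof.
move=> nf; rewrite -(Rint_finite mu (@measurable_initial n) (fun w => f (concat w y))).
by apply: eq_Rintegral => x _; apply: nf; exact: concat_initial_agree.
Qed.

End uniformly_continuous.

(** * Birkhoff sums and normalized potentials *)

Section birkhoff.
Context {R : realType} {A : alphabetType}.
Notation X := (shift_space A).
Notation shift k := (iter k (@left_shift A)).
Implicit Types (x y : X) (psi phi : X -> R) (n m k : nat).

(** The Birkhoff sum over the first [n] points of the orbit of [x]. *)
Definition birkhoff psi n x : R := \sum_(i < n) psi (shift i x).

Lemma birkhoff0 psi x : birkhoff psi 0 x = 0.
Proof. by rewrite /birkhoff big_ord0. Qed.

Lemma birkhoffD psi n m x :
  birkhoff psi (n + m) x = birkhoff psi n x + birkhoff psi m (shift n x).
Proof.
rewrite /birkhoff big_split_ord/=; congr (_ + _).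
by apply: eq_bigr => i _; rewrite addnC iterD.
Qed.

Lemma birkhoffS psi n x :
  birkhoff psi n.+1 x = psi x + birkhoff psi n (left_shift x).
Proof.
rewrite -add1n birkhoffD; congr (_ + _).
by rewrite /birkhoff big_ord1.
Qed.

(** Bounded distortion: the Birkhoff sums of length [n] of two sequences with
    the same first [n] letters differ by at most [C]. *)
Definition distortion psi (C : R) := forall n x y, agree n x y ->
  `|birkhoff psi n x - birkhoff psi n y| <= C.

Lemma distortion_ge0 psi C : distortion psi C -> 0 <= C.
Proof.
by move=> /(_ 0%N point point); rewrite subrr normr0; apply.
Qed.

Lemma distortion_le psi C n x y : distortion psi C -> agree n x y ->
  birkhoff psi n x <= birkhoff psi n y + C.
Proof. by move=> h /h; rewrite ler_norml => /andP[_]; rewrite lerBlDl. Qed.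

Lemma big_tupleS (I : finType) n (F : n.+1.-tuple I -> R) :
  \sum_(w : n.+1.-tuple I) F w =
  \sum_(a : I) \sum_(w : n.-tuple I) F [tuple of a :: w].
Proof.
rewrite pair_bigA/= (reindex (fun p : I * n.-tuple I => [tuple of p.1 :: p.2]))//=.
exists (fun w : n.+1.-tuple I => (thead w, [tuple of behead w])).
  by move=> [a w] _; congr (_, _); apply/val_inj.
by move=> w _; case/tupleP: w => a w /=; apply: val_inj => /=.
Qed.

Lemma normalized_le0 psi x : normalized psi -> psi x <= 0.
Proof.
move=> /(_ (left_shift x)) h; rewrite -(prepend_left_shift x).
rewrite -ler_expR expR0 -h (bigD1 (x 0%N))//= lerDl.
by apply: sumr_ge0 => a _; exact: expR_ge0.
Qed.

Lemma birkhoff_le0 psi n x : normalized psi -> birkhoff psi n x <= 0.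
Proof. by move=> h; apply: sumr_le0 => i _; exact: normalized_le0. Qed.

(** The iterates of the transfer operator of a normalized potential fix the
    constants. *)
Lemma normalized_words psi n x : normalized psi ->
  \sum_(w : n.-tuple A) expR (birkhoff psi n (concat w x)) = 1.
Proof.
move=> h; elim: n => [|n IH].
  rewrite (bigD1 [tuple])//= birkhoff0 expR0 big1 ?addr0// => w /eqP[].
  exact: tuple0.
rewrite big_tupleS exchange_big -[RHS]IH; apply: eq_bigr => w _ /=.
under eq_bigr do rewrite birkhoffS expRD left_shift_prepend.
by rewrite -mulr_suml h mul1r.
Qed.

Lemma bmeas_shift psi k : bmeas psi -> bmeas (fun x => psi (shift k x)).
Proof.
move=> [mpsi [M hM]]; split; last by exists M.
exact: (measurableT_comp mpsi (measurable_fun_iter_shift k)).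
Qed.

Lemma bmeas_birkhoff psi n : bmeas psi -> bmeas (birkhoff psi n).
Proof. by move=> h; apply: bmeas_sum => i; exact: bmeas_shift. Qed.

Section invariant.
Variable mu : probability X R.
Hypothesis inv : invariant_measure (@left_shift A) mu.

Lemma Rint_shift psi k : bmeas psi -> \int[mu]_x psi (shift k x) = \int[mu]_x psi x.
Proof.
move=> bpsi; elim: k => [//|k <-].
rewrite -(Rint_preserving (th := @left_shift A) (f := fun x => psi (shift k x)))//.
- by apply: eq_Rintegral => x _; rewrite -iterSr.
- exact: measurable_fun_left_shift.
- exact: bmeas_shift.
Qed.

Lemma Rint_birkhoff psi n : bmeas psi ->
  \int[mu]_x birkhoff psi n x = n%:R * \int[mu]_x psi x.
Proof.
move=> h; rewrite /birkhoff Rint_sum; last by move=> i; exact: bmeas_shift.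
under eq_bigr do rewrite Rint_shift//.
by rewrite sumr_const card_ord mulr_natl.
Qed.

Lemma pr_shift B k : measurable B -> pr mu (shift k @^-1` B) = pr mu B.
Proof.
move=> mB; rewrite -!Rint_indic//; last first.
  by rewrite -[X in measurable X]setTI; exact: measurable_fun_iter_shift.
rewrite -[RHS](Rint_shift k); last exact: bmeas_indic.
by apply: eq_Rintegral => x _; rewrite !indicE.
Qed.

End invariant.

End birkhoff.

(** * The variational inequality *)

Section means.
Context {R : realType}.

(** The upper bound of the limit of [u n / n] includes the divergent case, in
    which [limn] is [0]; hence the hypothesis [0 <= c]. *)
Lemma limn_mean_le (u : nat -> R) (c : R) : 0 <= c ->
  (forall e : R, 0 < e -> exists K, forall n, u n <= n%:R * (c + e) + K) ->
  (limn (fun n => (n%:R^-1 * u n)%:E) <= c%:E)%E.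
Proof.
move=> c0 h; have [cv|/dvgP ->] := pselect (cvgn (fun n => (n%:R^-1 * u n)%:E));
  last by rewrite lee_fin.
apply/lee_addgt0Pr => e e0; have e20 : 0 < e / 2 by rewrite divr_gt0.
have [K hK] := h _ e20.
apply: lime_le => //; exists (Num.truncn (2 * `|K| / e)).+1 => // n /= nK.
have n0 : 0 < n%:R :> R by rewrite ltr0n (leq_trans _ nK).
rewrite lee_fin mulrC ler_pdivrMr//; apply: le_trans (hK n) _.
have : 2 * `|K| / e < n%:R.
  by apply: lt_le_trans (truncnS_gt _) _; rewrite ler_nat.
rewrite ltr_pdivrMr// => hn; have := ler_norm K; nra.
Qed.

(** Gibbs' inequality: the entropy of [p] is at most its cross-entropy relative
    to any positive subprobability [q]. *)
Lemma gibbs_inequality (I : finType) (p q : I -> R) :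
  (forall i, 0 <= p i) -> (forall i, 0 < q i) ->
  \sum_i p i = 1 -> \sum_i q i <= 1 ->
  - \sum_i p i * ln (p i) <= - \sum_i p i * ln (q i).
Proof.
move=> p0 q0 p1 q1; rewrite lerN2 -subr_ge0 -sumrB.
apply: (@le_trans _ _ (\sum_i (p i - q i))); first by rewrite sumrB p1; lra.
apply: ler_sum => i _.
have := p0 i; rewrite le_eqVlt => /predU1P[<-|pi0].
  by rewrite !mul0r subrr sub0r oppr_le0 ltW.
rewrite -mulrBr -ln_div ?posrE//.
have : ln (q i / p i) <= q i / p i - 1.
  have := @le_ln1Dx R (q i / p i - 1).
  rewrite [1 + _]addrC subrK; apply.
  by rewrite ltrBrDr addrC subrr divr_gt0.
rewrite -[X in _ -> _ <= _ * X]opprK -lnV ?posrE ?divr_gt0// invf_div => hl.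
have := ler_wpM2l (p0 i) hl; rewrite mulrBr mulrCA divff ?gt_eqF// mulr1.
lra.
Qed.

End means.

Section variational_inequality.
Context {R : realType} {A : alphabetType}.
Notation X := (shift_space A).
Notation shift k := (iter k (@left_shift A)).
Variables (mu : probability X R).
Hypothesis inv : invariant_measure (@left_shift A) mu.

Section itinerary.
Variables (k : nat) (P : 'I_k -> set X).
Hypothesis partP : finite_measurable_partition P.

Let k_gt0 : (0 < k)%N.
Proof.
case: partP => _ _ /seteqP[_ /(_ point I)] [i _ _].
exact: leq_ltn_trans (leq0n i) (ltn_ord i).
Qed.

Let i0 : 'I_k := Ordinal k_gt0.

(** The index of the atom of the partition that contains [x]; the default [i0]
    is never returned, since the atoms cover the space. *)
Let label (x : X) : 'I_k := xget i0 [set i | P i x].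

Let labelP x : P (label x) x.
Proof.
case: partP => _ _ /seteqP[_ /(_ x I)] [i _ Pix].
exact: (@xgetPex _ i0 [set i | P i x] (ex_intro _ i Pix)).
Qed.

Let label_uniq x i : P i x -> label x = i.
Proof.
move=> Pi; case: partP => _ tP _.
by apply: (tP _ _ I I); exists x; split=> //; exact: labelP.
Qed.

Let itin n (x : X) : {ffun 'I_n -> 'I_k} := [ffun i : 'I_n => label (shift i x)].

Let itinE n (w : {ffun 'I_n -> 'I_k}) :
  @itin n @^-1` [set w] = join_atom (@left_shift A) P w.
Proof.
apply/seteqP; split => x /=.
  by move=> <- i; rewrite ffunE; exact: labelP.
by move=> h; apply/ffunP => i; rewrite ffunE; exact: label_uniq.
Qed.

Let measurable_label i : measurable (label @^-1` [set i]).
Proof.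
have -> : label @^-1` [set i] = P i.
  by apply/seteqP; split => x /=; [move=> <-; exact: labelP|exact: label_uniq].
by case: partP.
Qed.

Let measurable_itin n (w : {ffun 'I_n -> 'I_k}) : measurable (@itin n @^-1` [set w]).
Proof.
have -> : @itin n @^-1` [set w] =
    \bigcap_(i in [set: 'I_n]) (shift i @^-1` (label @^-1` [set w i])).
  apply/seteqP; split => x /=.
    by move=> <- i _ /=; rewrite ffunE.
  by move=> h; apply/ffunP => i; rewrite ffunE; exact: h.
apply: fin_bigcap_measurable => // i _; rewrite -[X in measurable X]setTI.
exact: measurable_fun_iter_shift.
Qed.

(** A finite-dimensional guess of the label, wrong with small probability. *)
Let guess_label (delta : R) : 0 < delta -> exists m (guess : X -> 'I_k),
  fdim_fun m guess /\
  exists2 E, measurable E & pr mu E <= delta /\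
    forall x, ~ E x -> guess x = label x.
Proof.
move=> d0; have d1 : 0 < delta / k%:R by rewrite divr_gt0 ?ltr0n.
have mP i : measurable (P i) by case: partP.
have /choice[f hf] : forall i, exists nE : nat * set X, fdim nE.1 nE.2 /\
    pr mu ((P i `\` nE.2) `|` (nE.2 `\` P i)) < delta / k%:R.
  by move=> i; have [n [E [nE hE]]] := fdim_dense mu (mP i) d1; exists (n, E).
pose m := \max_i (f i).1.
have mf i : fdim m (f i).2.
  by apply: fdim_le (hf i).1; exact: (leq_bigmax i).
exists m, (fun x => xget i0 [set i | (f i).2 x]); split.
  move=> x y xy; congr xget; apply/seteqP; split => i /=; apply: mf => //.
  exact: agree_sym.
pose D i := (P i `\` (f i).2) `|` ((f i).2 `\` P i).
have mD i : measurable (D i).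
  by apply: measurableU; apply: measurableD => //; exact: fdim_measurable (mf i).
exists (\bigcup_i D i); first exact: fin_bigcup_measurable.
split.
  apply: le_trans (pr_bigcup_le _ mD) _.
  apply: le_trans (ler_sum _ (fun i _ => ltW (hf i).2)) _.
  rewrite sumr_const card_ord -(mulr_natr (delta / k%:R)) -mulrA mulVf ?mulr1//.
  by rewrite pnatr_eq0 -lt0n.
move=> x nD; rewrite /label; congr xget; apply/seteqP; split => i /= h.
  by apply: contrapT => nP; apply: nD; exists i => //; right.
by apply: contrapT => nP; apply: nD; exists i => //; left.
Qed.

(** The entropy of the join is bounded by coding itineraries: a word of letters
    is drawn with the weights given by [psi], labels are guessed from it, and
    each guess goes through a channel that errs with probability [eps]. *)
Lemma join_entropy_le (psi : X -> R) (C : R) :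
  bmeas psi -> normalized psi -> distortion psi C ->
  forall e : R, 0 < e -> exists K, forall n,
    join_entropy (@left_shift A) mu P n <= n%:R * (- (\int[mu]_x psi x) + e) + K.
Proof.
move=> bpsi npsi dpsi e e0.
have C0 := distortion_ge0 dpsi.
have k0 : 0 < k%:R :> R by rewrite ltr0n.
(* a correct guess costs [e / 2], a wrong one at most [- b]; [delta] is the
   frequency of wrong guesses that makes the total cost at most [e] *)
pose a : R := - (e / 2).
pose eps : R := 1 - expR a.
have eps0 : 0 < eps.
  by rewrite subr_gt0 -[X in _ < X]expR0 ltr_expR /a; lra.
pose b := Num.min a (ln (eps / k%:R)).
have ba : b <= a by rewrite /b ge_min lexx.
pose delta := e / 2 / (a - b + 1).
have ab0 : 0 < a - b + 1 by lra.
have d0 : 0 < delta by rewrite /delta divr_gt0// divr_gt0.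
have [m [guess [fg [E mE [pE hE]]]]] := guess_label d0.
(* the channel from guesses to labels *)
pose K (i j : 'I_k) : R := if i == j then expR a else eps / k%:R.
have K0 i j : 0 < K i j.
  by rewrite /K; case: ifP => _; rewrite ?expR_gt0// divr_gt0.
have K1 i : \sum_j K i j <= 1.
  rewrite (bigD1 i)//= /K eqxx.
  apply: (@le_trans _ _ (expR a + \sum_(j < k) eps / k%:R)).
    rewrite lerD2l [leRHS](bigD1 i)//=.
    apply: (@le_trans _ _ (\sum_(j < k | j != i) eps / k%:R)).
      by apply: ler_sum => j; rewrite eq_sym => /negbTE ->.
    by rewrite lerDr ltW// divr_gt0.
  rewrite sumr_const card_ord -(mulr_natr (eps / k%:R)) -mulrA mulVf ?gt_eqF// mulr1 /eps.
  lra.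
have ln_channel x : a + (b - a) * \1_E x <= ln (K (guess x) (label x)).
  have [xE|xE] := boolP (x \in E); rewrite indicE ?xE ?(negbTE xE) /=.
    rewrite mulr1 addrC subrK /K; case: ifP => _; first by rewrite expRK.
    by rewrite /b ge_min lexx orbT.
  rewrite mulr0 addr0 /K hE ?eqxx ?expRK//.
  by move: xE; rewrite notin_setE.
exists (C + m%:R * (- \int[mu]_x psi x)) => n.
(* [n + m] letters determine the guesses at the times [0], ..., [n - 1] *)
pose N := (n + m)%N.
pose Q (c : N.-tuple A) := expR (birkhoff psi N (concat c point)).
pose q (w : {ffun 'I_n -> 'I_k}) := \sum_(c : N.-tuple A)
  Q c * \prod_(j < n) K (guess (shift j (concat c point))) (w j).
have q0 w : 0 < q w.
  rewrite /q (bigD1 [tuple of nseq N point])//=; apply: ltr_wpDr.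
    by apply: sumr_ge0 => c _; rewrite mulr_ge0 ?expR_ge0// prodr_ge0// => j _; exact: ltW.
  by rewrite mulr_gt0 ?expR_gt0// prodr_gt0.
have q1 : \sum_w q w <= 1.
  rewrite /q exchange_big/= -[leRHS](@normalized_words R A psi N point npsi).
  apply: ler_sum => c _; rewrite -mulr_sumr -[leRHS]mulr1 ler_wpM2l ?expR_ge0//.
  rewrite -(bigA_distr_bigA (fun (j : 'I_n) (i : 'I_k) => K (guess (shift j (concat c point))) i))/=.
  apply: prodr_ile1 => j _; rewrite K1 andbT.
  by apply: sumr_ge0 => i _; exact: ltW.
(* keep the only term of [q] that comes from the word of [x] itself *)
have lnq x : birkhoff psi N x - C + \sum_(j < n) (a + (b - a) * \1_E (shift j x))
    <= ln (q (itin n x)).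
  pose c := initial N x.
  have cx : agree N x (concat c point) := @concat_initial_agree _ N x point.
  have : Q c * \prod_(j < n) K (guess (shift j x)) (label (shift j x)) <= q (itin n x).
    rewrite /q (bigD1 c)//= -[leLHS]addr0 lerD//.
      rewrite ler_wpM2l ?expR_ge0// le_eqVlt; apply/orP; left; apply/eqP.
      apply: eq_bigr => j _; rewrite ffunE; congr K; apply: fg.
      apply: agree_shift; apply: agree_le cx; rewrite /N leq_add2r.
      exact: ltnW.
    by apply: sumr_ge0 => d _; rewrite mulr_ge0 ?expR_ge0// prodr_ge0// => j _; exact: ltW.
  have pK : 0 < \prod_(j < n) K (guess (shift j x)) (label (shift j x)).
    by apply: prodr_gt0.
  rewrite -ler_ln ?posrE//; last by rewrite mulr_gt0// expR_gt0.
  rewrite lnM ?posrE ?expR_gt0// expRK; apply: le_trans; apply: lerD.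
    by rewrite lerBlDr; exact: distortion_le dpsi cx.
  have -> : ln (\prod_(j < n) K (guess (shift j x)) (label (shift j x))) =
      \sum_(j < n) ln (K (guess (shift j x)) (label (shift j x))).
    apply: expR_inj; rewrite expR_sum lnK ?posrE//.
    by apply: eq_bigr => j _; rewrite lnK ?posrE.
  by apply: ler_sum => j _; exact: ln_channel.
have bE : bmeas (\1_E : X -> R) by exact: bmeas_indic.
have bF : bmeas (fun x => a + (b - a) * \1_E x).
  by apply: bmeasD; [exact: bmeas_cst|exact: bmeasZ].
have intF : \int[mu]_x (a + (b - a) * \1_E x) = a + (b - a) * pr mu E.
  rewrite RintD ?RintZ ?Rint_cst ?Rint_indic//; first exact: bmeas_cst.
  exact: bmeasZ.
have : N%:R * \int[mu]_x psi x - C + n%:R * (a + (b - a) * pr mu E) <=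
    \int[mu]_x ln (q (itin n x)).
  rewrite -intF -!Rint_birkhoff// -(Rint_cst mu (- C)).
  have bS : bmeas (birkhoff psi N) by exact: bmeas_birkhoff.
  have bS' := @bmeas_birkhoff R A _ n bF.
  rewrite -RintD//; last exact: bmeas_cst.
  rewrite -RintD//; last by apply: bmeasD => //; exact: bmeas_cst.
  apply: Rint_le => //.
    by apply: bmeasD => //; apply: bmeasD => //; exact: bmeas_cst.
  exact: (bmeas_finite (@measurable_itin n) (fun w => ln (q w))).
rewrite (Rint_finite mu (@measurable_itin n) (fun w => ln (q w))) => hlow.
have H : join_entropy (@left_shift A) mu P n <=
    - \sum_w ln (q w) * pr mu (@itin n @^-1` [set w]).
  have := @gibbs_inequality R {ffun 'I_n -> 'I_k} (fun w => pr mu (@itin n @^-1` [set w])) q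
    (fun w => pr_ge0 _ _) q0 (pr_finite_sum mu (@measurable_itin n)) q1.
  rewrite /join_entropy; under eq_bigr do rewrite itinE.
  move=> h; apply: le_trans h _; rewrite lerN2 le_eqVlt; apply/orP; left; apply/eqP.
  by apply: eq_bigr => w _; rewrite mulrC itinE.
apply: le_trans H _; rewrite lerNl; apply: le_trans _ hlow.
have hd : (a - b) * pr mu E <= e / 2.
  apply: (@le_trans _ _ ((a - b + 1) * delta)).
    by apply: ler_pM; rewrite ?subr_ge0 ?lerDl ?pr_ge0 ?ler01.
  by rewrite /delta mulrCA divff ?mulr1// gt_eqF.
have := ler_wpM2l (ler0n R n) hd; rewrite /N natrD.
move: (\int[mu]_x psi x) n%:R m%:R (pr mu E) (b) => I' nr mr p b'.
rewrite /a; lra.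
Qed.

End itinerary.

(** The variational inequality [h(mu) + int psi <= 0] for normalized [psi]. *)
Theorem measure_entropy_le (psi : X -> R) (C : R) :
  bmeas psi -> normalized psi -> distortion psi C ->
  (measure_entropy (@left_shift A) mu <= (- \int[mu]_x psi x)%:E)%E.
Proof.
move=> bpsi npsi dpsi; apply: ge_ereal_sup => _ [k [P [partP ->]]].
apply: limn_mean_le; last exact: join_entropy_le dpsi.
rewrite oppr_ge0 -[leRHS](Rint_cst mu 0); apply: Rint_le => //.
  exact: bmeas_cst.
by move=> x; exact: normalized_le0.
Qed.

End variational_inequality.

(** * Equilibrium states of normalized potentials *)

Section summable_variation.
Context {R : realType} {A : alphabetType}.
Notation X := (shift_space A).
Notation shift k := (iter k (@left_shift A)).
Implicit Types (x y : X) (psi phi : X -> R) (n m k : nat).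

(** [v n] bounds the [n]-th variation of [phi]; unlike the variation itself,
    it is a real number. *)
Definition variation_bound phi (v : nat -> R) :=
  forall n x y, agree n x y -> `|phi x - phi y| <= v n.

Lemma summable_variationP phi : summable_variation phi ->
  exists v tail : nat -> R, [/\ variation_bound phi v, forall n, 0 <= v n,
    forall n m, \sum_(i < n) v (m + i.+1)%N <= tail m
    & forall e, 0 < e -> exists m, tail m <= e].
Proof.
move=> sphi.
have V0 n : (0 <= nth_variation phi n)%E.
  apply: ereal_sup_ubound; exists (point, point) => //=.
  by rewrite subrr normr0.
have Vfin n : nth_variation phi n \is a fin_num.
  rewrite ge0_fin_numE//; apply: le_lt_trans sphi.
  apply: le_trans (nneseries_lim_ge n.+1 (fun k _ _ => V0 k)).
  by rewrite big_nat_recr//= leeDr// sume_ge0.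
have tailE n m : \sum_(m.+1 <= k < m.+1 + n) fine (nth_variation phi k) =
    \sum_(i < n) fine (nth_variation phi (m + i.+1)%N).
  rewrite -[X in \sum_(X <= _ < _) _]add0n big_addn addKn big_mkord.
  by apply: eq_bigr => i _; rewrite addnC addSnnS.
have tail_fin m : (\sum_(m.+1 <= k <oo) nth_variation phi k)%E \is a fin_num.
  rewrite ge0_fin_numE; last by apply: nneseries_ge0.
  apply: le_lt_trans sphi; rewrite (nneseries_split 0 m.+1)// add0n.
  by rewrite leeDr// sume_ge0.
pose tail m := fine (\sum_(m.+1 <= k <oo) nth_variation phi k)%E.
exists (fun n => fine (nth_variation phi n)), tail; split.
- move=> n x y xy; rewrite -lee_fin fineK//.
  by apply: ereal_sup_ubound; exists (x, y).
- by move=> n; exact: fine_ge0.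
- move=> n m; rewrite -tailE -lee_fin fineK//.
  apply: le_trans (nneseries_lim_ge (m.+1 + n) (fun k _ _ => V0 k)).
  by rewrite -sumEFin lee_sum// => k _; rewrite fineK.
- move=> e e0; have := nneseries_tail_cvg sphi (fun k _ => V0 k).
  move=> /fine_cvgP[_ /cvgrPdist_le/(_ _ e0)[N _ /(_ N.+1 (leqnSn N))]].
  rewrite sub0r normrN => h; exists N; apply: le_trans h.
  exact: ler_norm.
Qed.

(** Summing the variation bounds along the first [n] shifts. *)
Lemma variation_birkhoff phi v n m x y : variation_bound phi v ->
  agree (n + m) x y ->
  `|birkhoff phi n x - birkhoff phi n y| <= \sum_(i < n) v (m + i.+1)%N.
Proof.
move=> hv xy; rewrite /birkhoff -sumrB (reindex_inj rev_ord_inj)/=.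
apply: le_trans (ler_norm_sum _ _ _) _; apply: ler_sum => i _.
apply: hv; apply: agree_shift; apply: agree_le xy.
by have := ltn_ord i; lia.
Qed.

Lemma variation_distortion phi v C : variation_bound phi v ->
  (forall n, \sum_(i < n) v i.+1 <= C) -> distortion phi C.
Proof.
move=> hv hC n x y xy; apply: le_trans (hC n).
by have := @variation_birkhoff phi v n 0 x y hv; rewrite addn0; apply.
Qed.

End summable_variation.

Section transfer_invariance.
Context {R : realType} {A : alphabetType}.
Notation X := (shift_space A).
Notation shift k := (iter k (@left_shift A)).
Implicit Types (x y : X) (n m k : nat).
Variables (phi : X -> R) (v : nat -> R) (C : R).
Hypothesis nphi : normalized phi.
Hypothesis vphi : variation_bound phi v.
Hypothesis v_ge0 : forall n, 0 <= v n.
Hypothesis v_sum : forall n, \sum_(i < n) v i.+1 <= C.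
Hypothesis uphi : ucont phi.

(** The normalizing term of the tilt varies no more than [phi]. *)
Lemma ln_tilt_lipschitz (s p q : R) : `|s| <= 1 / 2 -> p <= 0 -> q <= 0 ->
  `|ln (1 + s * expR p) - ln (1 + s * expR q)| <= `|p - q|.
Proof.
move=> hs p0 q0; wlog pq : p q p0 q0 / p <= q.
  move=> H; case: (leP p q) => [|/ltW] pq; first exact: H.
  by rewrite distrC [leRHS]distrC; exact: H.
have [up uq] : expR p <= 1 /\ expR q <= 1 by rewrite -[1]expR0 !ler_expR.
have upq : expR p <= expR q by rewrite ler_expR.
have p1 := expR_gt0 p; have q1 := expR_gt0 q.
move: hs; rewrite ler_norml => /andP[s1 s2].
have hp : 0 < 1 + s * expR p by nra.
have hq : 0 < 1 + s * expR q by nra.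
rewrite [leRHS]distrC (ger0_norm (_ : 0 <= q - p)) ?subr_ge0//.
have H (z w r t : R) : 0 < z -> 0 < w -> z * expR r <= w * expR t -> ln z + r <= ln w + t.
  by move=> z0 w0 h; rewrite -ler_expR !expRD !lnK.
rewrite ler_norml; apply/andP; split.
  have := @H (1 + s * expR q) (1 + s * expR p) p q hq hp.
  by move=> /(_ ltac:(nra)); lra.
have f1 : 0 <= 1 + s * (expR p + expR q) by nra.
have f2 : 0 <= expR q - expR p by rewrite subr_ge0.
have := @H (1 + s * expR p) (1 + s * expR q) p q hp hq.
have := mulr_ge0 f1 f2.
by move=> h /(_ ltac:(nra)); lra.
Qed.

Section tilt.
Variables (n : nat) (B : set X) (a : A).
Hypothesis fB : fdim n B.

(** The weight of the letter [a] in front of sequences in [B]. *)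
Let I (x : X) : R := expR (phi (prepend a x)) * \1_B x.

(** The cylinder [aB]. *)
Let aB : set X := [set y | y 0%N = a /\ B (left_shift y)].

Let fdim_aB : fdim n.+1 aB.
Proof.
move=> x y xy [x0 Bx]; split; first by rewrite -(xy 0%N).
by apply: fB Bx; exact: (@agree_shift _ 1).
Qed.

Let I_ge0 x : 0 <= I x.
Proof. by rewrite /I mulr_ge0 ?expR_ge0// indicE ler0n. Qed.

Let I_le1 x : I x <= 1.
Proof.
rewrite /I indicE; case: (_ \in _); rewrite ?mulr0// mulr1.
by rewrite -[leRHS]expR0 ler_expR normalized_le0.
Qed.

Lemma bmeas_weight : bmeas I.
Proof.
apply: bmeasM; last by apply: bmeas_indic; exact: fdim_measurable fB.
have [mp _] := ucont_bmeas (ucont_prepend a uphi).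
split; first exact: measurableT_comp.
exists 1 => x; rewrite ger0_norm ?expR_ge0//.
by rewrite -[leRHS]expR0 ler_expR normalized_le0.
Qed.

Section parameter.
Variable s : R.
Hypothesis s2 : `|s| <= 1 / 2.

Let sP : - (1 / 2) <= s <= 1 / 2.
Proof. by rewrite -ler_norml. Qed.

Let G x := ln (1 + s * I x).

Let G_arg x : 1 / 2 <= 1 + s * I x <= 2.
Proof.
have := I_ge0 x; have := I_le1 x; have /andP[] := sP => h1 h2 h3 h4.
by apply/andP; split; nra.
Qed.

Let G_le x : G x <= s * I x.
Proof.
apply: le_ln1Dx; have /andP[+ _] := G_arg x; lra.
Qed.

Let bmeas_G : bmeas G.
Proof.
split.
  apply: measurableT_comp; first exact: measurable_ln.
  apply: measurable_funD => //.
  by have [] := bmeasZ s bmeas_weight.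
exists (ln 2) => x; have /andP[h1 h2] := G_arg x.
have p : 0 < 1 + s * I x by lra.
rewrite ler_norml /G; apply/andP; split; last by rewrite ler_ln ?posrE.
by rewrite -lnV ?posrE// ler_ln ?posrE ?invr_gt0//; lra.
Qed.

(** The potential [phi] tilted towards [aB] and normalized again. *)
Let phis y := phi y + ln (1 + s) * \1_aB y - G (left_shift y).

Let normalized_phis : normalized phis.
Proof.
move=> x; rewrite /phis.
have s0 : 0 < 1 + s by have /andP[] := sP; lra.
have p : 0 < 1 + s * I x by have /andP[+ _] := G_arg x; lra.
have E b : expR (phi (prepend b x) + ln (1 + s) * \1_aB (prepend b x) - G x) =
   (expR (phi (prepend b x)) + (b == a)%:R * (s * I x)) / (1 + s * I x).
  rewrite expRB /G lnK ?posrE// expRD; congr (_ / _).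
  rewrite /I !indicE; have [->|ba] := eqVneq b a.
    have -> : (prepend a x \in aB) = (x \in B).
      by apply/idP/idP; rewrite !inE; [case|split].
    by case: (x \in B) => /=; rewrite !(mulr1, mulr0) ?expR0 ?lnK ?posrE//; ring.
  rewrite memNset; last by move=> [/= /eqP]; rewrite (negbTE ba).
  by rewrite mulr0 expR0 mul0r addr0 mulr1.
under eq_bigr do rewrite left_shift_prepend E.
rewrite -mulr_suml big_split/= nphi (bigD1 a)//= eqxx mul1r big1 ?addr0.
  by rewrite divff// gt_eqF.
by move=> b /negbTE ->; rewrite mul0r.
Qed.

Let bmeas_phis : bmeas phis.
Proof.
apply: bmeasD; first apply: bmeasD; first exact: ucont_bmeas.
  by apply: bmeasZ; apply: bmeas_indic; exact: fdim_measurable fdim_aB.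
have [mG [M hM]] : bmeas (fun x => G (left_shift x)) by exact: (@bmeas_shift R A G 1).
split; first exact: measurable_funN.
by exists M => x; rewrite normrN.
Qed.

(* beyond the first [n] letters the indicators agree, and the variation of
   [phis] is at most twice that of [phi]; before, it is at most [2 * M] *)
Let distortion_phis : exists D, distortion phis D.
Proof.
have [_ [M hM]] := bmeas_phis.
have M0 : 0 <= M by exact: le_trans (hM point).
pose w k := 2 * v k + (k <= n)%:R * (2 * M).
exists (2 * C + n%:R * (2 * M)).
apply: (@variation_distortion _ _ _ w).
  move=> k x y xy; rewrite /w; have [kn|nk] := leqP k n.
    rewrite mul1r; apply: (@le_trans _ _ (2 * M)).
      rewrite (le_trans (ler_normB _ _))// (le_trans (lerD (hM _) (hM _)))//.
      by lra.
    by rewrite lerDr mulr_ge0.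
  rewrite mul0r addr0; case: k nk xy => // k nk xy.
  have xy' : agree k (left_shift x) (left_shift y) by exact: (@agree_shift _ 1).
  have kn : (n <= k)%N by [].
  have -> : phis x - phis y = (phi x - phi y) - (G (left_shift x) - G (left_shift y)).
    rewrite /phis !indicE (fdim_mem (fdim_le _ fdim_aB) xy)//.
    by ring.
  rewrite mulrDl mul1r; apply: le_trans (ler_normB _ _) _.
  apply: lerD; first exact: vphi.
  rewrite /G /I !indicE.
  rewrite (fdim_mem (fdim_le kn fB) xy').
  case: (_ \in B); last by rewrite !mulr0 subrr normr0.
  rewrite !mulr1; apply: le_trans (ln_tilt_lipschitz s2 _ _) _; rewrite ?normalized_le0//.
  by apply: vphi; exact: agree_prepend.
move=> N; rewrite /w big_split/= -mulr_sumr; apply: lerD.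
  by rewrite ler_wpM2l// v_sum.
rewrite -mulr_suml ler_wpM2r ?mulr_ge0// -natr_sum ler_nat.
have -> : (\sum_(i < N) (i < n) = minn N n)%N.
  elim: N => [|N IH]; first by rewrite big_ord0 min0n.
  by rewrite big_ord_recr/= IH; case: (ltnP N n); lia.
exact: geq_minr.
Qed.

(** The variational inequality for the tilted potential, compared with the
    entropy bound from below. *)
Lemma tilt_le (mu : probability X R) : invariant_measure (@left_shift A) mu ->
  (0 <= free_energy phi mu)%E ->
  ln (1 + s) * pr mu aB <= s * \int[mu]_x I x.
Proof.
move=> inv fe.
have [D hD] := distortion_phis.
have bphi := ucont_bmeas uphi.
have bI := bmeas_weight.
have h := measure_entropy_le inv bmeas_phis normalized_phis hD.
have baB : bmeas (\1_aB : X -> R) by apply: bmeas_indic; exact: fdim_measurable fdim_aB.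
have bGs : bmeas (fun x => G (left_shift x)) by exact: (@bmeas_shift R A G 1).
have : 0 <= - (\int[mu]_x phis x) + \int[mu]_x phi x.
  rewrite -lee_fin EFinD; apply: le_trans fe _; rewrite /free_energy EFin_Rint//.
  by rewrite leeD2r.
have -> : \int[mu]_x phis x = \int[mu]_x phi x + ln (1 + s) * pr mu aB - \int[mu]_x G x.
  rewrite -(Rint_shift inv 1 bmeas_G) -Rint_indic; last exact: fdim_measurable fdim_aB.
  rewrite -RintZ// -RintD//; last exact: bmeasZ.
  rewrite -mulN1r -RintZ// -RintD//; [|by apply: bmeasD => //; exact: bmeasZ|exact: bmeasZ].
  by apply: eq_Rintegral => x _; rewrite mulN1r.
have : \int[mu]_x G x <= s * \int[mu]_x I x.
  by rewrite -RintZ//; apply: Rint_le => //; exact: bmeasZ.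
lra.
Qed.

End parameter.

(** A measure of non-negative free energy is invariant under the dual of the
    transfer operator, on cylinders: both sides of [tilt_le] vanish at [s = 0],
    and [s] can have either sign, so that their derivatives agree. *)
Lemma transfer_invariant (mu : probability X R) :
  invariant_measure (@left_shift A) mu -> (0 <= free_energy phi mu)%E ->
  pr mu [set y | y 0%N = a /\ B (left_shift y)] =
  \int[mu]_x (expR (phi (prepend a x)) * \1_B x).
Proof.
move=> inv fe; rewrite -/aB -/(I _).
set J := \int[mu]_x I x; set p := pr mu aB.
have p0 : 0 <= p by exact: pr_ge0.
have J0 : 0 <= J by exact: Rint_ge0.
have key (s : R) : `|s| <= 1 / 2 -> s * p <= (1 + s) * (s * J).
  move=> s2; have := tilt_le s2 inv fe; rewrite -/J -/p.
  move: s2; rewrite ler_norml => /andP[s1 s2] h.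
  have s0 : 0 < 1 + s by lra.
  have l : 1 - (1 + s)^-1 <= ln (1 + s).
    have := @le_ln1Dx R ((1 + s)^-1 - 1).
    have i0 : 0 < (1 + s)^-1 by rewrite invr_gt0.
    rewrite [1 + (_ - 1)]addrC subrK lnV ?posrE// => /(_ ltac:(lra)); lra.
  have l' : s <= (1 + s) * ln (1 + s).
    have := ler_wpM2l (ltW s0) l; rewrite mulrBr divff ?gt_eqF//; lra.
  apply: le_trans (ler_wpM2r p0 l') _.
  by rewrite -mulrA ler_wpM2l// ltW.
have small e : 0 < e -> exists s, [/\ 0 < s, `|s| <= 1 / 2 & s * J + s <= e].
  move=> e0; have J1 : 0 < J + 1 by lra.
  pose s := Num.min (1 / 2) (e / (J + 1)).
  have s0 : 0 < s by rewrite /s lt_min !divr_gt0.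
  exists s; split => //; first by rewrite gtr0_norm// /s ge_min lexx.
  rewrite -[X in _ + X]mulr1 -mulrDr -ler_pdivlMr//.
  by rewrite /s ge_min lexx orbT.
apply/eqP; rewrite eq_le; apply/andP; split; apply/ler_addgt0Pr => e e0.
  have [s [s0 sh se]] := small e e0.
  have := key s sh; rewrite mulrCA ler_pM2l//; lra.
have [s [s0 sh se]] := small e e0.
have := key (- s); rewrite normrN => /(_ sh).
by rewrite !mulNr mulrN lerN2 mulrCA ler_pM2l//; lra.
Qed.

End tilt.

(** The Gibbs property, by induction on the length of the cylinder: prepending a
    letter multiplies its measure by [exp phi], up to the variation of [phi]. *)
Lemma gibbs_bounds (mu : probability X R) n x :
  invariant_measure (@left_shift A) mu -> (0 <= free_energy phi mu)%E ->
  expR (birkhoff phi n x - C) <= pr mu [set y | agree n x y] <=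
  expR (birkhoff phi n x + C).
Proof.
move=> inv fe.
suff : expR (birkhoff phi n x - \sum_(i < n) v i.+1) <= pr mu [set y | agree n x y] <=
    expR (birkhoff phi n x + \sum_(i < n) v i.+1).
  move=> /andP[h1 h2]; apply/andP; split.
    by apply: le_trans h1; rewrite ler_expR lerB.
  by apply: le_trans h2 _; rewrite ler_expR lerD.
elim: n x => [|n IH] x.
  have -> : [set y | agree 0 x y] = setT by apply/seteqP; split.
  by rewrite pr_setT birkhoff0 big_ord0 subr0 addr0 expR0 lexx.
have fB := @fdim_agree A n (left_shift x).
have -> : [set y | agree n.+1 x y] =
    [set y | y 0%N = x 0%N /\ [set z | agree n (left_shift x) z] (left_shift y)].
  apply/seteqP; split => y /=.
    by move=> xy; split; [rewrite -xy|exact: (@agree_shift _ 1)].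
  by move=> [y0 h] [|i] // ni; exact: h.
rewrite (transfer_invariant _ fB inv fe).
set B := [set z | _].
have mB : measurable B by exact: fdim_measurable fB.
have bB : bmeas (\1_B : X -> R) by exact: bmeas_indic.
have bI : bmeas (fun z => expR (phi (prepend (x 0%N) z)) * \1_B z).
  exact: bmeas_weight fB.
have hz z : B z -> `|phi (prepend (x 0%N) z) - phi x| <= v n.+1.
  move=> Bz; apply: vphi; rewrite -[x in agree _ _ x]prepend_left_shift.
  by apply: agree_prepend; exact: agree_sym.
have [/andP[l u]] := IH (left_shift x).
rewrite big_ord_recr/= birkhoffS.
apply/andP; split.
  apply: (@le_trans _ _ (expR (phi x - v n.+1) * pr mu B)).
    apply: le_trans (ler_wpM2l (expR_ge0 _) l).
    by rewrite -expRD ler_expR; lra.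
  rewrite -Rint_indic// -RintZ//; apply: Rint_le => //; first exact: bmeasZ.
  move=> z; rewrite indicE; have [zB|zB] := boolP (z \in B); last by rewrite !mulr0.
  rewrite !mulr1 ler_expR; move: zB; rewrite inE => /hz.
  by rewrite ler_norml => /andP[]; lra.
apply: (@le_trans _ _ (expR (phi x + v n.+1) * pr mu B)).
  rewrite -Rint_indic// -RintZ//; apply: Rint_le => //; first exact: bmeasZ.
  move=> z; rewrite indicE; have [zB|zB] := boolP (z \in B); last by rewrite !mulr0.
  rewrite !mulr1 ler_expR; move: zB; rewrite inE => /hz.
  by rewrite ler_norml => /andP[]; lra.
apply: le_trans (ler_wpM2l (expR_ge0 _) u) _.
by rewrite -expRD ler_expR; lra.
Qed.

End transfer_invariance.

(** * A measure with prescribed weights of cylinders *)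

Section interval_coding.
Context {R : realType} {A : alphabetType}.
Notation X := (shift_space A).

(** Words are stored in reverse: [p r] is the weight of the cylinder of
    [rev r], and [I r] is a subinterval of [[0, 1[] of length [p r]; the
    intervals [I (a :: r)] partition [I r] from left to right, in the order of
    [enum A]. *)
Variable p : seq A -> R.
Hypothesis p_ge0 : forall r, 0 <= p r.
Hypothesis p_nil : p [::] = 1.
Hypothesis p_cons : forall r, \sum_(a : A) p (a :: r) = p r.

(** The [j]-th letter; the default value is not used, as [j < #|A|]. *)
Let ltr (j : nat) : A := nth point (enum A) j.

(** The total weight of the first [i] letters after [rev r]. *)
Let offset r i := \sum_(j < i) p (ltr j :: r).

(** The left end of [I r]. *)
Fixpoint code_left r :=
  if r is a :: s then code_left s + offset s (index a (enum A)) else 0.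

Let I r (t : R) := code_left r <= t < code_left r + p r.

(** The letter [a] such that [t] lies in [I (a :: r)], for [t] in [I r]. *)
Let code_letter r t :=
  ltr (find (fun i => t < code_left r + offset r i.+1) (iota 0 #|A|)).

Let offset_card r : offset r #|A| = p r.
Proof.
rewrite -p_cons -(big_enum _ _ _ (fun a => p (a :: r)))/= /offset.
by rewrite (big_nth point) -cardE big_mkord.
Qed.

Let offset_le r i j : (i <= j)%N -> offset r i <= offset r j.
Proof.
move=> ij; rewrite -(subnKC ij) /offset big_split_ord/= lerDl.
exact: sumr_ge0.
Qed.

Let offsetS r i : offset r i.+1 = offset r i + p (ltr i :: r).
Proof. by rewrite /offset big_ord_recr. Qed.

Let index_ltr i : (i < #|A|)%N -> index (ltr i) (enum A) = i.
Proof. by move=> iA; rewrite index_uniq ?enum_uniq// -cardE. Qed.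

Let ltr_index a : ltr (index a (enum A)) = a.
Proof. by rewrite /ltr nth_index// mem_enum. Qed.

Let I_cons a r t : I (a :: r) t -> I r t.
Proof.
rewrite /I /= => /andP[h1 h2].
have := offsetS r (index a (enum A)); rewrite ltr_index => E.
have o0 : 0 <= offset r (index a (enum A)) by exact: sumr_ge0.
have : offset r (index a (enum A)).+1 <= p r.
  by rewrite -offset_card; apply: offset_le; rewrite cardE index_mem mem_enum.
by move=> h; apply/andP; split; lra.
Qed.

Let I_letter r t : I r t -> I (code_letter r t :: r) t.
Proof.
move=> /andP[h1 h2]; rewrite /code_letter.
set P := fun i => _; set s := iota 0 #|A|; set k := find P s.
have c0 : (0 < #|A|)%N by apply/card_gt0P; exists point.
have hP : has P s.
  apply/hasP; exists #|A|.-1; first by rewrite mem_iota; lia.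
  by rewrite /P prednK// offset_card.
have kA : (k < #|A|)%N by have := hP; rewrite has_find size_iota.
have := nth_find 0%N hP; rewrite -/k nth_iota// add0n /P => tk.
rewrite /I /= index_ltr// -addrA -offsetS tk andbT.
have [->|k0] := posnP k; first by rewrite /offset big_ord0 addr0.
have := @before_find _ 0%N P s k.-1; rewrite prednK// leqnn => /(_ isT).
by rewrite nth_iota ?add0n /P ?prednK//; [move/negbT; rewrite -leNgt|lia].
Qed.

Let I_inj a b r t : I (a :: r) t -> I (b :: r) t -> a = b.
Proof.
wlog ab : a b / (index a (enum A) <= index b (enum A))%N.
  move=> H h1 h2; have [/H|/ltnW/H] := leqP (index a (enum A)) (index b (enum A)).
    exact.
  by move=> ->.
move=> /andP[_ ha] /andP[hb _].
have [->//|ne] := eqVneq a b.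
have ab' : (index a (enum A) < index b (enum A))%N.
  rewrite ltn_neqAle ab andbT; apply: contra ne => /eqP e.
  by rewrite -(ltr_index a) e ltr_index.
have := offset_le r ab'; rewrite offsetS ltr_index.
move: ha hb => /= ha hb h; exfalso; clear ne; lra.
Qed.

(** The first [n] letters of the sequence coded by [t], in reverse. *)
Fixpoint code_state t n : seq A :=
  if n is m.+1 then code_letter (code_state t m) t :: code_state t m else [::].

Let code t : X := if 0 <= t < 1 then fun n => code_letter (code_state t n) t else point.

Let code_stateE t n : 0 <= t < 1 -> code_state t n = rev (initial n (code t)).
Proof.
move=> t01; elim: n => [|n IH]; first by apply/esym/size0nil; rewrite size_rev size_tuple.
have -> : rev (initial n.+1 (code t)) = code t n :: rev (initial n (code t)).
  rewrite -rev_rcons; congr rev; apply: (@eq_from_nth _ point).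
    by rewrite size_rcons !size_tuple.
  move=> i; rewrite size_tuple => ni.
  rewrite nth_initial// nth_rcons size_tuple.
  case: ltngtP => [h|h|->//]; last by lia.
  by rewrite nth_initial.
by rewrite -IH /= /code t01.
Qed.

Let code_stateP t r : 0 <= t < 1 -> code_state t (size r) = r <-> I r t.
Proof.
move=> t01; have I0 : I [::] t by rewrite /I /= p_nil add0r.
have Ist n : I (code_state t n) t by elim: n => //= n IH; exact: I_letter.
split=> [<-//|]; elim: r => [//|a r IH] Iar /=.
rewrite IH; last exact: I_cons Iar.
congr cons; apply: (I_inj _ Iar); apply: I_letter; exact: I_cons Iar.
Qed.

Let codeP n (w : n.-tuple A) t : 0 <= t < 1 -> initial n (code t) = w <-> I (rev w) t.
Proof.
move=> t01; rewrite -code_stateP// size_rev size_tuple code_stateE//.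
split=> [->//|/(congr1 rev)]; rewrite !revK => h; exact: val_inj.
Qed.

Let measurable_I r : measurable [set t : R | I r t].
Proof.
have -> : [set t : R | I r t] = `[code_left r, code_left r + p r[%classic.
  by apply/seteqP; split => t /=; rewrite in_itv.
exact: measurable_itv.
Qed.

Let measurable_code : measurable_fun setT code.
Proof.
apply: (measurability [set B | exists n, fdim n B]).
  exact: measurable_fdimE.
move=> _ [B [n nB] <-]; rewrite setTI.
pose D : set R := `[0, 1[%classic.
have mD : measurable D by exact: measurable_itv.
have DE t : D t <-> 0 <= t < 1 by rewrite /D /= in_itv.
have -> : code @^-1` B = (~` D `&` [set t | B point]) `|`
    \bigcup_(w in [set w : n.-tuple A | B (concat w point)]) (D `&` [set t | I (rev w) t]).
  apply/seteqP; split => t /=.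
    have [Dt|nDt] := pselect (D t).
      move=> Bt; right; exists (initial n (code t)) => /=.
        by apply: nB Bt; exact: concat_initial_agree.
      by split => //; exact: (codeP (initial n (code t)) ((DE t).1 Dt)).1.
    by rewrite /code; case: ifP => h Bp; [case: nDt; apply/DE|left].
  move=> [[nDt Bp]|[w /= Bw [Dt]]].
    by rewrite /code; case: ifP => // h; case: nDt; apply/DE.
  move=> /codeP => /(_ ((DE t).1 Dt)) h; apply: nB Bw; rewrite -h.
  by apply: agree_sym; exact: concat_initial_agree.
apply: measurableU.
  by have [h|h] := pselect (B point);
    [rewrite (_ : [set t | B point] = setT)|rewrite (_ : [set t | B point] = set0)];
    rewrite ?setIT ?setI0//; [exact: measurableC|apply/seteqP; split..].
apply: fin_bigcup_measurable => // w _; apply: measurableI => //.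
Qed.

Let measurable_codeR : @measurable_fun _ _ (measurableTypeR R) X setT code.
Proof. exact: measurable_code. Qed.

Let code_mfun : {mfun (measurableTypeR R) >-> X} :=
  HB.pack (code : measurableTypeR R -> X)
    (isMeasurableFun.Build _ _ _ _ _ measurable_codeR).

(** Consistent weights of words are the weights of a measure: the image of the
    uniform measure on [[0, 1]] under the coding. *)
Lemma coding_measure : exists nu : probability X R, forall n (w : n.-tuple A),
  pr nu (@initial A n @^-1` [set w]) = p (rev w).
Proof.
exists (distribution (uniform_prob (@ltr01 R)) code_mfun) => n w.
pose U : probability (measurableTypeR R) R := uniform_prob (@ltr01 R).
have UE a b : 0 <= a -> a <= b -> b <= 1 -> pr U `[a, b[%classic = b - a.
  move=> a0 ab b1; rewrite /pr /U /= /uniform_prob.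
  rewrite (eq_integral (fun=> 1%:E)); last first.
    move=> x; rewrite inE /= in_itv /= => /andP[ax xb].
    by rewrite /uniform_pdf (le_trans a0 ax) (le_trans (ltW xb) b1) subr0 invr1.
  rewrite integral_cst//= mul1e lebesgue_measure_itv/= lte_fin.
  by case: ltgtP ab => //= ->; rewrite subrr.
pose D : set (measurableTypeR R) := `[0, 1[%classic.
have mD : measurable D by exact: (@measurable_itv R).
have mc B : measurable B -> measurable (code @^-1` B : set (measurableTypeR R)).
  by move=> mB; rewrite -[X in measurable X]setTI; exact: measurable_codeR.
set B := (X in pr _ X).
have mB : measurable B by exact: measurable_initial.
change (pr U (code @^-1` B) = p (rev w)).
have -> : pr U (code @^-1` B) = pr U (code @^-1` B `&` D).
  apply/eqP; rewrite eq_le; apply/andP; split; last first.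
    by apply: pr_le; [apply: measurableI => //; exact: mc|exact: mc|exact: subIsetl].
  have -> : pr U (code @^-1` B `&` D) = pr U (code @^-1` B `&` D) + pr U (~` D).
    by rewrite prC// UE// subr0 subrr addr0.
  apply: le_trans (prU_le _ _ _).
  - apply: pr_le; [exact: mc|apply: measurableU; [apply: measurableI => //; exact: mc|exact: measurableC]|].
    by move=> t Bt; have [Dt|Dt] := pselect (D t); [left|right].
  - by apply: measurableI => //; exact: mc.
  - exact: measurableC.
have -> : code @^-1` B `&` D = `[code_left (rev w), code_left (rev w) + p (rev w)[%classic.
  have I01 r t : I r t -> 0 <= t < 1.
    elim: r => [|a r IH]; last by move=> /I_cons /IH.
    by rewrite /I /= p_nil add0r.
  apply/seteqP; split => t /=.
    by rewrite /D /= !in_itv /= => -[h t01]; exact/codeP.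
  by rewrite /D /= !in_itv /= => h; have t01 := I01 _ _ h; split => //; exact/codeP.
have [l0 l1] : 0 <= code_left (rev w) /\ code_left (rev w) + p (rev w) <= 1.
  elim: (rev w) => [|a r [IH1 IH2]] /=; first by rewrite p_nil add0r.
  have o0 : 0 <= offset r (index a (enum A)) by exact: sumr_ge0.
  have := offsetS r (index a (enum A)); rewrite ltr_index => E.
  have : offset r (index a (enum A)).+1 <= p r.
    by rewrite -offset_card; apply: offset_le; rewrite cardE index_mem mem_enum.
  by move=> h; split; lra.
by rewrite UE// ?lerDl// addrAC subrr add0r.
Qed.

End interval_coding.

(** * The pressure of a normalized potential is non-negative *)

Section ultralimit.
Context {R : realType}.

(** Bounded sequences converge along ultrafilters. *)
Lemma bounded_ultralimit (U : set_system nat) (u : nat -> R) (a b : R) :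
  UltraFilter U -> (forall n, a <= u n <= b) -> exists l : R, u @ U --> l.
Proof.
move=> UU uab.
have H : (u @ U) `[a, b]%classic.
  apply: (@filterS _ U _ setT); last exact: filterT.
  by move=> n _ /=; rewrite in_itv /= uab.
have [l [_ cl]] := @segment_compact R a b (u @ U) _ H; exists l => N Nl.
have [//|UN] := in_ultra_setVsetC (u @^-1` N) UU.
have [x [/= nNx Nx]] := cl (~` N) N UN Nl.
by [].
Qed.

End ultralimit.

Section existence.
Context {R : realType} {A : alphabetType}.
Notation X := (shift_space A).
Notation shift k := (iter k (@left_shift A)).
Implicit Types (x y z : X) (n m k : nat) (w : seq A).
Variables (phi : X -> R) (v : nat -> R) (C : R).
Hypothesis nphi : normalized phi.
Hypothesis vphi : variation_bound phi v.
Hypothesis v_sum : forall n, \sum_(i < n) v i.+1 <= C.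
Hypothesis uphi : ucont phi.

(** The cylinder of a word; [point] is only used to extend the word to a
    sequence. *)
Definition cylinder w : set X := [set x | agree (size w) (concat w point) x].

Lemma cylinder_cons a w x : cylinder (a :: w) x <-> x 0%N = a /\ cylinder w (left_shift x).
Proof.
split=> [h|[x0 h] [|i] //= ni]; first split.
- by rewrite -(h 0%N).
- by move=> i ni; exact: (h i.+1).
- exact: h.
Qed.

(** The [i]-th iterate of the transfer operator at the base point. *)
Let T i (f : X -> R) : R :=
  \sum_(w : i.-tuple A) expR (birkhoff phi i (concat w point)) * f (concat w point).

(** The transfer operator. *)
Let L (f : X -> R) x := \sum_(a : A) expR (phi (prepend a x)) * f (prepend a x).

Let T_le i f g : (forall x, f x <= g x) -> T i f <= T i g.
Proof. by move=> fg; apply: ler_sum => w _; rewrite ler_wpM2l ?expR_ge0. Qed.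

Let T_cst i c : T i (fun=> c) = c.
Proof. by rewrite /T -mulr_suml normalized_words// mul1r. Qed.

Let T_Z i c f : T i (fun x => c * f x) = c * T i f.
Proof. by rewrite /T mulr_sumr; apply: eq_bigr => w _; rewrite mulrCA. Qed.

Let T_sum i (F : A -> X -> R) : T i (fun x => \sum_a F a x) = \sum_a T i (F a).
Proof.
by rewrite /T exchange_big; apply: eq_bigr => w _; rewrite mulr_sumr.
Qed.

Let T_S i f : T i.+1 f = T i (L f).
Proof.
rewrite /T big_tupleS exchange_big; apply: eq_bigr => w _ /=.
rewrite /L mulr_sumr; apply: eq_bigr => a _.
by rewrite birkhoffS expRD left_shift_prepend mulrA [X in X * _]mulrC.
Qed.

(** Indicator functions of cylinders. *)
Let ind w : X -> R := \1_(cylinder w).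

Let ind_ge0 w x : 0 <= ind w x. Proof. by rewrite /ind indicE ler0n. Qed.

Let ind_le1 w x : ind w x <= 1.
Proof. by rewrite /ind indicE; case: (_ \in _). Qed.

Let T01 i w : 0 <= T i (ind w) <= 1.
Proof.
by rewrite -{1}(T_cst i 0) -(T_cst i 1); apply/andP; split; apply: T_le => x.
Qed.

Let ind_nil x : ind [::] x = 1.
Proof. by rewrite /ind indicE mem_set. Qed.

Let ind_rcons w x : \sum_a ind (rcons w a) x = ind w x.
Proof.
have E a : cylinder (rcons w a) x <-> cylinder w x /\ x (size w) = a.
  rewrite /cylinder /= size_rcons; split=> [h|[h e] i].
    split=> [i ni|]; last first.
      by rewrite -h// concat_nth size_rcons ltnSn nth_rcons ltnn eqxx.
    rewrite -h; last exact: leqW.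
    by rewrite !concat_nth size_rcons ltnS (ltnW ni) nth_rcons ni.
  rewrite ltnS leq_eqVlt => /orP[/eqP ->|ni].
    by rewrite e concat_nth size_rcons ltnSn nth_rcons ltnn eqxx.
  by rewrite -h// !concat_nth size_rcons ltnS (ltnW ni) nth_rcons ni.
rewrite (bigD1 (x (size w)))//= big1 ?addr0 /ind ?indicE.
  have [wx|wx] := boolP (x \in cylinder w).
    by rewrite mem_set//; apply/E; split => //; exact/set_mem.
  by rewrite memNset// => /E[/mem_set]; rewrite (negbTE wx).
move=> a ax; rewrite indicE memNset// => /E[_ e].
by rewrite e eqxx in ax.
Qed.

Let L_cons a w x : L (ind (a :: w)) x = expR (phi (prepend a x)) * ind w x.
Proof.
have E b : (prepend b x \in cylinder (a :: w)) = (b == a) && (x \in cylinder w).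
  apply/idP/andP; rewrite !inE; first by move=> /cylinder_cons[/= -> h]; split.
  by move=> [/eqP -> h]; apply/cylinder_cons.
rewrite /L (bigD1 a)//= big1 ?addr0 /ind ?indicE ?E ?eqxx//.
by move=> b ba; rewrite indicE E (negbTE ba) mulr0.
Qed.

Let T_shift i w : \sum_a T i.+1 (ind (a :: w)) = T i (ind w).
Proof.
under eq_bigr do rewrite T_S.
rewrite -T_sum /T; apply: eq_bigr => t _; congr (_ * _).
under eq_bigr do rewrite L_cons.
by rewrite -mulr_suml nphi mul1r.
Qed.

(** Gibbs bounds already hold for the iterates of the transfer operator. *)
Let T_gibbs i w x : (size w <= i)%N ->
  expR (birkhoff phi (size w) (concat w x) - \sum_(j < size w) v j.+1) <=
  T i (ind w) <=
  expR (birkhoff phi (size w) (concat w x) + \sum_(j < size w) v j.+1).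
Proof.
elim: w i => [|a w IH] i.
  move=> _; have -> : T i (ind [::]) = 1.
    by rewrite -[RHS](T_cst i 1); apply: eq_bigr => w _; rewrite ind_nil.
  by rewrite /= big_ord0 subr0 addr0 birkhoff0 expR0 lexx.
case: i => // i; rewrite ltnS => wi.
rewrite T_S (_ : L _ = fun z => expR (phi (prepend a z)) * ind w z); last first.
  by apply/funext => z; exact: L_cons.
have /andP[l u] := IH i wi.
have h z : cylinder w z ->
    `|phi (prepend a z) - phi (prepend a (concat w x))| <= v (size w).+1.
  move=> wz; apply: vphi; apply: agree_prepend.
  by apply: agree_trans (agree_sym wz) _; exact: concat_agree.
rewrite big_ord_recr [birkhoff _ (size (_ :: _)) _]birkhoffS [left_shift _]/=.
set p := phi _; set S := birkhoff _ _ _; set V := \sum_(j < _) _.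
rewrite -/S in l u; rewrite -/V in l u.
apply/andP; split.
  apply: (@le_trans _ _ (T i (fun z => expR (p - v (size w).+1) * ind w z))).
    rewrite T_Z; apply: le_trans (ler_wpM2l (expR_ge0 _) l).
    by rewrite -expRD ler_expR /=; lra.
  apply: T_le => z; rewrite /ind indicE.
  have [zw|zw] := boolP (z \in cylinder w); last by rewrite !mulr0.
  rewrite !mulr1 ler_expR; move: zw; rewrite inE => /h.
  by rewrite ler_norml => /andP[]; rewrite /p /=; lra.
apply: (@le_trans _ _ (T i (fun z => expR (p + v (size w).+1) * ind w z))).
  apply: T_le => z; rewrite /ind indicE.
  have [zw|zw] := boolP (z \in cylinder w); last by rewrite !mulr0.
  rewrite !mulr1 ler_expR; move: zw; rewrite inE => /h.
  by rewrite ler_norml => /andP[]; rewrite /p /=; lra.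
rewrite T_Z; apply: le_trans (ler_wpM2l (expR_ge0 _) u) _.
by rewrite -expRD ler_expR /=; lra.
Qed.

(** Averages of the iterates from [n + 1] to [2 n + 1]: starting late, all their
    terms satisfy the Gibbs bounds for words of length at most [n]. *)
Let c n w : R := n.+1%:R^-1 * \sum_(i < n.+1) T (n.+1 + i) (ind w).

Let c_between n w a b :
  (forall i, (n < i)%N -> a <= T i (ind w) <= b) -> a <= c n w <= b.
Proof.
move=> h; rewrite /c; have n0 : 0 < n.+1%:R :> R by rewrite ltr0n.
rewrite ler_pdivlMl// ler_pdivrMl//; apply/andP; split.
  apply: (@le_trans _ _ (\sum_(i < n.+1) a)).
    by rewrite sumr_const card_ord mulr_natl.
  by apply: ler_sum => i _; have /andP[] := h (n.+1 + i)%N (leq_addr _ _).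
apply: (@le_trans _ _ (\sum_(i < n.+1) b)).
  by apply: ler_sum => i _; have /andP[] := h (n.+1 + i)%N (leq_addr _ _).
by rewrite sumr_const card_ord mulr_natl.
Qed.

Let c01 n w : 0 <= c n w <= 1.
Proof. by apply: c_between => i _; exact: T01. Qed.

Let c_rcons n w : \sum_a c n (rcons w a) = c n w.
Proof.
rewrite /c -mulr_sumr exchange_big; congr (_ * _); apply: eq_bigr => i _.
by rewrite -T_sum; congr (T _ _); apply/funext => x; exact: ind_rcons.
Qed.

Let c_shift n w : `|\sum_a c n (a :: w) - c n w| <= n.+1%:R^-1.
Proof.
rewrite /c -mulr_sumr exchange_big -mulrBr normrM ger0_norm ?invr_ge0 ?ler0n//.
rewrite -[leRHS]mulr1 ler_wpM2l ?invr_ge0 ?ler0n//.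
under eq_bigr do rewrite addSn T_shift.
rewrite big_ord_recl [X in _ - X]big_ord_recr /=.
rewrite (eq_bigr (fun i : 'I_n => T (n.+1 + i) (ind w))); last first.
  by move=> i _; rewrite addnS.
rewrite addn0 [X in _ - X]addrC opprD addrACA subrr addr0.
have /andP[a1 a2] := T01 n w; have /andP[b1 b2] := T01 (n.+1 + n) w.
by rewrite ler_norml; apply/andP; split; lra.
Qed.

(** The weights are limits of these averages along an ultrafilter. *)
Lemma invariant_gibbs_exists : exists nu : probability X R,
  invariant_measure (@left_shift A) nu /\
  forall n x, expR (birkhoff phi n x - C) <= pr nu [set y | agree n x y] <=
    expR (birkhoff phi n x + C).
Proof.
have [U [UU ooU]] := @ultraFilterLemma nat \oo _.
have [q hq] : {q : seq A -> R & forall w, (c^~ w) @ U --> q w}.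
  apply: (@choice _ _ (fun w l => (c^~ w) @ U --> l)) => w.
  exact: (@bounded_ultralimit _ U _ 0 1).
have q01 w : 0 <= q w <= 1.
  apply/andP; split; [apply: (cvgr_to_ge (hq w))|apply: (cvgr_to_le (hq w))];
    by apply: nearW => n; have /andP[] := c01 n w.
have qsum (F : A -> seq A) :
    (fun n => \sum_a c n (F a)) @ U --> \sum_a q (F a).
  by apply: cvg_big => [|a _]; [exact: add_continuous|exact: hq].
have q_nil : q [::] = 1.
  apply/eqP; rewrite eq_le; have /andP[_ -> /=] := q01 [::].
  apply: (cvgr_to_ge (hq [::])); apply: nearW => n.
  suff /andP[] : 1 <= c n [::] <= 1 by [].
  apply: c_between => i _; have := @T_gibbs i [::] point isT.
  by rewrite /= big_ord0 birkhoff0 subr0 addr0 expR0.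
have q_rcons w : \sum_a q (rcons w a) = q w.
  have := qsum (rcons w); rewrite (_ : (fun n => _) = c^~ w).
    by move=> /(cvg_unique _ (hq w)) ->.
  by apply/funext => n; exact: c_rcons.
have q_shift w : \sum_a q (a :: w) = q w.
  apply/eqP; rewrite -subr_eq0; apply/eqP.
  have h0 : (fun n => \sum_a c n (a :: w) - c n w) @ U --> (0 : R).
    have : (fun n => n.+1%:R^-1 : R) @ U --> (0 : R).
      exact: cvg_trans (cvg_app _ ooU) (@cvg_harmonic R).
    move=> hU; apply/cvgr0Pnorm_le => e e0.
    move/cvgr0Pnorm_le : hU => /(_ _ e0); apply: filterS => n.
    by apply: le_trans; rewrite [leRHS]ger0_norm ?invr_ge0 ?ler0n//; exact: c_shift.
  have h1 : (fun n => \sum_a c n (a :: w) - c n w) @ U --> \sum_a q (a :: w) - q w.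
    by apply: cvgB => //; exact: (qsum (fun a => a :: w)).
  exact: (cvg_unique _ h1 h0).
have q_gibbs w x : expR (birkhoff phi (size w) (concat w x) - C) <= q w <=
    expR (birkhoff phi (size w) (concat w x) + C).
  have H n : (size w <= n)%N -> expR (birkhoff phi (size w) (concat w x) - C) <= c n w <=
    expR (birkhoff phi (size w) (concat w x) + C).
    move=> wn; apply: c_between => i ni.
    have /andP[l u] := @T_gibbs i w x (leq_trans wn (ltnW ni)).
    apply/andP; split.
      by apply: le_trans l; rewrite ler_expR lerB.
    by apply: le_trans u _; rewrite ler_expR lerD.
  have ev : \forall n \near U, (size w <= n)%N.
    by apply: ooU; exact: nbhs_infty_ge.
  apply/andP; split; [apply: (cvgr_to_ge (hq w))|apply: (cvgr_to_le (hq w))];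
    by apply: filterS ev => n /H /andP[].
have p_cons r : \sum_a q (rev (a :: r)) = q (rev r).
  by rewrite -q_rcons; apply: eq_bigr => a _; rewrite rev_cons.
have [nu hnu] := @coding_measure R A (fun r => q (rev r))
   (fun r => (andP (q01 (rev r))).1) q_nil p_cons.
have nuE n (w : n.-tuple A) : pr nu (@initial A n @^-1` [set w]) = q w.
  by rewrite hnu revK.
exists nu; split; last first.
  move=> n x; have -> : [set y | agree n x y] = @initial A n @^-1` [set initial n x].
    by apply/seteqP; split => y /= h; [apply/esym/initialP|apply/initialP].
  rewrite nuE; have := q_gibbs (initial n x) (shift n x).
  by rewrite size_tuple concat_initial_shift.
have nuB n B : fdim n B ->
    pr nu B = \sum_(w : n.-tuple A) \1_B (concat w point) * q w.
  move=> nB; rewrite -Rint_indic; last exact: fdim_measurable nB.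
  rewrite (@Rint_fdim _ _ nu n _ point); last first.
    by move=> x y xy; rewrite !indicE (fdim_mem nB xy).
  by apply: eq_bigr => w _; rewrite nuE.
have mth := @measurable_fun_left_shift A.
suff H B : measurable B -> nu B = pushforward nu (@left_shift A) B.
  by move=> B mB; rewrite [RHS]H.
apply: (@measure_unique _ R X [set B | exists n, fdim n B] (fun=> setT)
  measurable_fdimE setI_closed_fdim).
- by move=> _; exists 0%N.
- by rewrite bigcup_const.
- move=> B' [n nB]; have nB' : fdim n.+1 (@left_shift A @^-1` B').
    by move=> x y xy; apply: nB; exact: (@agree_shift _ 1).
  change (nu B' = nu (@left_shift A @^-1` B')); rewrite (prE _ (fdim_measurable nB)) (prE _ (fdim_measurable nB')).
  congr EFin; rewrite (nuB _ _ nB) (nuB _ _ nB') big_tupleS exchange_big.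
  apply: eq_bigr => w _; rewrite -q_shift mulr_sumr; apply: eq_bigr => a _.
  by rewrite !indicE.
- by move=> _; rewrite -ge0_fin_numE// fin_num_measure.
Qed.

(** The one-cylinder partition has entropy [- int phi] for a Gibbs measure. *)
Lemma gibbs_free_energy (nu : probability X R) :
  invariant_measure (@left_shift A) nu ->
  (forall n x, expR (birkhoff phi n x - C) <= pr nu [set y | agree n x y] <=
    expR (birkhoff phi n x + C)) ->
  (0 <= free_energy phi nu)%E.
Proof.
move=> inv gibbs.
have bphi := ucont_bmeas uphi.
pose P (i : 'I_#|A|) : set X := [set x | enum_rank (x 0%N) = i].
have fP i : fdim 1 (P i) by move=> x y xy /=; rewrite /P /= (xy 0%N).
have partP : finite_measurable_partition P.
  split=> [i||].
  - exact: fdim_measurable (fP i).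
  - by move=> i j _ _ [x [/= <- <-]].
  - by apply/seteqP; split => // x _; exists (enum_rank (x 0%N)).
pose xi n x : {ffun 'I_n -> 'I_#|A|} := [ffun i : 'I_n => enum_rank (x i)].
have xiE n (f : {ffun 'I_n -> 'I_#|A|}) : join_atom (@left_shift A) P f = @xi n @^-1` [set f].
  apply/seteqP; split => x /=.
    move=> h; apply/ffunP => i; rewrite ffunE; have := h i.
    by rewrite /P /= iter_shiftE addn0.
  by move=> <- i; rewrite ffunE /P /= iter_shiftE addn0.
have xiA n x y : xi n x = xi n y <-> agree n x y.
  split=> [h i ni|h].
    have := congr1 (fun f : {ffun 'I_n -> 'I_#|A|} => f (Ordinal ni)) h.
    by rewrite !ffunE => /enum_rank_inj.
  by apply/ffunP => i; rewrite !ffunE h.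
have mxi n (f : {ffun 'I_n -> 'I_#|A|}) : measurable (@xi n @^-1` [set f]).
  apply: (@fdim_measurable _ n) => x y /xiA xy /= <-.
  by rewrite -xy.
have HE n : join_entropy (@left_shift A) nu P n =
    - \int[nu]_x ln (pr nu (@xi n @^-1` [set xi n x])).
  rewrite (Rint_finite nu (@mxi n) (fun f => ln (pr nu (@xi n @^-1` [set f])))).
  rewrite /join_entropy; congr (- _); apply: eq_bigr => f _.
  by rewrite xiE mulrC.
have Hn n : `|n%:R * (- \int[nu]_x phi x) - join_entropy (@left_shift A) nu P n| <= C.
  have bl : bmeas (fun x => ln (pr nu (@xi n @^-1` [set xi n x]))).
    exact: (bmeas_finite (@mxi n) (fun f => ln (pr nu (@xi n @^-1` [set f])))).
  have h x : birkhoff phi n x - C <= ln (pr nu (@xi n @^-1` [set xi n x])) <=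
      birkhoff phi n x + C.
    have /andP[l u] := gibbs n x.
    have -> : @xi n @^-1` [set xi n x] = [set y | agree n x y].
      by apply/seteqP; split => y /= h; [apply/xiA|apply/esym/xiA].
    have p0 : 0 < pr nu [set y | agree n x y] by apply: lt_le_trans l; exact: expR_gt0.
    by apply/andP; split; rewrite -ler_expR lnK ?posrE.
  have bS := bmeas_birkhoff n bphi.
  have l : n%:R * \int[nu]_x phi x - C <=
      \int[nu]_x ln (pr nu (@xi n @^-1` [set xi n x])).
    rewrite -Rint_birkhoff// -(Rint_cst nu (- C)) -RintD//; last exact: bmeas_cst.
    apply: Rint_le => //; first by apply: bmeasD => //; exact: bmeas_cst.
    by move=> x; have /andP[] := h x.
  have u : \int[nu]_x ln (pr nu (@xi n @^-1` [set xi n x])) <=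
      n%:R * \int[nu]_x phi x + C.
    rewrite -Rint_birkhoff// -[X in _ + X](Rint_cst nu C) -RintD//; last exact: bmeas_cst.
    apply: Rint_le => //; first by apply: bmeasD => //; exact: bmeas_cst.
    by move=> x; have /andP[] := h x.
  by rewrite HE mulrN ler_norml; apply/andP; split; lra.
have PE : partition_entropy (@left_shift A) nu P = (- \int[nu]_x phi x)%:E.
  apply/cvg_lim => //; apply: cvg_EFin; first by apply: nearW.
  apply/cvgrPdist_le => e e0 /=.
  exists (Num.truncn (C / e)).+1 => // n /= Cn.
  have n0 : 0 < n%:R :> R by rewrite ltr0n (leq_trans _ Cn).
  have Ce : C / e < n%:R.
    by apply: lt_le_trans (truncnS_gt _) _; rewrite ler_nat.
  rewrite -(@ler_pM2l _ n%:R)// -[X in X * `|_|]ger0_norm ?ltW// -normrM.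
  rewrite mulrBr mulrA divff ?gt_eqF// mul1r.
  apply: le_lt_trans (Hn n) _; move: Ce; rewrite ltr_pdivrMr//.
rewrite /free_energy EFin_Rint// -leeBlDr// add0e -EFinN.
rewrite -PE; apply: ereal_sup_ubound.
by exists #|A|, P.
Qed.

Lemma pressure_ge0 : (0 <= pressure phi)%E.
Proof.
have [nu [inv gibbs]] := invariant_gibbs_exists.
apply: le_trans (gibbs_free_energy inv gibbs) _.
by apply: ereal_sup_ubound; exists nu.
Qed.

End existence.

(** * Gibbs measures: mixing and periodic orbits *)

Section gibbs_measure.
Context {R : realType} {A : alphabetType}.
Notation X := (shift_space A).
Notation shift k := (iter k (@left_shift A)).
Implicit Types (x y z : X) (n m k l : nat).
Variables (mu : probability X R) (phi : X -> R) (C : R).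
Hypothesis inv : invariant_measure (@left_shift A) mu.
Hypothesis nphi : normalized phi.
Hypothesis bphi : bmeas phi.
Hypothesis dphi : distortion phi C.

(** The cylinder of length [n] around [x], and its measure. *)
Definition ball_cyl n x : set X := [set y | agree n x y].
Definition cyl_measure n x : R := pr mu (ball_cyl n x).

Hypothesis gibbs : forall n x,
  expR (birkhoff phi n x - C) <= cyl_measure n x <= expR (birkhoff phi n x + C).

Let gibbs_lower n x : expR (birkhoff phi n x - C) <= cyl_measure n x.
Proof. by have /andP[] := gibbs n x. Qed.

Let gibbs_upper n x : cyl_measure n x <= expR (birkhoff phi n x + C).
Proof. by have /andP[] := gibbs n x. Qed.

Lemma measurable_ball_cyl n x : measurable (ball_cyl n x).
Proof. exact: fdim_measurable (@fdim_agree _ n x). Qed.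

Lemma ball_cyl_initial n (w : n.-tuple A) y :
  @initial A n @^-1` [set w] = ball_cyl n (concat w y).
Proof.
apply/seteqP; split => x /=.
  by move=> <-; apply: agree_sym; exact: concat_initial_agree.
by move/initialP; rewrite initial_concat.
Qed.

Lemma fdim_cyl_measure n : fdim_fun n (cyl_measure n).
Proof.
move=> x y xy; congr (pr mu _); apply/seteqP; split => z h.
  exact: agree_trans (agree_sym xy) h.
exact: agree_trans xy h.
Qed.

Lemma cyl_measure_sum n y : \sum_(w : n.-tuple A) cyl_measure n (concat w y) = 1.
Proof.
rewrite -(pr_finite_sum mu (@measurable_initial A n)).
by apply: eq_bigr => w _; rewrite (ball_cyl_initial w y).
Qed.

(** The constant of [mixing_lower]. *)
Definition mixing_const : R := expR (- (3 * C)).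

(** Mixing from below: the future is independent of the past up to a constant
    factor. *)
Lemma mixing_lower n m (F G : X -> R) : fdim_fun n F -> fdim_fun m G ->
  (forall x, 0 <= F x) -> (forall x, 0 <= G x) ->
  mixing_const * (\int[mu]_x F x * \int[mu]_x G x) <=
  \int[mu]_x (F x * G (shift n x)).
Proof.
move=> nF mG F0 G0.
pose xi x := (initial n x, initial m (shift n x)).
have xiE (p : n.-tuple A * m.-tuple A) :
    xi @^-1` [set p] = ball_cyl (n + m) (concat p.1 (concat p.2 point)).
  case: p => u w; apply/seteqP; split => x /=.
    case=> <- <-; apply: agree_add.
      by apply: agree_sym; exact: concat_initial_agree.
    rewrite iter_shift_concat_tuple.
    by apply: agree_sym; exact: concat_initial_agree.
  move=> h; congr pair.
    transitivity (initial n (concat u (concat w point))); last by rewrite initial_concat.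
    by apply/esym/initialP; apply: agree_le h; exact: leq_addr.
  transitivity (initial m (shift n (concat u (concat w point)))).
    by apply/esym/initialP; exact: agree_shift h.
  by rewrite iter_shift_concat_tuple initial_concat.
have mxi p : measurable (xi @^-1` [set p]).
  by rewrite xiE; exact: measurable_ball_cyl.
have -> : \int[mu]_x (F x * G (shift n x)) =
    \sum_(p : n.-tuple A * m.-tuple A) F (concat p.1 point) * G (concat p.2 point) * pr mu (xi @^-1` [set p]).
  rewrite -(Rint_finite mu mxi (fun p : n.-tuple A * m.-tuple A => F (concat p.1 point) * G (concat p.2 point))).
  apply: eq_Rintegral => x _ /=; congr (_ * _).
    by apply: nF; exact: concat_initial_agree.
  by apply: mG; exact: concat_initial_agree.
rewrite (@Rint_fdim _ _ mu n F point nF) (@Rint_fdim _ _ mu m G point mG).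
rewrite big_distrlr/= pair_bigA/= mulr_sumr; apply: ler_sum => -[u w] _ /=.
rewrite mulrACA [leLHS]mulrCA ler_wpM2l ?mulr_ge0// xiE/=.
set z := concat u (concat w point).
have -> : pr mu (@initial A n @^-1` [set u]) = cyl_measure n z.
  by rewrite (ball_cyl_initial u (concat w point)).
have -> : pr mu (@initial A m @^-1` [set w]) = cyl_measure m (shift n z).
  by rewrite (ball_cyl_initial w point) /z iter_shift_concat_tuple.
apply: le_trans (gibbs_lower (n + m) z); rewrite birkhoffD.
apply: (@le_trans _ _ (mixing_const * (expR (birkhoff phi n z + C) *
    expR (birkhoff phi m (shift n z) + C)))).
  rewrite ler_wpM2l ?expR_ge0//.
  by apply: ler_pM; rewrite ?gibbs_upper// /cyl_measure pr_ge0.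
by rewrite /mixing_const -!expRD ler_expR; lra.
Qed.

(** A factor [1 - s] at each visit, at the times [n0], [n0 + l], ..., of the
    cylinder of length [l] around [z]. *)
Definition visit_weight (s : R) l z n0 j x : R :=
  \prod_(i < j) (1 - s * \1_(ball_cyl l z) (shift (n0 + i * l) x)).

Lemma fdim_visit_weight s l z n0 j : fdim_fun (n0 + j * l) (visit_weight s l z n0 j).
Proof.
move=> x y xy; apply: eq_bigr => i _; rewrite !indicE; congr (1 - s * (nat_of_bool _)%:R).
apply: (@fdim_mem _ l); first exact: fdim_agree.
apply: agree_shift; apply: agree_le xy.
by rewrite -addnA leq_add2l -mulSnr leq_mul2r ltn_ord orbT.
Qed.

Lemma visit_weight_ge0 s l z n0 j x : 0 <= s <= 1 -> 0 <= visit_weight s l z n0 j x.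
Proof.
move=> /andP[s0 s1]; apply: prodr_ge0 => i _; rewrite indicE.
by case: (_ \in _) => /=; rewrite ?mulr1 ?mulr0; lra.
Qed.

Lemma mixing_cyl01 l z : 0 < mixing_const * cyl_measure l z <= 1.
Proof.
apply/andP; split.
  by rewrite mulr_gt0 ?expR_gt0// (lt_le_trans _ (gibbs_lower _ _)) ?expR_gt0.
rewrite -[leRHS]mulr1; apply: ler_pM; rewrite ?expR_ge0 /cyl_measure ?pr_ge0//.
  rewrite /mixing_const -[leRHS]expR0 ler_expR.
  by have := distortion_ge0 dphi; lra.
exact: pr_le1 (measurable_ball_cyl _ _).
Qed.

(** Visits are frequent: independently of the past, a visit has probability
    at least [mixing_const * cyl_measure l z]. *)
Lemma visit_decay (s : R) l z n0 j (F : X -> R) : 0 <= s <= 1 ->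
  fdim_fun n0 F -> (forall x, 0 <= F x) ->
  \int[mu]_x (F x * visit_weight s l z n0 j x) <=
  (1 - s * (mixing_const * cyl_measure l z)) ^+ j * \int[mu]_x F x.
Proof.
move=> s01 nF F0; have /andP[s0 s1] := s01.
have bV : bmeas (\1_(ball_cyl l z) : X -> R).
  by apply: bmeas_indic; exact: measurable_ball_cyl.
have fV : fdim_fun l (\1_(ball_cyl l z) : X -> R).
  by move=> x y xy; rewrite !indicE (fdim_mem (@fdim_agree _ l z) xy).
have V0 x : 0 <= (\1_(ball_cyl l z) : X -> R) x by rewrite indicE ler0n.
have /andP[/ltW m0 m1] := mixing_cyl01 l z.
elim: j => [|j IH].
  rewrite expr0 mul1r le_eqVlt; apply/orP; left; apply/eqP.
  by apply: eq_Rintegral => x _; rewrite /visit_weight big_ord0 mulr1.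
set H := fun x => F x * visit_weight s l z n0 j x in IH.
have fH : fdim_fun (n0 + j * l) H.
  move=> x y xy; rewrite /H (@fdim_visit_weight s l z n0 j _ _ xy); congr (_ * _).
  by apply: nF; apply: agree_le xy; exact: leq_addr.
have H0 x : 0 <= H x by rewrite mulr_ge0// visit_weight_ge0.
have bH : bmeas H by exact: fdim_bmeas fH.
have bHV : bmeas (fun x => H x * \1_(ball_cyl l z) (shift (n0 + j * l) x)).
  by apply: bmeasM => //; exact: bmeas_shift.
have -> : \int[mu]_x (F x * visit_weight s l z n0 j.+1 x) =
    \int[mu]_x H x - s * \int[mu]_x (H x * \1_(ball_cyl l z) (shift (n0 + j * l) x)).
  rewrite -mulNr -RintZ// -RintD//; last exact: bmeasZ.
  by apply: eq_Rintegral => x _; rewrite /H /visit_weight big_ord_recr/=; ring.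
have := mixing_lower fH fV H0 V0; rewrite Rint_indic; last exact: measurable_ball_cyl.
rewrite -/(cyl_measure l z) exprS => mix.
have h := ler_wpM2l s0 mix.
apply: (@le_trans _ _ ((1 - s * (mixing_const * cyl_measure l z)) * \int[mu]_x H x)).
  by move: h; move: (\int[mu]_x H x) (cyl_measure l z) mixing_const => a b c'; lra.
rewrite -mulrA ler_wpM2l// subr_ge0.
by apply: le_trans m1; rewrite ler_piMl.
Qed.

(** ** Averages along periodic orbits *)

(** The averages of [phi] along periodic orbits. *)
Definition periodic_means : set R :=
  [set r | exists k x, [/\ (0 < k)%N, shift k x = x & r = birkhoff phi k x / k%:R]].

Definition max_mean : R := sup periodic_means.

Lemma has_sup_periodic_means : has_sup periodic_means.
Proof.
split.
  by exists (birkhoff phi 1 (fun=> point) / 1%:R), 1%N, (fun=> point).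
exists 0 => _ [k [x [k0 _ ->]]].
by rewrite pmulr_lle0 ?invr_gt0 ?ltr0n// birkhoff_le0.
Qed.

Lemma birkhoff_periodic_le k x : (0 < k)%N -> shift k x = x ->
  birkhoff phi k x <= k%:R * max_mean.
Proof.
move=> k0 kx; rewrite mulrC -ler_pdivrMr ?ltr0n//.
by apply: sup_upper_bound; [exact: has_sup_periodic_means|exists k, x].
Qed.

(** By closing orbits up, periodic orbits control all Birkhoff sums. *)
Lemma birkhoff_le_max_mean n x : birkhoff phi n x <= n%:R * max_mean + C.
Proof.
case: n => [|n]; first by rewrite birkhoff0 mul0r add0r; exact: distortion_ge0 dphi.
apply: le_trans (distortion_le dphi (repeat_word_agree x)) _.
rewrite lerD2r; apply: birkhoff_periodic_le => //.
by rewrite -{1}(size_tuple (initial n.+1 x)); exact: repeat_word_shift.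
Qed.

Lemma birkhoff_mul k x m : shift k x = x ->
  birkhoff phi (m * k) x = m%:R * birkhoff phi k x.
Proof.
move=> kx; elim: m => [|m IH]; first by rewrite birkhoff0 mul0r.
by rewrite mulSn birkhoffD kx IH -natr1 mulrDl mul1r addrC.
Qed.

(** Along a periodic orbit, Birkhoff sums are bounded below linearly; the loss of
    one period makes up for incomplete ones, as [phi <= 0]. *)
Lemma birkhoff_periodic_ge k x n : (0 < k)%N -> shift k x = x ->
  (n + k)%:R * (birkhoff phi k x / k%:R) <= birkhoff phi n x.
Proof.
move=> k0 kx; have k0' : 0 < k%:R :> R by rewrite ltr0n.
have := birkhoff_mul (n %/ k).+1 kx.
have -> : ((n %/ k).+1 * k = n + (k - n %% k))%N.
  by rewrite {2}(divn_eq n k) mulSn; have := ltn_pmod n k0; lia.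
rewrite birkhoffD => E.
apply: (@le_trans _ _ ((n %/ k).+1%:R * birkhoff phi k x)).
  rewrite mulrA mulrAC ler_wnM2r ?birkhoff_le0// ler_pdivlMr// -natrM ler_nat.
  by rewrite mulSn addnC leq_add2r leq_trunc_div.
by rewrite -E gerDl birkhoff_le0.
Qed.

(** Returning at time [k] forces the orbit to shadow a periodic one for [n]
    further steps, hence a bound that does not depend on [k]. *)
Lemma return_upper n k : (0 < k)%N ->
  pr mu [set x | agree n (shift k x) x] <= expR (3 * C) * expR (n%:R * max_mean).
Proof.
move=> k0.
have sub : [set x | agree n (shift k x) x] `<=`
    \bigcup_(w : k.-tuple A) ball_cyl (n + k) (repeat_word w).
  move=> x h; exists (initial k x) => //.
  by apply: agree_sym; exact: agree_repeat_word.
have mB (w : k.-tuple A) : measurable (ball_cyl (n + k) (repeat_word w)).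
  exact: measurable_ball_cyl.
have mD : measurable [set x | agree n (shift k x) x].
  exact: fdim_measurable (@fdim_return _ n k).
have mU : measurable (\bigcup_(w : k.-tuple A) ball_cyl (n + k) (repeat_word w)).
  exact: fin_bigcup_measurable.
apply: le_trans (pr_le mu mD mU sub) _.
apply: le_trans (pr_bigcup_le _ mB) _.
rewrite -[leRHS]mul1r -[X in X * _](cyl_measure_sum k point) mulr_suml.
apply: ler_sum => w _.
have pw : shift k (repeat_word w) = repeat_word w.
  by rewrite -{1}(size_tuple w) repeat_word_shift.
have -> : cyl_measure k (concat w point) = cyl_measure k (repeat_word w).
  apply: fdim_cyl_measure => i ik; rewrite concat_nth /repeat_word !size_tuple ik.
  by rewrite modn_small.
apply: le_trans (gibbs_upper _ _) _.
rewrite addnC birkhoffD pw.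
apply: (@le_trans _ _ (expR (birkhoff phi k (repeat_word w) - C) * (expR (3 * C) * expR (n%:R * max_mean)))).
  rewrite -!expRD ler_expR; have := birkhoff_le_max_mean n (repeat_word w); lra.
by rewrite ler_wpM2r ?mulr_ge0 ?expR_ge0// gibbs_lower.
Qed.

(** Near a [k]-periodic point, the prefix of length [n] occurs again at time
    [k]. *)
Lemma return_lower n k x : (0 < k)%N -> shift k x = x ->
  expR ((n + (k + k))%:R * (birkhoff phi k x / k%:R) - C) <=
  pr mu [set y | agree n (shift k y) y].
Proof.
move=> k0 kx.
have mD : measurable [set y | agree n (shift k y) y].
  exact: fdim_measurable (@fdim_return _ n k).
apply: (@le_trans _ _ (cyl_measure (n + k) x)).
  apply: le_trans (gibbs_lower _ _); rewrite ler_expR lerB// addnA.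
  exact: birkhoff_periodic_ge.
apply: pr_le => //; first exact: measurable_ball_cyl.
move=> y h i ni /=; rewrite iter_shiftE -!h; [|lia..].
by rewrite -iter_shiftE kx.
Qed.

(** If some periodic orbit is not maximizing, then visits close to it make the
    mean measure of cylinders of length [n] exponentially smaller than
    [exp(n * max_mean)]. *)
Lemma cyl_measure_decay k x : (0 < k)%N -> shift k x = x ->
  birkhoff phi k x < k%:R * max_mean ->
  exists l rho, [/\ (0 < l)%N, 0 < rho < 1 & forall j,
    \int[mu]_x cyl_measure (j * l) x <=
    expR (2 * C) * expR ((j * l)%:R * max_mean) * rho ^+ j].
Proof.
move=> k0 kx lt.
(* [m] periods lose enough, at least [C + ln 2], to make up for the gain [C]
   that is possible on the rest of the orbit, and still halve the weight *)
pose d := k%:R * max_mean - birkhoff phi k x.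
have d0 : 0 < d by rewrite subr_gt0.
pose m := (Num.truncn ((2 * C + ln 2) / d)).+1.
pose l := (m * k)%N.
have l0 : (0 < l)%N by rewrite muln_gt0 k0.
pose psi n y := birkhoff phi n y - n%:R * max_mean.
have psiD n n' y : psi (n + n')%N y = psi n y + psi n' (shift n y).
  by rewrite /psi birkhoffD natrD; ring.
have psiC n y : psi n y <= C.
  by rewrite /psi lerBlDr addrC birkhoff_le_max_mean.
have psiV y : ball_cyl l x y -> psi l y <= - C - ln 2.
  move=> ly; have := distortion_le dphi (agree_sym ly).
  rewrite {2}/l birkhoff_mul// /psi {2}/l natrM => h.
  have : (2 * C + ln 2) / d < m%:R by exact: truncnS_gt.
  rewrite ltr_pdivrMr// /d => h'.
  move: (birkhoff phi k x) h h' => a; set b := m%:R; set b' := k%:R; set g := max_mean.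
  lra.
(* each visit, among the blocks after time [n0], costs a factor [1 / 2] *)
have key j n0 y : expR (psi (n0 + j * l)%N y) <= expR C * visit_weight (1 / 2) l x n0 j y.
  elim: j n0 y => [|j IH] n0 y.
    by rewrite /visit_weight big_ord0 mulr1 mul0n addn0 ler_expR.
  rewrite /visit_weight big_ord_recl mul0n addn0 indicE.
  have [/set_mem yV|yV] := boolP (shift n0 y \in ball_cyl l x); last first.
    rewrite /= mulr0 subr0 mul1r; have := IH (n0 + l)%N y.
    rewrite -addnA -mulSn => /le_trans; apply.
    rewrite le_eqVlt; apply/orP; left; apply/eqP; congr (_ * _).
    by apply: eq_bigr => i _ /=; rewrite -addnA -mulSn.
  rewrite mulSn psiD psiD.
  have IHy := IH 0%N (shift l (shift n0 y)); rewrite add0n in IHy.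
  have -> : \prod_(i < j) (1 - 1 / 2 * \1_(ball_cyl l x) (shift (n0 + lift ord0 i * l) y)) =
      visit_weight (1 / 2) l x 0 j (shift l (shift n0 y)).
    apply: eq_bigr => i _; rewrite -!iterD; congr (1 - _ * \1__ (iter _ _ _)).
    by rewrite /= /bump /= add1n mulSn; lia.
  rewrite (expRD (psi n0 y)) (expRD (psi l (shift n0 y))) /=.
  have W0 : 0 <= visit_weight (1 / 2) l x 0 j (shift l (shift n0 y)).
    by apply: visit_weight_ge0; lra.
  have h1 : expR (psi n0 y) <= expR C by rewrite ler_expR.
  have h2 : expR (psi l (shift n0 y)) <= expR (- C) / 2.
    by rewrite -[X in _ / X](@lnK _ 2) ?posrE// -expRN -expRD ler_expR psiV.
  have h3 : expR (psi l (shift n0 y)) * expR (psi (j * l)%N (shift l (shift n0 y))) <=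
     1 / 2 * visit_weight (1 / 2) l x 0 j (shift l (shift n0 y)).
    apply: le_trans (ler_pM (expR_ge0 _) (expR_ge0 _) h2 IHy) _.
    have e1 : expR (- C) * expR C = 1 by rewrite -expRD addNr expR0.
    move: (visit_weight _ _ _ _ _ _) => W.
    have -> : expR (- C) / 2 * (expR C * W) = expR (- C) * expR C * (1 / 2 * W) by ring.
    by rewrite e1 mul1r.
  apply: le_trans (ler_pM (expR_ge0 _) _ h1 h3) _; first by rewrite mulr_ge0 ?expR_ge0.
  by rewrite mulr1; lra.
pose eta := 1 / 2 * (mixing_const * cyl_measure l x).
have /andP[m0 m1] := mixing_cyl01 l x.
exists l, (1 - eta); split => //; first by rewrite /eta; apply/andP; split; lra.
move=> j; set n := (j * l)%N.
have fW := @fdim_visit_weight (1 / 2) l x 0 j.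
have s01 : 0 <= (1 / 2 : R) <= 1 by apply/andP; split; lra.
have bW : bmeas (visit_weight (1 / 2) l x 0 j) by exact: fdim_bmeas fW.
have h y : cyl_measure n y <=
    expR (2 * C) * expR (n%:R * max_mean) * visit_weight (1 / 2) l x 0 j y.
  apply: le_trans (gibbs_upper n y) _.
  have -> : birkhoff phi n y + C = C + n%:R * max_mean + psi n y by rewrite /psi; ring.
  have := key j 0%N y; rewrite add0n -/n => hk.
  rewrite expRD; apply: le_trans (ler_wpM2l (expR_ge0 _) hk) _.
  by rewrite mulrA -!expRD le_eqVlt; apply/orP; left; apply/eqP; congr (expR _ * _); lra.
apply: le_trans (_ : \int[mu]_y (expR (2 * C) * expR (n%:R * max_mean) *
    visit_weight (1 / 2) l x 0 j y) <= _).
  apply: Rint_le => //; last exact: bmeasZ.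
  exact: fdim_bmeas (@fdim_cyl_measure n).
rewrite RintZ// ler_wpM2l ?mulr_ge0 ?expR_ge0//.
have := @visit_decay (1 / 2) l x 0 j (fun=> 1) s01 (fun _ _ _ => erefl) (fun=> ler01).
rewrite Rint_cst mulr1 -/eta; apply: le_trans.
by under [leRHS]eq_Rintegral do rewrite mul1r.
Qed.

End gibbs_measure.

(** * A Livsic theorem on the full shift *)

Section livsic.
Context {R : realType} {A : alphabetType}.
Notation X := (shift_space A).
Notation shift k := (iter k (@left_shift A)).
Implicit Types (x y z : X) (n m k l : nat).
Variables (psi : X -> R) (v tail : nat -> R).
Hypothesis vpsi : variation_bound psi v.
Hypothesis v_tail : forall n m, \sum_(i < n) v (m + i.+1)%N <= tail m.
Hypothesis tail0 : forall e, 0 < e -> exists m, tail m <= e.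
Hypothesis psi_periodic : forall k x, (0 < k)%N -> shift k x = x ->
  birkhoff psi k x = 0.

Let birkhoff_tail n m x y : agree (n + m) x y ->
  `|birkhoff psi n x - birkhoff psi n y| <= tail m.
Proof. by move=> xy; apply: le_trans (v_tail n m); exact: variation_birkhoff. Qed.

(** Birkhoff sums over a common future: close both orbits up by a long common
    word, so as to compare them with periodic orbits. *)
Let birkhoff_common_future n l x y : (n <= l)%N -> agree n x y ->
  shift l x = shift l y -> `|birkhoff psi l x - birkhoff psi l y| <= tail n.
Proof.
move=> nl xy exy; apply/ler_addgt0Pr => e e0.
have [N hN] := tail0 (divr_gt0 e0 (ltr0n R 2)).
pose M := (l + N)%N.
have [l0|l0] := posnP l.
  rewrite l0 !birkhoff0 subrr normr0.
  have : 0 <= tail n by have := v_tail 0 n; rewrite big_ord0.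
  by move: e0; lra.
pose p z := repeat_word (initial M z).
have pM z : shift M (p z) = p z.
  by rewrite -{1}(size_tuple (initial M z)) repeat_word_shift.
have pz z : agree M z (p z) := @repeat_word_agree _ M z.
have s0 z : birkhoff psi l (p z) = - birkhoff psi N (shift l (p z)).
  apply/eqP; rewrite -addr_eq0 -birkhoffD; apply/eqP.
  by apply: psi_periodic => //; rewrite /M addn_gt0 l0.
have hz z := @birkhoff_tail l N z (p z) (pz z).
have h : `|birkhoff psi N (shift l (p x)) - birkhoff psi N (shift l (p y))| <= tail n.
  apply: birkhoff_tail => i iNn; rewrite !iter_shiftE.
  have [iN|Ni] := ltnP i N.
    rewrite -(pz x) -?(pz y) ?/M; [|lia..].
    by rewrite -!iter_shiftE exy.
  have -> : (l + i = M + (i - N))%N by rewrite /M; lia.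
  rewrite -!iter_shiftE !pM -(pz x) -?(pz y); [|rewrite /M; lia..].
  by apply: xy; lia.
have := hz x; have := hz y; have := s0 x; have := s0 y; move: h hN.
rewrite !ler_norml.
move=> /andP[a1 a2] a3 -> -> /andP[a5 a6] /andP[a7 a8].
by apply/andP; split; lra.
Qed.

Let a : A := point.

(** The sequence [a ... a x], with [n] letters [a]. *)
Let pad n x : X := iter n (prepend a) x.

Let padS n x : left_shift (pad n.+1 x) = pad n x. Proof. by []. Qed.

Let pad_agree n m x y : agree m x y -> agree (n + m) (pad n x) (pad n y).
Proof. by move=> xy; elim: n => //= n IH; rewrite addSn; exact: agree_prepend. Qed.

Let shift_pad n x : shift n (pad n x) = x.
Proof. by elim: n x => [//|n IH] x; rewrite iterSr padS. Qed.

Let pad_cst n : pad n (fun=> a) = (fun=> a).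
Proof.
by elim: n => //= n ->; apply/funext => -[|i].
Qed.

(** [H n x] converges to the transfer function [h], up to sign. *)
Let H n x : R := birkhoff psi n (pad n x).

Let HS n x : H n.+1 x = psi (pad n.+1 x) + H n x.
Proof. by rewrite /H birkhoffS. Qed.

Let psi_pad n x : `|psi (pad n x)| <= v n.
Proof.
have p0 : psi (fun=> a) = 0.
  by have := @psi_periodic 1 (fun=> a) isT erefl; rewrite /birkhoff big_ord1.
rewrite -[psi _]subr0 -p0 -(pad_cst n); apply: vpsi.
by rewrite -[n in agree n]addn0; exact: pad_agree.
Qed.

Let H_cauchy n m x : `|H (n + m) x - H n x| <= tail n.
Proof.
apply: le_trans (v_tail m n); elim: m => [|m IH].
  by rewrite addn0 subrr normr0 big_ord0.
rewrite big_ord_recr/= addnS HS.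
have -> : psi (pad (n + m).+1 x) + H (n + m) x - H n x =
    (H (n + m) x - H n x) + psi (pad (n + m).+1 x) by ring.
by apply: le_trans (ler_normD _ _) _; apply: lerD => //; exact: psi_pad.
Qed.

Let H_cvg x : cvgn (H^~ x).
Proof.
apply: cauchy_cvg; apply/cauchy_exP => e e0.
have [m hm] := tail0 (divr_gt0 e0 (ltr0n R 2)).
exists (H m x); exists m => // n /= mn; rewrite /ball /= distrC.
rewrite -(subnKC mn); apply: le_lt_trans (H_cauchy _ _ _) _.
by apply: le_lt_trans hm _; move: e0; lra.
Qed.

Let h x : R := limn (H^~ x).

Let hH n x : `|h x - H n x| <= tail n.
Proof.
have c : (fun k => `|H k x - H n x|) @ \oo --> `|h x - H n x|.
  by apply: cvg_norm; apply: cvgB; [exact: H_cvg|exact: cvg_cst].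
apply: (cvgr_to_le c); exists n => // k /= nk.
by rewrite -(subnKC nk); exact: H_cauchy.
Qed.

Let h_ucont : ucont h.
Proof.
move=> e e0; have [m hm] := tail0 e0; exists m => x y xy.
apply: le_trans hm.
have c : (fun k => `|H k x - H k y|) @ \oo --> `|h x - h y|.
  by apply: cvg_norm; apply: cvgB; exact: H_cvg.
apply: (cvgr_to_le c); apply: nearW => k.
by apply: birkhoff_tail; exact: pad_agree.
Qed.

Let h_cohomology b x : h (prepend b x) + psi (prepend b x) = h x.
Proof.
apply/eqP; rewrite -subr_eq0 -normr_le0; apply/ler_addgt0Pr => e e0.
have [n hn] := tail0 (divr_gt0 e0 (ltr0n R 4)).
have E : birkhoff psi n.+1 (pad n (prepend b x)) = H n (prepend b x) + psi (prepend b x).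
  by rewrite -addn1 birkhoffD shift_pad /birkhoff big_ord1.
have h1 : `|birkhoff psi n.+1 (pad n (prepend b x)) - H n.+1 x| <= tail n.
  apply: birkhoff_common_future => //.
    rewrite /pad iterSr -[n in agree n]addn0; exact: pad_agree.
  by rewrite shift_pad iterS shift_pad.
have h2 := hH n (prepend b x); have h3 := hH n x.
have h4 : `|H n.+1 x - H n x| <= tail n by rewrite -addn1; exact: H_cauchy.
rewrite add0r; move: h1 h2 h3 h4; rewrite E !ler_norml.
move=> /andP[a1 a2] /andP[a3 a4] /andP[a5 a6] /andP[a7 a8].
by apply/andP; split; lra.
Qed.

(** A function of summable variation with null sums along periodic orbits is a
    coboundary, with continuous transfer function. *)
Lemma livsic : exists u : X -> R, continuous u /\
  forall x, psi x = u x - u (left_shift x).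
Proof.
exists (fun x => - h x); split.
  apply: ucont_continuous => e /h_ucont[n hn]; exists n => x y /hn.
  by rewrite -opprD normrN.
move=> x; have := h_cohomology (x 0%N) (left_shift x).
by rewrite prepend_left_shift; lra.
Qed.

End livsic.

(** * Moments of first occurrence times *)

Section growth.
Context {R : realType}.

(** The tangent line of [ln] at [e ^-1]. *)
Lemma ln_le_linear (e t : R) : 0 < e -> 0 < t -> ln t <= e * t - 1 - ln e.
Proof.
move=> e0 t0; have et : 0 < e * t by rewrite mulr_gt0.
have := @le_ln1Dx R (e * t - 1); rewrite [1 + _]addrC subrK lnM ?posrE//.
by move=> /(_ ltac:(lra)); lra.
Qed.

Lemma harmonic_le (K : nat) : (0 < K)%N ->
  \sum_(k < K) (k.+1%:R)^-1 <= 1 + ln K%:R :> R.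
Proof.
elim: K => // -[_ _|K IH _]; first by rewrite big_ord1 ln1 addr0 invr1.
rewrite big_ord_recr/=.
have K1 : 0 < K.+1%:R :> R by rewrite ltr0n.
have K2 : 0 < K.+2%:R :> R by rewrite ltr0n.
have : ln (K.+1%:R / K.+2%:R) <= - K.+2%:R^-1 :> R.
  have := @le_ln1Dx R (- K.+2%:R^-1).
  have -> : 1 + - K.+2%:R^-1 = K.+1%:R / K.+2%:R :> R.
    move: K2; rewrite -[K.+2%:R]natr1 => K2; field.
    by rewrite gt_eqF.
  by apply; rewrite ltrN2 invf_lt1// ltr1n.
rewrite ln_div ?posrE// lerBlDr => h; apply: le_trans (lerD (IH isT) (lexx _)) _.
by rewrite -addrA lerD2l -lerBrDr addrC.
Qed.

(** Exponential rates of sequences bounded up to subexponential factors. *)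
Lemma cvg_rate (u : nat -> \bar R) (r : R) :
  (forall e, 0 < e -> exists K, forall n, (0 < n)%N ->
     ((expR (n%:R * (r - e) - K))%:E <= u n <= (expR (n%:R * (r + e) + K))%:E)%E) ->
  ((n%:R^-1)%:E * lne (u n))%E @[n --> \oo] --> r%:E.
Proof.
move=> h.
have fin n : (0 < n)%N -> exists2 s, 0 < s & u n = s%:E.
  move=> n0; have [K /(_ n n0)] := h 1 ltr01.
  case: (u n) => [s|/andP[_]|/andP[]]; rewrite ?leye_eq ?leeNy_eq//.
  by rewrite !lee_fin => /andP[hs _]; exists s => //; apply: lt_le_trans hs; rewrite expR_gt0.
apply/fine_cvgP; split.
  exists 1%N => // n /= n0; have [s s0 ->] := fin n n0.
  by rewrite lne_EFin.
apply/cvgrPdist_le => e e0 /=.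
have e20 : 0 < e / 2 by rewrite divr_gt0.
have [K hK] := h _ e20.
exists (Num.truncn (2 * `|K| / e)).+1 => // n /= nK.
have n0 : (0 < n)%N by exact: leq_trans nK.
have n0' : 0 < n%:R :> R by rewrite ltr0n.
have := hK n n0; have [s s0 ->] := fin n n0.
rewrite lne_EFin// !lee_fin => /andP[l1 l2].
have nK' : 2 * `|K| < n%:R * e.
  rewrite -ltr_pdivrMr//; apply: lt_le_trans (truncnS_gt _) _.
  by rewrite ler_nat.
have {}l1 : n%:R * (r - e / 2) - K <= ln s by rewrite -ler_expR lnK.
have {}l2 : ln s <= n%:R * (r + e / 2) + K by rewrite -ler_expR lnK.
have [k1 k2] : - K <= `|K| /\ K <= `|K|.
  by rewrite ler_norm -normrN ler_norm.
rewrite ler_norml; apply/andP; split.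
  rewrite lerNl opprB lerBlDl ler_pdivrMl//; lra.
by rewrite lerBlDl -lerBlDr ler_pdivlMl//; lra.
Qed.

End growth.

Section first_time.
Context {d : measure_display} {T : measurableType d} {R : realType}.
Variable P : probability T R.
Variable D : nat -> set T.
Hypothesis mD : forall k, measurable (D k).
Implicit Types (y : T) (k K : nat) (q : R).

(** The first [k >= 1] such that [D k] occurs, or [+oo]; the value of [D 0] is
    irrelevant. *)
Definition first_time y : \bar R :=
  ereal_inf [set k%:R%:E | k in [set k | (1 <= k)%N /\ D k y]].

(** No occurrence at times [1], ..., [K]. *)
Definition no_time K : set T := [set y | forall k, (1 <= k <= K)%N -> ~ D k y].

(** The first occurrence is at time [k]. *)
Let hit k : set T := [set y | [/\ (1 <= k)%N, D k y & no_time k.-1 y]].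

Let hit_first_time k y : hit k y -> first_time y = k%:R%:E.
Proof.
move=> [k1 Dk no]; apply/eqP; rewrite eq_le; apply/andP; split.
  by apply: ereal_inf_lbound; exists k.
apply: le_ereal_inf_tmp => _ [j [j1 Dj] <-]; rewrite lee_fin ler_nat leqNgt.
by apply/negP => jk; apply: (no j) => //; rewrite j1; lia.
Qed.

Let first_time_or y : (exists k, hit k y) \/ (forall K, no_time K y).
Proof.
have [[k Hk]|no] := pselect (exists k, (1 <= k)%N /\ D k y); last first.
  by right=> K k /andP[k1 _] Dk; apply: no; exists k.
left; have ex : exists k, `[< (1 <= k)%N /\ D k y >] by exists k; apply/asboolP.
case: (ex_minnP ex) => m /asboolP[m1 Dm] mmin.
exists m; split=> // j /andP[j1 jm] Dj.
have := mmin j; rewrite asboolT; last by [].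
by move=> /(_ isT); lia.
Qed.

Let first_time_infty y : (forall K, no_time K y) -> first_time y = +oo%E.
Proof.
move=> no; rewrite /first_time (_ : [set _ | _ in _] = set0) ?ereal_inf0//.
apply/seteqP; split => // t [k [k1 Dk] _].
by apply: (no k k); rewrite ?k1 ?leqnn.
Qed.

Lemma measurable_no_time K : measurable (no_time K).
Proof.
have -> : no_time K = \bigcap_(k in [set k | (1 <= k <= K)%N]) ~` D k.
  by apply/seteqP; split => y h k; exact: h.
by apply: bigcap_measurableType => k _; exact: measurableC.
Qed.

Let measurable_hit k : measurable (hit k).
Proof.
have [k1|k1] := boolP (1 <= k)%N; last first.
  by rewrite (_ : hit k = set0)//; apply/seteqP; split => // y []; rewrite (negbTE k1).
have -> : hit k = D k `&` no_time k.-1 by apply/seteqP; split => y []; split.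
by apply: measurableI => //; exact: measurable_no_time.
Qed.

(** No regularity of [h] is needed, as the time takes countably many values. *)
Lemma measurable_first_time (h : \bar R -> \bar R) :
  measurable_fun setT (h \o first_time).
Proof.
move=> _ B mB; rewrite setTI.
have -> : (h \o first_time) @^-1` B =
    (\bigcup_k (if pselect (B (h k%:R%:E)) then hit k else set0)) `|`
    (if pselect (B (h +oo%E)) then \bigcap_K no_time K else set0).
  apply/seteqP; split => y /=.
    have [[k hk]|no] := first_time_or y.
      rewrite (hit_first_time hk) => Bk; left; exists k => //.
      by case: pselect.
    rewrite (first_time_infty no) => By; right.
    by case: pselect => // _ K _; exact: no.
  move=> [[k _]|]; case: pselect => // Bk.
    by move=> /hit_first_time ->.
  by move=> no; rewrite first_time_infty// => K; exact: no.
apply: measurableU.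
  by apply: bigcup_measurable => k _; case: pselect => ?; [exact: measurable_hit|exact: measurable0].
by case: pselect => ?; [apply: bigcapT_measurable => K; exact: measurable_no_time|exact: measurable0].
Qed.

(** The moment of order [q] of the first occurrence time. *)
Definition moment q : \bar R := (\int[P]_y time_power (first_time y) q)%E.

Let time_power_nat k q : (0 < k)%N ->
  time_power (k%:R%:E : \bar R) q = (expR (q * ln k%:R))%:E.
Proof. by move=> k0; rewrite /time_power lne_EFin ?ltr0n. Qed.

Let time_power_ge0 t q : (0 <= time_power (t : \bar R) q)%E.
Proof. exact: expeR_ge0. Qed.

Let measurable_power q :
  measurable_fun setT (fun y => time_power (first_time y) q).
Proof. exact: (measurable_first_time (time_power^~ q)). Qed.

Let time_power_infty q : q < 0 -> time_power (+oo%E : \bar R) q = 0%E.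
Proof. by move=> q0; rewrite /time_power [lne _]/= mulry ltr0_sg// mulN1e. Qed.

Lemma moment_le (q1 q2 : R) : q1 <= q2 <= 0 -> (moment q1 <= moment q2)%E.
Proof.
move=> /andP[q12 q20]; apply: ge0_le_integral => // y _.
have [[k hk]|no] := first_time_or y.
  have [k1 _ _] := hk; rewrite (hit_first_time hk) !time_power_nat//.
  by rewrite lee_fin ler_expR ler_wpM2r// ln_ge0// ler1n.
rewrite first_time_infty//; move: q20; rewrite [q2 <= 0]le_eqVlt => /predU1P[e2|n2]; last first.
  by rewrite !time_power_infty//; exact: le_lt_trans n2.
move: q12; rewrite e2 le_eqVlt => /predU1P[->//|n1].
by rewrite time_power_infty.
Qed.

(** ** Lower bounds of moments *)

Lemma moment_ge_first q : ((pr P (D 1))%:E <= moment q)%E.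
Proof.
rewrite -Rint_indic// -EFin_Rint; last exact: bmeas_indic.
apply: ge0_le_integral => //.
- by apply/measurable_EFinP; exact: measurable_indic.
move=> y _; rewrite indicE; have [/set_mem Dy|_] := boolP (y \in D 1); last by [].
have h1 : hit 1 y by split => // k; lia.
by rewrite (hit_first_time h1) time_power_nat// ln1 mulr0 expR0.
Qed.

Lemma moment_ge_early q K : q <= 0 -> (0 < K)%N ->
  ((expR (q * ln K%:R) * (1 - pr P (no_time K)))%:E <= moment q)%E.
Proof.
move=> q0 K0; have mN := measurable_no_time K.
rewrite -prC// -Rint_indic; last exact: measurableC.
have bN : bmeas (\1_(~` no_time K) : T -> R) by apply: bmeas_indic; exact: measurableC.
rewrite -RintZ// -EFin_Rint; last exact: bmeasZ.
apply: ge0_le_integral => //.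
- by apply/measurable_EFinP; have [] := bmeasZ (expR (q * ln K%:R)) bN.
move=> y _; rewrite indicE; have [/set_mem Ny|_] := boolP (y \in ~` no_time K); last first.
  by rewrite mulr0.
rewrite mulr1; have [[k hk]|no] := first_time_or y; last by have := Ny (no K).
have [k1 _ nk] := hk; rewrite (hit_first_time hk) time_power_nat// lee_fin ler_expR.
have kK : (k <= K)%N.
  rewrite leqNgt; apply/negP => Kk; apply: Ny => j /andP[j1 jK].
  by apply: nk; rewrite j1; lia.
by rewrite ler_wnM2l// ler_ln ?posrE ?ltr0n// ler_nat.
Qed.

Lemma moment_ge_late q K (r : R) : 0 <= q -> 0 < r -> r <= K.+1%:R ->
  ((expR (q * ln r) * pr P (no_time K))%:E <= moment q)%E.
Proof.
move=> q0 r0 rK; have mN := measurable_no_time K.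
have bN : bmeas (\1_(no_time K) : T -> R) by exact: bmeas_indic.
rewrite -Rint_indic// -RintZ// -EFin_Rint; last exact: bmeasZ.
apply: ge0_le_integral => //.
- by apply/measurable_EFinP; have [] := bmeasZ (expR (q * ln r)) bN.
move=> y _; rewrite indicE; have [/set_mem Ny|_] := boolP (y \in no_time K); last first.
  by rewrite mulr0.
rewrite mulr1; have [[k hk]|no] := first_time_or y.
  have [k1 Dk _] := hk; rewrite (hit_first_time hk) time_power_nat// lee_fin ler_expR.
  have kK : (K < k)%N.
    by rewrite ltnNge; apply/negP => kK; apply: (Ny k) => //; rewrite k1.
  rewrite ler_wpM2l// ler_ln ?posrE ?ltr0n//; apply: le_trans rK _.
  by rewrite ler_nat.
rewrite first_time_infty//; move: q0; rewrite le_eqVlt => /predU1P[<-|q0].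
  by rewrite mul0r expR0 /time_power mul0e expeR0.
by rewrite /time_power [lne _]/= mulry gtr0_sg// mul1e leey.
Qed.

(** ** Upper bounds of moments *)

Lemma moment_le_cutoff q K (M : R) : q < 0 -> (0 < K)%N ->
  (forall k, (0 < k)%N -> pr P (D k) <= M) ->
  (moment q <= (\sum_(k < K) expR (q * ln k.+1%:R) * M + expR (q * ln K%:R))%:E)%E.
Proof.
move=> q0 K0 hM.
have bD k : bmeas (\1_(D k) : T -> R) by exact: bmeas_indic.
pose f y := \sum_(k < K) expR (q * ln k.+1%:R) * \1_(D k.+1) y + expR (q * ln K%:R).
have bf : bmeas f.
  by apply: bmeasD; [apply: bmeas_sum => k; exact: bmeasZ|exact: bmeas_cst].
apply: (@le_trans _ _ (\int[P]_y (f y)%:E)%E); last first.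
  rewrite EFin_Rint// lee_fin /f RintD ?Rint_cst; last exact: bmeas_cst.
    rewrite lerD2r Rint_sum; last by move=> k; exact: bmeasZ.
    apply: ler_sum => k _; rewrite RintZ// Rint_indic//.
    by rewrite ler_wpM2l ?expR_ge0// hM.
  by apply: bmeas_sum => k; exact: bmeasZ.
have f0 y : 0 <= \sum_(k < K) expR (q * ln k.+1%:R) * \1_(D k.+1) y.
  by apply: sumr_ge0 => k _; rewrite mulr_ge0 ?expR_ge0// indicE ler0n.
apply: ge0_le_integral => //; first by apply/measurable_EFinP; case: bf.
move=> y _; have [[k hk]|no] := first_time_or y; last first.
  rewrite first_time_infty// time_power_infty// lee_fin.
  by rewrite addr_ge0// expR_ge0.
have [k1 Dk _] := hk; rewrite (hit_first_time hk) time_power_nat// lee_fin /f.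
have [kK|Kk] := leqP k K; last first.
  apply: le_trans (_ : expR (q * ln K%:R) <= _); last by rewrite lerDr.
  by rewrite ler_expR ler_wnM2l ?(ltW q0)// ler_ln ?posrE ?ltr0n// ler_nat ltnW.
case: k k1 Dk kK {hk} => // k _ Dk kK.
apply: le_trans (_ : \sum_(k < K) expR (q * ln k.+1%:R) * \1_(D k.+1) y <= _);
  last by rewrite lerDl expR_ge0.
rewrite (bigD1 (Ordinal kK))//= indicE mem_set// mulr1 lerDl.
by apply: sumr_ge0 => j _; rewrite mulr_ge0 ?expR_ge0// indicE ler0n.
Qed.

(** If every occurrence has probability at most [kap * exp(- s)], moments of
    order [q] in [[-1, 0[] are at most of order [exp(q s)]. *)
Lemma moment_le_neg q (s kap : R) : -1 <= q < 0 -> 0 <= s -> 0 <= kap ->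
  (forall k, (0 < k)%N -> pr P (D k) <= kap * expR (- s)) ->
  (moment q <= (expR (q * s) * (2 * kap * (2 + s) + 1))%:E)%E.
Proof.
move=> /andP[q1 q0] s0 kap0 hM.
(* the cutoff [exp s], rounded up *)
pose K := (Num.truncn (expR s)).+1.
have es1 : 1 <= expR s by rewrite -[leLHS]expR0 ler_expR.
have K1 : expR s <= K%:R by exact/ltW/truncnS_gt.
have K2 : K%:R <= 2 * expR s.
  by rewrite /K -natr1; have /andP[+ _] := truncn_itv (expR_ge0 s); lra.
have Kp : 0 < K%:R :> R by rewrite ltr0n.
have lnK1 : s <= ln K%:R by rewrite -ler_expR lnK.
have lnK2 : ln K%:R <= ln 2 + s.
  by rewrite -ler_expR expRD !lnK ?posrE.
have ln2 : ln 2 <= 1 :> R.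
  have := @le_ln1Dx R 1; rewrite (_ : 1 + 1 = 2)//; apply; lra.
have K0 : (0 < K)%N by [].
apply: le_trans (moment_le_cutoff q0 K0 hM) _; rewrite lee_fin mulrDr mulr1.
apply: lerD; last by rewrite ler_expR ler_wnM2l ?(ltW q0).
rewrite -mulr_suml.
have h : \sum_(k < K) expR (q * ln k.+1%:R) <= expR ((q + 1) * ln K%:R) * (1 + ln K%:R) :> R.
  apply: (@le_trans _ _ (\sum_(k < K) expR ((q + 1) * ln K%:R) * (k.+1%:R)^-1)).
    apply: ler_sum => k _.
    rewrite -[X in _ <= _ * X](@lnK _ k.+1%:R^-1) ?posrE ?invr_gt0 ?ltr0n//.
    rewrite lnV ?posrE ?ltr0n// -expRD ler_expR.
    have : (q + 1) * ln k.+1%:R <= (q + 1) * ln K%:R.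
      rewrite ler_wpM2l//; first by lra.
      by rewrite ler_ln ?posrE ?ltr0n// ler_nat.
    by lra.
  by rewrite -mulr_sumr ler_wpM2l ?expR_ge0// harmonic_le.
have h2 : expR ((q + 1) * ln K%:R) <= 2 * expR ((q + 1) * s).
  rewrite -[X in _ <= X * _](@lnK _ 2) ?posrE// -expRD ler_expR.
  have ln20 : 0 <= ln 2 :> R by rewrite ln_ge0// ler1n.
  by have := ler_wpM2l (_ : 0 <= q + 1) lnK2 => /(_ ltac:(lra)); nra.
have kM : 0 <= kap * expR (- s) by rewrite mulr_ge0 ?expR_ge0.
apply: le_trans (ler_wpM2r kM h) _.
have h3 : expR ((q + 1) * ln K%:R) * (1 + ln K%:R) <= 2 * expR ((q + 1) * s) * (2 + s).
  by apply: ler_pM => //; rewrite ?expR_ge0//; lra.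
apply: le_trans (ler_wpM2r kM h3) _.
have -> : expR ((q + 1) * s) = expR (q * s) * expR s by rewrite -expRD; congr expR; ring.
have e1 : expR s * expR (- s) = 1 by rewrite -expRD subrr expR0.
rewrite le_eqVlt; apply/orP; left; apply/eqP.
transitivity (expR (q * s) * (2 * kap * (2 + s)) * (expR s * expR (- s))); first by ring.
by rewrite e1 mulr1.
Qed.

(** If the time is larger than [M i] with probability at most [4 ^ - i], its
    moments of order [q >= 0] are at most of order [M ^ q]. *)
Lemma moment_le_pos q M (c : R) : 0 <= q -> (0 < M)%N -> 0 <= c ->
  (forall i, expR (q * ln i.+1%:R) <= c * 2 ^+ i) ->
  (forall i, pr P (no_time (M * i)) <= (4 ^+ i)^-1) ->
  (moment q <= (2 * c * expR (q * ln M%:R))%:E)%E.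
Proof.
move=> q0 M0 c0 hc hP.
pose a i : R := expR (q * ln (M * i.+1)%:R).
have a1 i : 1 <= a i.
  by rewrite -[leLHS]expR0 ler_expR mulr_ge0// ln_ge0// ler1n muln_gt0 M0.
have bN i : bmeas (\1_(no_time (M * i)) : T -> R).
  by apply: bmeas_indic; exact: measurable_no_time.
pose f i y : \bar R := (a i * \1_(no_time (M * i)) y)%:E.
have f0 i y : (0 <= f i y)%E.
  rewrite lee_fin; apply: mulr_ge0; first exact: le_trans ler01 (a1 i).
  by rewrite indicE ler0n.
have mf i : measurable_fun setT (f i).
  by apply/measurable_EFinP; have [] := bmeasZ (a i) (bN i).
apply: (@le_trans _ _ (\int[P]_y (\sum_(i <oo) f i y))%E).
  apply: ge0_le_integral => //.
    by apply: ge0_emeasurable_sum.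
  move=> y _; have [[k hk]|no] := first_time_or y; last first.
    (* when the time is infinite, all the terms are at least [1] *)
    suff -> : (\sum_(i <oo) f i y = +oo)%E by rewrite leey.
    apply: eq_infty => t.
    apply: le_trans (nneseries_lim_ge (Num.truncn t).+1 (fun i _ _ => f0 i y)).
    rewrite big_mkord sumEFin lee_fin.
    apply: le_trans (ltW (truncnS_gt t)) _.
    rewrite -[X in X%:R <= _]card_ord -sumr_const; apply: ler_sum => i _.
    by rewrite indicE mem_set ?mulr1//; exact: no.
  have [k1 Dk nk] := hk; rewrite (hit_first_time hk) time_power_nat//.
  pose i := (k.-1 %/ M)%N.
  apply: le_trans (nneseries_lim_ge i.+1 (fun i _ _ => f0 i y)).
  rewrite big_mkord (bigD1 ord_max)//=.
  apply: le_trans (_ : f i y <= _)%E; last first.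
    by rewrite leeDl// sume_ge0.
  rewrite /f indicE mem_set ?mulr1.
    rewrite lee_fin ler_expR ler_wpM2l// ler_ln ?posrE ?ltr0n ?muln_gt0 ?M0//.
    rewrite ler_nat mulnC /i; have := ltn_ceil k.-1 M0; lia.
  move=> j /andP[j1 jM]; apply: nk; rewrite j1 (leq_trans jM)//.
  by rewrite mulnC leq_trunc_div.
rewrite integral_nneseries//.
have ca : 0 <= 2 * c * expR (q * ln M%:R).
  by rewrite mulr_ge0 ?expR_ge0// mulr_ge0.
apply: le_trans (epsilon_trick0 xpredT ca); apply: lee_nneseries => [i _ _|i _].
  by apply: integral_ge0.
rewrite /f EFin_Rint; last exact: bmeasZ.
rewrite RintZ// Rint_indic; last exact: measurable_no_time.
rewrite lee_fin.
apply: (@le_trans _ _ (c * 2 ^+ i * expR (q * ln M%:R) * (4 ^+ i)^-1)).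
  have ha : a i <= c * 2 ^+ i * expR (q * ln M%:R).
    rewrite /a natrM lnM ?posrE ?ltr0n// mulrDr expRD mulrC.
    by rewrite ler_wpM2r ?expR_ge0.
  by apply: ler_pM; rewrite ?pr_ge0 ?(le_trans ler01 (a1 i)).
have p2 : 2 ^+ i != 0 :> R by rewrite expf_neq0.
have -> : (4 : R) ^+ i = 2 ^+ i * 2 ^+ i by rewrite -exprMn; congr (_ ^+ _); ring.
rewrite natrX exprS le_eqVlt; apply/orP; left; apply/eqP.
by field.
Qed.

End first_time.

(** ** Exponential rates of moments *)

Section uniform_rate.
Context {d : measure_display} {T : measurableType d} {R : realType}.
Variable P : probability T R.
Variable D : nat -> nat -> set T.
Hypothesis mD : forall n k, measurable (D n k).
(** [exp(- n L)] is the order of the probability of an occurrence at a given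
    time, and occurrences in successive blocks of [n] times are likely enough
    to be hit as by independent trials. *)
Variables (L a c : R).
Hypothesis L0 : 0 <= L.
Hypothesis a0 : 0 <= a.
Hypothesis c01 : 0 < c <= 1.
Hypothesis hit_le : forall n k, (0 < k)%N -> pr P (D n k) <= a * expR (- (n%:R * L)).
Hypothesis late_le : forall n j, (0 < n)%N ->
  pr P (no_time (D n) (n * j)) <= (1 - c * expR (- (n%:R * L))) ^+ j.
Hypothesis hit_ge : forall n, c * expR (- (n%:R * L)) <= pr P (D n 1).

(** Powers grow slower than exponentials. *)
Lemma ln_subexponential (al e : R) : 0 <= al -> 0 < e ->
  exists K, forall n, (0 < n)%N -> al * ln n%:R <= n%:R * e + K.
Proof.
move=> al0 e0; pose f := e / (al + 1).
have al1 : 0 < al + 1 by lra.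
have f0 : 0 < f by rewrite divr_gt0.
exists (al * (- 1 - ln f)) => n n0.
have := @ln_le_linear R f n%:R f0; rewrite ltr0n => /(_ n0) h.
apply: le_trans (ler_wpM2l al0 h) _.
have -> : al * (f * n%:R - 1 - ln f) = n%:R * (al * f) + al * (- 1 - ln f) by ring.
rewrite lerD2r ler_wpM2l ?ler0n// /f mulrA ler_pdivrMr//; move: e0; nra.
Qed.

(** A number [J] of blocks, of order [exp(n L)], such that an occurrence before
    time [n J] has probability at least [3 / 4]. *)
Let blocks : exists t, 0 <= t /\ forall n, (0 < n)%N -> exists J,
  [/\ (0 < J)%N, ln J%:R <= n%:R * L + t &
   forall i, pr P (no_time (D n) (n * J * i)) <= (4 ^+ i)^-1].
Proof.
have /andP[c0 c1] := c01.
have l4 : 0 < ln 4 :> R by rewrite ln_gt0// ltr1n.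
pose t := ln 4 / c.
have t0 : 0 < t by rewrite divr_gt0.
exists (ln (t + 1)); split; first by rewrite ln_ge0// lerDr ltW.
move=> n n0; pose E := expR (n%:R * L).
have E1 : 1 <= E by rewrite -[leLHS]expR0 ler_expR mulr_ge0.
have EE : E * expR (- (n%:R * L)) = 1 by rewrite -expRD subrr expR0.
pose J := (Num.truncn (t * E)).+1.
have J1 : t * E <= J%:R by exact/ltW/truncnS_gt.
have J2 : J%:R <= (t + 1) * E.
  have tE : 0 <= t * E by rewrite mulr_ge0//; lra.
  by rewrite /J -natr1; have /andP[+ _] := truncn_itv tE; lra.
exists J; split => // [|i].
  rewrite -ler_expR expRD !lnK ?posrE ?ltr0n//; last by lra.
  by rewrite mulrC.
rewrite -mulnA; apply: le_trans (late_le (J * i) n0) _.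
set x := c * _.
have x0 : 0 <= x by rewrite mulr_ge0 ?expR_ge0// ltW.
have x1 : x <= 1.
  apply: (@le_trans _ _ (1 * 1)); last by rewrite mulr1.
  apply: ler_pM; rewrite ?expR_ge0 ?(ltW c0)// -[leRHS]expR0 ler_expR oppr_le0.
  by rewrite mulr_ge0.
have xJ : (1 - x) ^+ J <= 4^-1.
  apply: (@le_trans _ _ (expR (- x) ^+ J)).
    by rewrite lerXn2r ?nnegrE ?expR_ge0 ?subr_ge0//; exact: expR_ge1Dx.
  rewrite -expRM_natl -[4^-1](@lnK _ 4^-1) ?posrE ?invr_gt0//.
  rewrite ler_expR lnV ?posrE// mulrN lerN2.
  apply: le_trans (ler_wpM2r x0 J1); rewrite le_eqVlt; apply/orP; left; apply/eqP.
  transitivity (c * t * (E * expR (- (n%:R * L)))); last by rewrite /x; ring.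
  by rewrite EE mulr1 /t mulrCA divff ?mulr1// gt_eqF.
rewrite exprM -exprVn lerXn2r ?nnegrE ?invr_ge0//.
by rewrite exprn_ge0// subr_ge0.
Qed.

(** The bound of [moment_le_neg] along a sequence of families of events. *)
Lemma moment_upper_neg (q : R) n : -1 <= q < 0 -> (0 < n)%N ->
  (moment P (D n) q <= (expR (n%:R * (q * L) + ln (4 * a + 2 * a * L + 1) + ln n%:R))%:E)%E.
Proof.
move=> q01 n0.
have nL : 0 <= n%:R * L by rewrite mulr_ge0.
apply: le_trans (moment_le_neg (mD n) q01 nL a0 (hit_le n)) _.
rewrite lee_fin (mulrCA n%:R q L) !expRD -[leRHS]mulrA; apply: ler_wpM2l; first exact: expR_ge0.
have n1 : 1 <= n%:R :> R by rewrite ler1n.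
have aL : 0 <= a * L by rewrite mulr_ge0.
have k0 : 0 < 4 * a + 2 * a * L + 1.
  by rewrite ltr_wpDl// addr_ge0// ?mulr_ge0.
rewrite !lnK ?posrE ?ltr0n//.
have := ler_wpM2l a0 n1; move: n1 aL; nra.
Qed.

(** The exponential rates of the moments when the probabilities of occurrence
    are of order [exp(- n L)], uniformly. *)
Lemma moment_rate (q : R) :
  ((n%:R^-1)%:E * lne (moment P (D n) q))%E @[n --> \oo] -->
  (if -1 <= q then q * L else - L)%:E.
Proof.
have /andP[c0 c1] := c01.
have [t [t0 ht]] := blocks.
apply: cvg_rate => e e0.
have [q0|q0] := leP 0 q.
  have q1 : -1 <= q by lra.
  rewrite q1.
  have [K1 hK1] := @ln_subexponential q e q0 e0.
  have [K2 hK2] := @ln_subexponential q (ln 2) q0 (ltac:(by rewrite ln_gt0// ltr1n)).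
  pose C := expR (ln 2 + K2).
  pose b := 2 * (a + 1).
  have b0 : 0 < b by rewrite /b; move: a0; lra.
  exists (`|q * ln b| + ln 2 + `|K1| + `|q * t| + `|ln (2 * C)|) => n n0.
  have lnn : 0 <= ln n%:R :> R by rewrite ln_ge0// ler1n.
  have [J [J0 lJ hJ]] := ht n n0.
  have n0' : 0 < n%:R :> R by rewrite ltr0n.
  have ne : 0 <= n%:R * e by rewrite mulr_ge0// ltW.
  have l2 : 0 <= ln 2 :> R by rewrite ln_ge0// ler1n.
  apply/andP; split.
    pose r := expR (n%:R * L) / b.
    have r0 : 0 < r by rewrite divr_gt0// expR_gt0.
    pose K := Num.truncn r.
    have rK : r <= K.+1%:R by exact/ltW/truncnS_gt.
    have Kr : K%:R <= r by have /andP[] := truncn_itv (ltW r0).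
    apply: le_trans (moment_ge_late P (mD n) q0 r0 rK).
    have half : 1 / 2 <= pr P (no_time (D n) K).
      have mU : measurable (\bigcup_(k : 'I_K) D n k.+1) by exact: fin_bigcup_measurable.
      have : pr P (~` no_time (D n) K) <= 1 / 2.
        apply: (@le_trans _ _ (pr P (\bigcup_(k : 'I_K) D n k.+1))).
          apply: pr_le => //; first by apply: measurableC; exact: measurable_no_time.
          move=> y hy; apply: contrapT => no; apply: hy => k /andP[k1 kK] Dk.
          case: k k1 kK Dk => // k _ kK Dk; apply: no.
          by exists (Ordinal kK).
        apply: le_trans (@pr_bigcup_le _ _ _ P 'I_K (fun k => D n k.+1) (fun k => mD n k.+1)) _.
        apply: (@le_trans _ _ (\sum_(k < K) a * expR (- (n%:R * L)))).
          by apply: ler_sum => k _; exact: hit_le.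
        rewrite sumr_const card_ord -(mulr_natl (a * _)).
        have aE : 0 <= a * expR (- (n%:R * L)) by rewrite mulr_ge0 ?expR_ge0.
        apply: le_trans (ler_wpM2r aE Kr) _.
        have -> : r * (a * expR (- (n%:R * L))) =
            a / b * (expR (n%:R * L) * expR (- (n%:R * L))) by rewrite /r; ring.
        rewrite -expRD subrr expR0 mulr1 ler_pdivrMr// /b; move: a0; lra.
      rewrite prC; last exact: measurable_no_time.
      lra.
    rewrite lee_fin; apply: (@le_trans _ _ (expR (q * ln r) * (1 / 2))); last first.
      by rewrite ler_wpM2l ?expR_ge0.
    rewrite mul1r -[2^-1](@lnK _ 2^-1) ?posrE ?invr_gt0// -expRD ler_expR lnV ?posrE//.
    rewrite /r ln_div ?posrE ?expR_gt0// expRK.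
    have := ler_norm (q * ln b); have := normr_ge0 K1; have := normr_ge0 (q * t).
    have := normr_ge0 (ln (2 * C)); lra.
  have C0 : 0 <= C by exact: expR_ge0.
  have C1 : 0 < C by exact: expR_gt0.
  have nJ0 : (0 < n * J)%N by rewrite muln_gt0 n0.
  have hC i : expR (q * ln i.+1%:R) <= C * 2 ^+ i.
    have := hK2 i.+1 isT; rewrite -natr1 mulrDl mul1r => h.
    apply: (@le_trans _ _ (expR (i%:R * ln 2 + ln 2 + K2))).
      by rewrite ler_expR.
    by rewrite -addrA expRD mulrC ler_wpM2l// expRM_natl lnK ?posrE.
  apply: le_trans (moment_le_pos (mD n) q0 nJ0 C0 hC hJ) _.
  rewrite lee_fin -[X in X * _](@lnK _ (2 * C)) ?posrE ?mulr_gt0 ?expR_gt0//.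
  rewrite -expRD ler_expR natrM [ln (_ * J%:R)]lnM ?posrE ?ltr0n//.
  have := ler_wpM2l q0 lJ; have := hK1 n n0; have := ler_norm K1.
  have := ler_norm (q * t); have := ler_norm (ln (2 * C)).
  have := normr_ge0 (q * ln b); lra.
pose ka := ln (4 * a + 2 * a * L + 1).
have [K1 hK1] := @ln_subexponential 1 e ler01 e0.
have up q' n : -1 <= q' < 0 -> (0 < n)%N ->
    (moment P (D n) q' <= (expR (n%:R * (q' * L + e) + (ka + K1)))%:E)%E.
  move=> q'01 n0; apply: le_trans (moment_upper_neg q'01 n0) _.
  rewrite lee_fin ler_expR; have := hK1 n n0; rewrite mul1r /ka; lra.
have [q1|q1] := leP (-1) q; last first.
  exists (`|ka + K1| + `|ln c|) => n n0.
  have ne : 0 <= n%:R * e by rewrite mulr_ge0// ltW.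
  apply/andP; split.
    apply: le_trans (moment_ge_first P (mD n) q); rewrite lee_fin.
    apply: le_trans (hit_ge n); rewrite -[X in _ <= X * _](@lnK _ c) ?posrE//.
    rewrite -expRD ler_expR.
    have := ler_norm (- ln c); rewrite normrN; have := normr_ge0 (ka + K1); lra.
  apply: (@le_trans _ _ (moment P (D n) (-1))).
    by apply: moment_le; rewrite // (ltW q1); lra.
  apply: le_trans (up (-1) n _ n0) _; first by lra.
  rewrite lee_fin ler_expR mulN1r; have := ler_norm (ka + K1); have := normr_ge0 (ln c); lra.
have q10 : 0 <= - q by lra.
have [K2 hK2] := @ln_subexponential (- q) e q10 e0.
exists (`|ka + K1| + `|K2| + `|q * t| + ln 2) => n n0.
have l2 : 0 <= ln 2 :> R by rewrite ln_ge0// ler1n.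
have [J [J0 lJ hJ]] := ht n n0.
apply/andP; split.
  have nJ0 : (0 < n * J)%N by rewrite muln_gt0 n0.
  apply: le_trans (moment_ge_early P (mD n) (ltW q0) nJ0).
  have := hJ 1%N; rewrite muln1 expr1 => hp.
  have half : 1 / 2 <= 1 - pr P (no_time (D n) (n * J)).
    have : (4^-1 : R) <= 1 / 2 by lra.
    by lra.
  rewrite lee_fin; apply: (@le_trans _ _ (expR (q * ln (n * J)%:R) * (1 / 2))); last first.
    by rewrite ler_wpM2l ?expR_ge0.
  rewrite mul1r -[2^-1](@lnK _ 2^-1) ?posrE ?invr_gt0// -expRD ler_expR lnV ?posrE//.
  rewrite natrM lnM ?posrE ?ltr0n//.
  have := ler_wpM2l q10 lJ; have := hK2 n n0; have := ler_norm K2.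
  have := ler_norm (- (q * t)); rewrite normrN; have := normr_ge0 (ka + K1); lra.
apply: le_trans (up q n _ n0) _; first by rewrite q1.
rewrite lee_fin ler_expR; have := ler_norm (ka + K1); have := normr_ge0 K2.
have := normr_ge0 (q * t); lra.
Qed.

End uniform_rate.

(** * Return and waiting times of Gibbs measures *)

Section return_and_waiting.
Context {R : realType} {A : alphabetType}.
Notation X := (shift_space A).
Notation shift k := (iter k (@left_shift A)).
Implicit Types (x y z : X) (n m k l j : nat).
Variables (mu : probability X R).
Hypothesis inv : invariant_measure (@left_shift A) mu.

Let mu2 : probability (X * X)%type R := (mu \x mu)%E.

(** The word of length [n] of [x] occurs again at time [k]. *)
Definition return_set n k : set X := [set x | agree n (shift k x) x].

(** The word of length [n] of [p.1] occurs in [p.2] at time [k]. *)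
Definition waiting_set n k : set (X * X) := [set p | agree n (shift k p.2) p.1].

Lemma measurable_return_set n k : measurable (return_set n k).
Proof. exact: fdim_measurable (@fdim_return _ n k). Qed.

(** The measure of a set of pairs whose slice at [x] only depends on the first
    letters of [x]. *)
Lemma pr_slices n (E : set (X * X)) (B : n.-tuple A -> set X) :
  (forall w, measurable (B w)) -> (forall p, E p <-> B (initial n p.1) p.2) ->
  measurable E /\
  pr mu2 E = \sum_w pr mu (@initial A n @^-1` [set w]) * pr mu (B w).
Proof.
move=> mB EB.
pose F (w : n.-tuple A) : set (X * X) := (@initial A n @^-1` [set w]) `*` B w.
have mF w : measurable (F w).
  by apply: measurableX => //; exact: measurable_initial.
have EF : E = \bigcup_w F w.
  apply/seteqP; split => p.
    by move=> /EB h; exists (initial n p.1).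
  by move=> [w _ [/= pw Bp]]; apply/EB; rewrite pw.
have mE : measurable E by rewrite EF; exact: fin_bigcup_measurable.
split => //; rewrite -Rint_indic//.
have -> : \int[mu2]_p \1_E p = \int[mu2]_p \sum_w \1_(F w) p.
  apply: eq_Rintegral => p _; rewrite (bigD1 (initial n p.1))//= big1 ?addr0.
    rewrite !indicE; congr (nat_of_bool _)%:R; apply/idP/idP; rewrite !inE.
      by move=> /EB.
    by move=> [_ h]; apply/EB.
  move=> w wp; rewrite indicE memNset//= => -[/= e _].
  by rewrite e eqxx in wp.
rewrite Rint_sum; last by move=> w; exact: bmeas_indic.
apply: eq_bigr => w _; rewrite Rint_indic//; apply: EFin_inj.
rewrite -prE// EFinM -!prE//; first exact: product_measure1E (@measurable_initial A n w) (mB w).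
exact: measurable_initial.
Qed.

Let measurable_ball k n x : measurable (shift k @^-1` ball_cyl n x).
Proof.
rewrite -[X in measurable X]setTI; apply: measurable_fun_iter_shift => //.
exact: measurable_ball_cyl.
Qed.

Let waiting_setE n k p : waiting_set n k p <->
  (shift k @^-1` ball_cyl n (concat (initial n p.1) point)) p.2.
Proof.
have h : agree n p.1 (concat (initial n p.1) point) by exact: concat_initial_agree.
split=> [w|w] /=.
  exact: agree_trans (agree_sym h) (agree_sym w).
exact: agree_trans (agree_sym w) (agree_sym h).
Qed.

Lemma measurable_waiting_set n k : measurable (waiting_set n k).
Proof.
exact: (pr_slices (fun w => @measurable_ball k n (concat w point)) (@waiting_setE n k)).1.
Qed.

Lemma pr_waiting_set n k : pr mu2 (waiting_set n k) = \int[mu]_x cyl_measure mu n x.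
Proof.
rewrite (pr_slices (fun w => @measurable_ball k n (concat w point)) (@waiting_setE n k)).2.
rewrite (@Rint_fdim _ _ mu n _ point (@fdim_cyl_measure _ _ mu n)).
apply: eq_bigr => w _; rewrite mulrC; congr (_ * _).
by rewrite pr_shift//; exact: measurable_ball_cyl.
Qed.

(** The integrals that define the spectra are moments of first occurrence
    times. *)
Lemma return_moment n q :
  (\int[mu]_x time_power (return_time n x) q)%E = moment mu (return_set n) q.
Proof. by []. Qed.

Lemma waiting_moment n q :
  (\int[mu]_y \int[mu]_x time_power (waiting_time n x y) q)%E =
  moment mu2 (waiting_set n) q.
Proof.
pose f (p : X * X) := time_power (first_time (waiting_set n) p) q.
have mf : measurable_fun setT f.
  exact: (measurable_first_time (measurable_waiting_set n) (time_power^~ q)).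
by rewrite /moment -/f (@fubini_tonelli2 _ _ _ _ _ mu mu f mf)// => p; exact: expeR_ge0.
Qed.

Section gibbs.
Variables (phi : X -> R) (C : R).
Hypothesis nphi : normalized phi.
Hypothesis bphi : bmeas phi.
Hypothesis dphi : distortion phi C.
Hypothesis gibbs : forall n x,
  expR (birkhoff phi n x - C) <= cyl_measure mu n x <= expR (birkhoff phi n x + C).

(* the visits weighed here are at the times [n], [2 n], ..., [j n] *)
Let no_visit n z j y : (0 < n)%N ->
  (forall k, (1 <= k <= n * j)%N -> ~ ball_cyl n z (shift k y)) ->
  visit_weight (1 : R) n z n j y = 1.
Proof.
move=> n0 h; rewrite /visit_weight big1// => i _.
rewrite indicE memNset ?mulr0 ?subr0//; apply: h.
rewrite -mulSn mulnC leq_mul2l ltn_ord orbT andbT.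
by rewrite muln_gt0 n0.
Qed.

Let s01 : 0 <= (1 : R) <= 1. Proof. by rewrite ler01 lexx. Qed.

Let weight_decay n j z (eta : R) : eta <= mixing_const C * cyl_measure mu n z ->
  (1 - 1 * (mixing_const C * cyl_measure mu n z)) ^+ j <= (1 - eta) ^+ j.
Proof.
move=> h; have /andP[_ m1] := mixing_cyl01 dphi gibbs n z.
by rewrite mul1r lerXn2r ?nnegrE ?subr_ge0 ?lerB// (le_trans h).
Qed.

Let fdim_visits n z j : fdim_fun (n + j * n) (visit_weight (1 : R) n z n j).
Proof. exact: fdim_visit_weight. Qed.

Lemma waiting_late n j (eta : R) : (0 < n)%N ->
  (forall z, eta <= mixing_const C * cyl_measure mu n z) ->
  pr mu2 (no_time (waiting_set n) (n * j)) <= (1 - eta) ^+ j.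
Proof.
move=> n0 heta.
pose B (w : n.-tuple A) : set X :=
  [set y | forall k, (1 <= k <= n * j)%N -> ~ ball_cyl n (concat w point) (shift k y)].
have mB w : measurable (B w).
  have -> : B w = \bigcap_(k in [set k | (1 <= k <= n * j)%N])
      ~` (shift k @^-1` ball_cyl n (concat w point)).
    by apply/seteqP; split => y h k; exact: h.
  by apply: bigcap_measurableType => k _; apply: measurableC; exact: measurable_ball.
have EB p : no_time (waiting_set n) (n * j) p <-> B (initial n p.1) p.2.
  by split=> h k /h nk hk; apply: nk; apply/waiting_setE.
rewrite (pr_slices mB EB).2.
have bBw w : pr mu (B w) <= (1 - eta) ^+ j.
  rewrite -Rint_indic//; set z := concat w point.
  have := @visit_decay _ _ _ _ _ dphi gibbs 1 n z n j (fun=> 1) s01 (fun _ _ _ => erefl)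
    (fun=> ler01).
  rewrite Rint_cst mulr1 => h.
  apply: le_trans (weight_decay j (heta z)); apply: le_trans h.
  apply: Rint_le; first exact: bmeas_indic.
    by under eq_fun do rewrite mul1r; exact: fdim_bmeas (@fdim_visits n z j).
  move=> y; rewrite mul1r indicE; have [/set_mem By|_] := boolP (y \in B w).
    by rewrite no_visit.
  exact: visit_weight_ge0.
apply: (@le_trans _ _ (\sum_w pr mu (@initial A n @^-1` [set w]) * (1 - eta) ^+ j)).
  by apply: ler_sum => w _; rewrite ler_wpM2l ?pr_ge0.
by rewrite -mulr_suml (pr_finite_sum mu (@measurable_initial A n)) mul1r.
Qed.

Lemma return_late n j (eta : R) : (0 < n)%N ->
  (forall z, eta <= mixing_const C * cyl_measure mu n z) ->
  pr mu (no_time (return_set n) (n * j)) <= (1 - eta) ^+ j.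
Proof.
move=> n0 heta.
pose V (w : n.-tuple A) := @initial A n @^-1` [set w].
have mV w : measurable (V w) by exact: measurable_initial.
pose W (w : n.-tuple A) := visit_weight (1 : R) n (concat w point) n j.
have bW w : bmeas (fun x => \1_(V w) x * W w x).
  apply: bmeasM; first exact: bmeas_indic.
  exact: fdim_bmeas (@fdim_visits n (concat w point) j).
have W0 w x : 0 <= W w x by exact: visit_weight_ge0.
have mN : measurable (no_time (return_set n) (n * j)).
  by apply: measurable_no_time => k; exact: measurable_return_set.
rewrite -Rint_indic//.
apply: (@le_trans _ _ (\int[mu]_x \sum_w \1_(V w) x * W w x)).
  apply: Rint_le; [exact: bmeas_indic|exact: bmeas_sum|move=> x].
  rewrite [leLHS]indicE; have [/set_mem Nx|_] := boolP (x \in _); last first.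
    by apply: sumr_ge0 => w _; apply: mulr_ge0; [rewrite indicE ler0n|exact: W0].
  rewrite (bigD1 (initial n x))//= indicE mem_set// mul1r.
  rewrite /W no_visit// ?lerDl.
    by apply: sumr_ge0 => w _; apply: mulr_ge0; [rewrite indicE ler0n|exact: W0].
  move=> k k1 hk; apply: (Nx k k1).
  have h : agree n x (concat (initial n x) point) by exact: concat_initial_agree.
  exact: agree_trans (agree_sym hk) (agree_sym h).
rewrite Rint_sum//.
apply: (@le_trans _ _ (\sum_w (1 - eta) ^+ j * pr mu (V w))).
  apply: ler_sum => w _; rewrite -Rint_indic//; set z := concat w point.
  have fV : fdim_fun n (\1_(V w) : X -> R).
    have nV : fdim n (V w) by move=> x y /initialP xy <-; rewrite /V /= xy.
    by move=> x y xy; rewrite !indicE (fdim_mem nV xy).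
  have V0 x : 0 <= (\1_(V w) : X -> R) x by rewrite indicE ler0n.
  apply: le_trans (visit_decay dphi gibbs n z j s01 fV V0) _.
  by rewrite ler_wpM2r ?Rint_ge0// weight_decay.
by rewrite -mulr_sumr (pr_finite_sum mu (@measurable_initial A n)) mulr1.
Qed.

(** ** Uniform averages along periodic orbits *)
Section uniform.
Variable L : R.
Hypothesis L0 : 0 <= L.
Hypothesis uniform : forall k x, (0 < k)%N -> shift k x = x ->
  birkhoff phi k x = - (k%:R * L).

Lemma max_mean_uniform : max_mean phi = - L.
Proof.
have pL k x : (0 < k)%N -> shift k x = x -> birkhoff phi k x / k%:R = - L.
  move=> k0 kx; rewrite uniform// mulNr mulrAC divff ?mul1r//.
  by rewrite pnatr_eq0 -lt0n.
rewrite /max_mean (_ : periodic_means phi = [set - L]) ?sup1//.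
apply/seteqP; split => r.
  by move=> [k [x [k0 kx ->]]]; exact: pL.
by move=> ->; exists 1%N, (fun=> point); split => //; rewrite pL.
Qed.

Let birkhoff_uniform n x : - (n%:R * L) - C <= birkhoff phi n x <= - (n%:R * L) + C.
Proof.
have [->|n0] := posnP n.
  rewrite birkhoff0 mul0r oppr0 !add0r oppr_le0.
  by rewrite (distortion_ge0 dphi).
have px : shift n (repeat_word (initial n x)) = repeat_word (initial n x).
  by rewrite -{1}(size_tuple (initial n x)) repeat_word_shift.
have := dphi (@repeat_word_agree _ n x).
by rewrite (uniform n0 px) ler_norml => /andP[h1 h2]; apply/andP; split; lra.
Qed.

Let cyl_uniform n x : expR (- (2 * C)) * expR (- (n%:R * L)) <= cyl_measure mu n x <=
  expR (2 * C) * expR (- (n%:R * L)).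
Proof.
have /andP[g1 g2] := gibbs n x; have /andP[b1 b2] := birkhoff_uniform n x.
rewrite -!expRD; apply/andP; split.
  by apply: le_trans g1; rewrite ler_expR; lra.
by apply: le_trans g2 _; rewrite ler_expR; lra.
Qed.

Let c : R := expR (- (5 * C) - 2 * L).

Let C0 : 0 <= C. Proof. exact: distortion_ge0 dphi. Qed.

Let c01 : 0 < c <= 1.
Proof.
by rewrite expR_gt0 -[leRHS]expR0 ler_expR; move: C0 L0; lra.
Qed.

Let eta_le n z : c * expR (- (n%:R * L)) <= mixing_const C * cyl_measure mu n z.
Proof.
have /andP[h _] := cyl_uniform n z.
apply: le_trans (ler_wpM2l (expR_ge0 _) h).
by rewrite mulrA ler_wpM2r ?expR_ge0// /c -expRD ler_expR; move: L0; lra.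
Qed.

Lemma return_rate_uniform (q : R) :
  return_spectrum mu q = (if -1 <= q then q * L else - L)%:E.
Proof.
apply/cvg_lim => //.
apply: (@moment_rate _ _ _ mu return_set measurable_return_set L (expR (3 * C)) c) => //.
- move=> n k k0; have := return_upper nphi dphi gibbs n k0.
  by rewrite max_mean_uniform mulrN.
- by move=> n j n0; exact: return_late.
move=> n; have := return_lower nphi gibbs n (k := 1) (x := fun=> point) isT erefl.
apply: le_trans.
have -> : birkhoff phi 1 (fun=> point) / 1%:R = - L.
  by rewrite (uniform (k := 1) (x := fun=> point) isT erefl) mul1r divr1.
rewrite /c -expRD ler_expR natrD.
have -> : (1 + 1)%:R = 2 :> R by [].
move: C0; lra.
Qed.

Lemma waiting_rate_uniform (q : R) :
  waiting_spectrum mu q = (if -1 <= q then q * L else - L)%:E.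
Proof.
apply/cvg_lim => //.
under eq_fun do rewrite waiting_moment.
apply: (@moment_rate _ _ _ mu2 waiting_set measurable_waiting_set L (expR (3 * C)) c) => //.
- move=> n k k0; rewrite pr_waiting_set -[leRHS](Rint_cst mu).
  apply: Rint_le; [exact: fdim_bmeas (@fdim_cyl_measure _ _ mu n)|exact: bmeas_cst|].
  move=> x; have /andP[_ h] := cyl_uniform n x; apply: le_trans h _.
  by rewrite ler_wpM2r ?expR_ge0// ler_expR; move: C0; lra.
- by move=> n j n0; exact: waiting_late.
move=> n; rewrite pr_waiting_set -[leLHS](Rint_cst mu).
apply: Rint_le; [exact: bmeas_cst|exact: fdim_bmeas (@fdim_cyl_measure _ _ mu n)|].
move=> x; have /andP[h _] := cyl_uniform n x; apply: le_trans h.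
by rewrite ler_wpM2r ?expR_ge0// ler_expR; move: C0 L0; lra.
Qed.

End uniform.

End gibbs.

End return_and_waiting.

(** * Comparison of the two spectra at [q = -1] *)

Section spectra.
Context {R : realType} {A : alphabetType}.
Notation X := (shift_space A).
Notation shift k := (iter k (@left_shift A)).
Implicit Types (x y z : X) (n m k l j : nat).
Variables (mu : probability X R).
Hypothesis inv : invariant_measure (@left_shift A) mu.
Variables (phi : X -> R) (C : R).
Hypothesis nphi : normalized phi.
Hypothesis bphi : bmeas phi.
Hypothesis dphi : distortion phi C.
Hypothesis gibbs : forall n x,
  expR (birkhoff phi n x - C) <= cyl_measure mu n x <= expR (birkhoff phi n x + C).

Lemma max_mean_le0 : max_mean phi <= 0.
Proof.
apply: ge_sup; first by have [] := has_sup_periodic_means nphi.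
move=> _ [k [x [k0 _ ->]]].
by rewrite pmulr_lle0 ?invr_gt0 ?ltr0n// birkhoff_le0.
Qed.

(** With two letters at least, a normalized potential is bounded away from
    zero. *)
Lemma max_mean_lt0 : (1 < #|A|)%N -> max_mean phi < 0.
Proof.
move=> /card_gt1P[a [b [_ _ ab]]].
have [_ [M hM]] := bphi.
have phi_lt x : phi x <= - expR (- M).
  have [c cx] : exists c, c != x 0%N.
    by have [ax|ax] := eqVneq a (x 0%N); [exists b; rewrite -ax eq_sym|exists a].
  have := nphi (left_shift x); rewrite (bigD1 (x 0%N))//= (bigD1 c)//=.
  rewrite prepend_left_shift => e1.
  have h1 : expR (- M) <= expR (phi (prepend c (left_shift x))).
    rewrite ler_expR; have := hM (prepend c (left_shift x)).
    by rewrite ler_norml => /andP[].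
  have h2 : 0 <= \sum_(i | (i != x 0%N) && (i != c)) expR (phi (prepend i (left_shift x))).
    by apply: sumr_ge0 => i _; exact: expR_ge0.
  rewrite -ler_expR; have := expR_ge1Dx (- expR (- M)); lra.
apply: (@le_lt_trans _ _ (- expR (- M))); last by rewrite oppr_lt0 expR_gt0.
apply: ge_sup; first by have [] := has_sup_periodic_means nphi.
move=> _ [k [x [k0 _ ->]]]; rewrite ler_pdivrMr ?ltr0n// mulr_natr.
apply: (@le_trans _ _ (\sum_(i < k) - expR (- M))); first exact: ler_sum.
by rewrite sumr_const card_ord.
Qed.

(** At [q = -1], returns follow the maximizing periodic orbits. *)
Lemma return_spectrum_N1 : return_spectrum mu (-1) = (max_mean phi)%:E.
Proof.
pose g := max_mean phi.
have g0 : 0 <= - g by rewrite oppr_ge0 max_mean_le0.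
have hit n k : (0 < k)%N -> pr mu (return_set n k) <= expR (3 * C) * expR (- (n%:R * - g)).
  by move=> k0; rewrite mulrN opprK; exact: return_upper nphi dphi gibbs n _ k0.
apply/cvg_lim => //; apply: cvg_rate => e e0.
have [K1 hK1] := @ln_subexponential R 1 e ler01 e0.
(* the lower bound comes from one almost maximizing periodic orbit *)
have [r [k [x [k0 kx rE]]] hr] := sup_adherent e0 (has_sup_periodic_means nphi).
rewrite -/(max_mean phi) -/g rE in hr.
pose ka := ln (4 * expR (3 * C) + 2 * expR (3 * C) * - g + 1).
exists (`|K1| + `|ka| + `|ln k%:R - (k + k)%:R * (birkhoff phi k x / k%:R) + C|).
move=> n n0; rewrite return_moment -/g; apply/andP; split.
  have N10 : -1 <= 0 :> R by lra.
  apply: le_trans (moment_ge_early mu (measurable_return_set n) N10 k0).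
  have : pr mu (return_set n k) <= 1 - pr mu (no_time (return_set n) k).
    rewrite -prC; last by apply: measurable_no_time => i; exact: measurable_return_set.
    apply: pr_le; first exact: measurable_return_set.
      by apply: measurableC; apply: measurable_no_time => i; exact: measurable_return_set.
    by move=> y yk /(_ k); rewrite k0 leqnn; apply.
  move=> /(ler_wpM2l (expR_ge0 (-1 * ln k%:R))) h.
  rewrite lee_fin; apply: le_trans h.
  apply: le_trans (ler_wpM2l (expR_ge0 _) (return_lower nphi gibbs n k0 kx)).
  rewrite -expRD ler_expR (natrD _ n) mulrDl.
  have := ler_norm (ln k%:R - (k + k)%:R * (birkhoff phi k x / k%:R) + C).
  have := ler_wpM2l (ler0n R n) (ltW hr).
  have := normr_ge0 K1; have := normr_ge0 ka; lra.
have q1 : -1 <= (-1 : R) < 0 by apply/andP; split; lra.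
apply: le_trans (moment_upper_neg measurable_return_set g0 (expR_ge0 _) hit q1 n0) _.
rewrite lee_fin ler_expR mulN1r opprK -/ka.
have := hK1 n n0; rewrite mul1r; have := ler_norm K1; have := ler_norm ka.
have := normr_ge0 (ln k%:R - (k + k)%:R * (birkhoff phi k x / k%:R) + C); lra.
Qed.

(** At [q = -1], the exponential rate of the waiting times is smaller along a
    subsequence, unless all the periodic orbits are maximizing. *)
Lemma waiting_spectrum_N1 k x : (0 < k)%N -> shift k x = x ->
  birkhoff phi k x < k%:R * max_mean phi -> max_mean phi < 0 ->
  waiting_spectrum mu (-1) <> (max_mean phi)%:E.
Proof.
move=> k0 kx lt g0; set g := max_mean phi in lt g0 *.
have [l [rho [l0 /andP[r0 r1] decay]]] := cyl_measure_decay nphi dphi gibbs k0 kx lt.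
rewrite /waiting_spectrum; under eq_fun do rewrite waiting_moment.
set w := (fun n => _) => limE.
have cvw : cvgn w.
  (* a divergent sequence would have limit 0, which is not [g] *)
  have [//|/dvgP h] := pselect (cvgn w).
  by move: limE g0; rewrite h => -[<-]; rewrite ltxx.
have lr0 : ln rho < 0 by rewrite ln_lt0// r0.
have l0' : 0 < l%:R :> R by rewrite ltr0n.
(* along multiples of [l], the mean measure of cylinders is of order at most
   [exp(- j L')] *)
pose L' := - (l%:R * g + ln rho).
have L'0 : 0 <= L' by rewrite oppr_ge0; nra.
have hit j i : (0 < i)%N ->
    pr (mu \x mu)%E (waiting_set (j * l) i) <= expR (2 * C) * expR (- (j%:R * L')).
  move=> _; rewrite pr_waiting_set//; apply: le_trans (decay j) _.
  rewrite -mulrA ler_wpM2l ?expR_ge0// -{1}(@lnK _ rho) ?posrE// -expRM_natl -expRD.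
  rewrite ler_expR -/g natrM /L'; lra.
pose e := - ln rho / 4.
have e0 : 0 < e by rewrite /e divr_gt0// oppr_gt0.
have [K1 hK1] := @ln_subexponential R 1 e ler01 e0.
have q1 : -1 <= (-1 : R) < 0 by apply/andP; split; lra.
pose ka := ln (4 * expR (2 * C) + 2 * expR (2 * C) * L' + 1).
have up j : (0 < j)%N -> (w (j * l)%N <=
    ((j * l)%:R^-1 * (j%:R * (- L' + e) + (ka + K1)))%:E)%E.
  move=> j0; rewrite EFinM; apply: lee_wpmul2l; first by rewrite lee_fin invr_ge0.
  have h := moment_upper_neg (fun j => @measurable_waiting_set _ _ mu (j * l))
    L'0 (expR_ge0 _) hit q1 j0.
  have m0 : (0 <= moment (mu \x mu)%E (waiting_set (j * l)) (-1))%E.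
    by apply: integral_ge0 => y _; exact: expeR_ge0.
  rewrite -[leRHS]expeRK lee_lne ?in_itv/= ?m0 ?leey ?lee_fin ?expR_ge0//.
  apply: le_trans h _; rewrite lee_fin ler_expR mulN1r -/ka.
  by have := hK1 j j0; rewrite mul1r; lra.
have sub : (fun j => (j * l)%N) @ \oo --> \oo.
  move=> B [N _ hN]; exists N => // j /= Nj; apply: hN => /=.
  exact: leq_trans Nj (leq_pmulr _ l0).
have cv : (w \o (fun j => (j * l)%N)) @ \oo --> g%:E.
  by apply: (cvg_comp _ _ sub); rewrite -limE; exact: cvw.
have : (g%:E <= (g - e / l%:R)%:E)%E.
  apply: (cvge_to_le cv); exists (Num.truncn (`|ka + K1| / e)).+1 => // j /= jK.
  have j0 : (0 < j)%N by exact: leq_trans jK.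
  apply: le_trans (up j j0) _; rewrite lee_fin natrM.
  have j0' : 0 < j%:R :> R by rewrite ltr0n.
  have : `|ka + K1| / e < j%:R.
    by apply: lt_le_trans (truncnS_gt _) _; rewrite ler_nat.
  rewrite ltr_pdivrMr// => hj.
  rewrite ler_pdivrMl ?mulr_gt0//.
  have -> : j%:R * l%:R * (g - e / l%:R) = j%:R * (l%:R * g - e).
    by field; rewrite gt_eqF.
  have := ler_norm (ka + K1).
  have er : ln rho = - (4 * e) by rewrite /e; lra.
  rewrite /L' er; nra.
rewrite lee_fin; have : 0 < e / l%:R by rewrite divr_gt0.
lra.
Qed.

(** If all periodic orbits have the same average, it is [- ln #|A|]. *)
Lemma uniform_mean (g : R) :
  (forall k x, (0 < k)%N -> shift k x = x -> birkhoff phi k x = k%:R * g) ->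
  g = - ln #|A|%:R.
Proof.
move=> h.
have A0 : 0 < #|A|%:R :> R by rewrite ltr0n; apply/card_gt0P; exists point.
pose s := g + ln #|A|%:R.
have ub n : (0 < n)%N -> `|n%:R * s| <= C.
  move=> n0.
  have S x : n%:R * g - C <= birkhoff phi n x <= n%:R * g + C.
    have px : shift n (repeat_word (initial n x)) = repeat_word (initial n x).
      by rewrite -{1}(size_tuple (initial n x)) repeat_word_shift.
    have := dphi (@repeat_word_agree _ n x).
    by rewrite (h n _ n0 px) ler_norml => /andP[h1 h2]; apply/andP; split; lra.
  have sumE (r : R) : \sum_(w : n.-tuple A) expR (n%:R * g + r) = expR (n%:R * s + r).
    rewrite sumr_const card_tuple -(mulr_natl (expR _)) natrX.
    rewrite -{1}(@lnK _ #|A|%:R) ?posrE// -expRM_natl -expRD; congr expR.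
    by rewrite /s; ring.
  have := @normalized_words R A phi n point nphi.
  have : \sum_(w : n.-tuple A) expR (n%:R * g - C) <=
      \sum_(w : n.-tuple A) expR (birkhoff phi n (concat w point)).
    by apply: ler_sum => w _; rewrite ler_expR; have /andP[] := S (concat w point).
  have : \sum_(w : n.-tuple A) expR (birkhoff phi n (concat w point)) <=
      \sum_(w : n.-tuple A) expR (n%:R * g + C).
    by apply: ler_sum => w _; rewrite ler_expR; have /andP[] := S (concat w point).
  rewrite !sumE => h1 h2 e1; move: h1 h2; rewrite e1 -[1]expR0 !ler_expR.
  by move=> h1 h2; rewrite ler_norml; apply/andP; split; lra.
suff : s = 0 by rewrite /s; lra.
apply/eqP; apply: contraT => s0.
have s1 : 0 < `|s| by rewrite normr_gt0.
have := ub (Num.truncn (C / `|s|)).+1 isT.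
rewrite normrM normr_nat -ler_pdivlMr// leNgt truncnS_gt.
by [].
Qed.

End spectra.

Theorem theorem3p2 (R : realType) (A : alphabetType) (cardA : (1 < #|A|)%N)
    (phi : shift_space A -> R) (phi_sum : summable_variation phi)
    (phi_norm : normalized phi)
    (mu : probability (shift_space A) R) (mu_eq : equilibrium_state phi mu) :
  ((forall q : R, return_spectrum mu q = waiting_spectrum mu q) <->
   (exists u : shift_space A -> R,
      continuous u /\
      forall x : shift_space A, phi x = u x - u (left_shift x) - ln (#|A|%:R))) /\
  ((exists u : shift_space A -> R,
      continuous u /\
      forall x : shift_space A, phi x = u x - u (left_shift x) - ln (#|A|%:R)) ->
   forall q : R,
     waiting_spectrum mu q = return_spectrum mu q /\
     return_spectrum mu q =
       (if -1 <= q then q * ln (#|A|%:R) else - ln (#|A|%:R))%:E).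
Proof.
have [v [tail [vphi v0 vtail tail0]]] := summable_variationP phi_sum.
have v_sum n : \sum_(i < n) v i.+1 <= tail 0%N by exact: (vtail n 0%N).
have dphi : distortion phi (tail 0%N) by exact: variation_distortion vphi v_sum.
have uphi : ucont phi.
  move=> e /tail0[m hm]; exists m.+1 => x y xy.
  apply: le_trans (vphi _ _ _ xy) _; apply: le_trans hm.
  by have := vtail 1%N m; rewrite big_ord1 addn1.
have bphi := ucont_bmeas uphi.
have [inv mu_max] := mu_eq.
have fe : (0 <= free_energy phi mu)%E.
  by rewrite mu_max; exact: pressure_ge0 phi_norm vphi v_sum uphi.
have gibbs n x : expR (birkhoff phi n x - tail 0%N) <= cyl_measure mu n x <=
    expR (birkhoff phi n x + tail 0%N).
  exact (gibbs_bounds phi_norm vphi v0 v_sum uphi n x inv fe).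
have L0 : 0 <= ln #|A|%:R :> R by rewrite ln_ge0// ler1n ltnW.
have rates : (exists u : shift_space A -> R, continuous u /\
      forall x, phi x = u x - u (left_shift x) - ln #|A|%:R) ->
   forall q : R, waiting_spectrum mu q = return_spectrum mu q /\
     return_spectrum mu q =
       (if -1 <= q then q * ln #|A|%:R else - ln #|A|%:R)%:E.
  move=> [u [_ hu]] q.
  have uniform k x : (0 < k)%N -> iter k (@left_shift A) x = x ->
      birkhoff phi k x = - (k%:R * ln #|A|%:R).
    move=> _ kx.
    (* Birkhoff sums telescope *)
    have tele n : birkhoff phi n x = u x - u (iter n (@left_shift A) x) - n%:R * ln #|A|%:R.
      elim: n => [|n IH]; first by rewrite birkhoff0 mul0r subr0 subrr.
      by rewrite -addn1 birkhoffD IH /birkhoff big_ord1 hu natrD addn1; ring.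
    by rewrite tele kx subrr sub0r.
  rewrite (return_rate_uniform phi_norm dphi gibbs L0 uniform).
  by rewrite (waiting_rate_uniform inv dphi gibbs L0 uniform).
split; last exact: rates.
split; last by move=> /rates h q; have [] := h q.
move=> RW.
have g0 := max_mean_lt0 phi_norm bphi cardA.
have per k x : (0 < k)%N -> iter k (@left_shift A) x = x ->
    birkhoff phi k x = k%:R * max_mean phi.
  move=> k0 kx; apply/eqP; rewrite eq_le birkhoff_periodic_le//= leNgt.
  apply/negP => lt.
  apply: (waiting_spectrum_N1 inv phi_norm dphi gibbs k0 kx lt g0).
  by rewrite -RW; exact: return_spectrum_N1 phi_norm dphi gibbs.
have gE := uniform_mean phi_norm dphi per.
pose psi x := phi x + ln #|A|%:R.
have vpsi : variation_bound psi v.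
  by move=> n x y xy; rewrite /psi opprD addrACA subrr addr0; exact: vphi.
have psi0 k x : (0 < k)%N -> iter k (@left_shift A) x = x -> birkhoff psi k x = 0.
  move=> k0 kx; have := per k x k0 kx.
  rewrite gE /birkhoff big_split/= => ->.
  by rewrite sumr_const card_ord -(mulr_natl (ln _)) mulrN addNr.
have [u [cu hu]] := livsic vpsi vtail tail0 psi0.
by exists u; split => // x; rewrite -hu /psi addrK.
Qed.
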